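(* Let $\kappa>0$, let $\alpha$ satisfy Conditions C1 and C2, let $s>9/2$ and $f\in C^{[s]+1}(\mathbb{R})$ with $f(0)=0$. Let $u\in C^1([0,T],H^s(\mathbb{R}))$ be the solution of $u_t+\alpha'\ast f(u)+\kappa\,\alpha'''\ast u=0$, $u(x,0)=\varphi(x)$, with $\varphi\in H^s(\mathbb{R})$. Then for all sufficiently small $h>0$ and $\epsilon>0$ there is a positive integer $N$ such that the solution $\mathbf{u}^N_h$ of the finite system $$\frac{dv^N_i}{dt}=-\sum_{j=-N}^{N}h\,\alpha'(x_i-x_j)f(v^N_j)-\kappa\sum_{j=-N}^{N}h\,(D_h^2\boldsymbol{\alpha}'_h)_{i-j}\,v^N_j,\qquad -N\le i\le N,$$ with initial value $\mathbf{u}^N_h(0)=\mathcal{T}^N\boldsymbol{\varphi}_h$ exists for $t\in[0,T]$ and $$\big|u(ih,t)-(\mathbf{u}^N_h)_i(t)\big|\le C(h^2+\epsilon),\qquad t\in[0,T],\ -N\le i\le N,$$ with $C$ independent of $h$, $\epsilon$ and $N$.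
   Context: Condition C1: $\alpha\in W^{2,1}(\mathbb{R})$. Condition C2: the distributional third derivative $\alpha'''=\mu$ is a finite Borel measure on $\mathbb{R}$. Grid $x_i=ih$; $\boldsymbol{\alpha}'_h=(\alpha'(ih))_{i\in\mathbb{Z}}$; $(D_h^2\mathbf{u})_i=h^{-2}(u_{i+1}-2u_i+u_{i-1})$; $\boldsymbol{\varphi}_h=(\varphi(ih))_{i\in\mathbb{Z}}$; $\mathcal{T}^N\mathbf{v}=(v_{-N},\dots,v_N)$. $[s]$ is the integer part of $s$. *)

(* Defs.v *)
From HB Require Import structures.
From mathcomp Require Import all_boot all_order all_algebra.
From mathcomp Require Import all_classical all_reals all_analysis.

Set Implicit Arguments.
Unset Strict Implicit.
Unset Printing Implicit Defensive.

Import Order.TTheory GRing.Theory Num.Theory.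
Import numFieldNormedType.Exports.
Local Open Scope classical_set_scope.
Local Open Scope ring_scope.

Section Defs.
Variable R : realType.
Local Notation mu := (@lebesgue_measure R).

Definition Ck (k : nat) (f : R -> R) : Prop :=
  (forall n, (n < k)%N -> forall x, derivable (derive1n n f) x 1) /\
  continuous (derive1n k f).

Definition test_fun (phi : R -> R) : Prop :=
  (forall n x, derivable (derive1n n phi) x 1) /\
  exists M : R, forall x, M < `|x| -> phi x = 0.

Definition Rint (f : R -> R) : R := Rintegral mu setT f.

Definition L1 (u : R -> R) : Prop := mu.-integrable setT (EFin \o u).

Definition L2 (u : R -> R) : Prop :=
  measurable_fun setT u /\ mu.-integrable setT (EFin \o (fun x => u x ^+ 2)).

Definition weak_deriv (u g : R -> R) : Prop :=
  forall phi, test_fun phi ->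
    Rint (fun x => u x * (derive1 phi) x) = - Rint (fun x => g x * phi x).

Definition cos_tr (phi : R -> R) (xi : R) : R := Rint (fun x => phi x * cos (x * xi)).
Definition sin_tr (phi : R -> R) (xi : R) : R := Rint (fun x => phi x * sin (x * xi)).

(* g1 + i g2 is the (distributional) Fourier transform of u in L^2,
   with convention  u^(xi) = int u(x) e^{-i x xi} dx :
   <u^, phi> = <u, phi^> for all test functions phi. *)
Definition fourier_pair (u g1 g2 : R -> R) : Prop :=
  L2 u /\ measurable_fun setT g1 /\ measurable_fun setT g2 /\
  forall phi, test_fun phi ->
    Rint (fun xi => g1 xi * phi xi) = Rint (fun xi => u xi * cos_tr phi xi) /\
    Rint (fun xi => g2 xi * phi xi) = - Rint (fun xi => u xi * sin_tr phi xi).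

Definition Hs_bound (s : R) (u : R -> R) (M : R) : Prop :=
  exists g1 g2, fourier_pair u g1 g2 /\
    (\int[mu]_(xi in setT)
       (((1 + xi ^+ 2) `^ s * (g1 xi ^+ 2 + g2 xi ^+ 2))%:E) <= M%:E)%E.

Definition in_Hs (s : R) (u : R -> R) : Prop := exists M : R, Hs_bound s u M.

Definition Hs_cont (s T : R) (U : R -> R -> R) : Prop :=
  (forall t, 0 <= t <= T -> in_Hs s (U t)) /\
  forall t0, 0 <= t0 <= T -> forall e : R, 0 < e ->
    exists d : R, 0 < d /\ forall t, 0 <= t <= T -> `|t - t0| < d ->
      Hs_bound s (fun x => U t x - U t0 x) e.

Definition Hs_deriv (s T : R) (U W : R -> R -> R) : Prop :=
  forall t0, 0 <= t0 <= T -> forall e : R, 0 < e ->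
    exists d : R, 0 < d /\ forall t, 0 <= t <= T -> 0 < `|t - t0| < d ->
      Hs_bound s (fun x => (U t x - U t0 x) / (t - t0) - W t0 x) e.

Definition kconv (k g : R -> R) (x : R) : R := Rint (fun y => k (x - y) * g y).

Definition mconv (mu1 mu2 : {finite_measure set R -> \bar R}) (g : R -> R) (x : R) : R :=
  Rintegral mu1 setT (fun y => g (x - y)) - Rintegral mu2 setT (fun y => g (x - y)).

(* Condition C1: alpha in W^{2,1}(R), with weak derivatives da = alpha',
   d2a = alpha'' (da is taken to be its continuous representative). *)
Definition cond_C1 (alpha da d2a : R -> R) : Prop :=
  L1 alpha /\ L1 da /\ L1 d2a /\ weak_deriv alpha da /\ weak_deriv da d2a /\
  continuous da.

(* Condition C2: alpha''' = mu1 - mu2 is a finite (signed) Borel measure *)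
Definition cond_C2 (d2a : R -> R) (mu1 mu2 : {finite_measure set R -> \bar R}) : Prop :=
  forall phi, test_fun phi ->
    Rint (fun x => d2a x * derive1 phi x) =
    - (Rintegral mu1 setT phi - Rintegral mu2 setT phi).

Definition isum (N : nat) (F : int -> R) : R :=
  \sum_(k < (2 * N).+1) F (k%:Z - N%:Z).

Definition D2h (h : R) (da : R -> R) (k : int) : R :=
  h ^- 2 * (da ((k + 1)%:~R * h) - 2 * da (k%:~R * h) + da ((k - 1)%:~R * h)).

Definition semi_rhs (kappa h : R) (da f : R -> R) (N : nat) (v : int -> R) (i : int) : R :=
  - isum N (fun j => h * da ((i - j)%:~R * h) * f (v j))
  - kappa * isum N (fun j => h * D2h h da (i - j) * v j).

(* v : [0,T] -> R^{2N+1} (indexed by -N..N) solves the finite system with the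
   given initial value; derivatives are one-sided at the ends of [0,T]. *)
Definition semi_sol (kappa h T : R) (da f phi : R -> R) (N : nat) (v : R -> int -> R) : Prop :=
  (forall i : int, - (N%:Z) <= i <= N%:Z -> v 0 i = phi (i%:~R * h)) /\
  forall i : int, - (N%:Z) <= i <= N%:Z ->
  forall t, 0 <= t <= T -> forall e : R, 0 < e ->
    exists d : R, 0 < d /\ forall t', 0 <= t' <= T -> 0 < `|t' - t| < d ->
      `|(v t' i - v t i) / (t' - t) - semi_rhs kappa h da f N (v t) i| < e.

End Defs.

(* Main.v *)
Require Import Defs.
From HB Require Import structures.
From mathcomp Require Import all_boot all_order all_algebra.
From mathcomp Require Import all_classical all_reals all_analysis.
From mathcomp Require Import measurable_realfun real_interval.
From mathcomp Require Import ring lra zify.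
(* [Rint] would otherwise denote the qualifier of [archimedean]. *)
Import Defs.
Import Order.TTheory GRing.Theory Num.Theory.
Import numFieldNormedType.Exports.
Local Open Scope classical_set_scope.
Local Open Scope ring_scope.

Set Implicit Arguments.
Unset Strict Implicit.
Unset Printing Implicit Defensive.

(* The scheme is stable because the l^1 norms of its two kernels are bounded
   uniformly in h and N: for h alpha'(ih) by the L^1 norm and the total variation
   of alpha', for h D_h^2 alpha'(ih) because second differences of alpha' are integrals of hat
   functions against the measure alpha'''. That same representation identifies
   the discrete sum for alpha''' * u with the integral, against this measure, of
   the piecewise linear interpolant of u, whose error is O(h^2). The sum for
   alpha' * f(u) is a trapezoidal rule; since alpha'' is only integrable and
   alpha''' only a measure, its O(h^2) error comes from symmetrizing each cell
   around its midpoint and summing by parts the mixed second differences of the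
   product. The bounds on u needed here (size, increments, mixed differences)
   are instances of one estimate for finite functionals sum_i a_i u(X_i) by the
   H^s norm. Truncation to |i| <= N costs the size of u outside [-Nh, Nh], which
   is small uniformly on [0, T] by compactness. A barrier argument of Gronwall
   type then keeps the error below delta exp((A+1)t) <= 1, where f is Lipschitz;
   existence follows by first solving the system with f composed with a clamp. *)

(** * Integration on the line *)

(** The Fourier transform is given only through its pairing with test functions, so functionals of
    [u] have to be estimated without an inversion formula. Testing with a wide cutoff times a cosine
    or a sine turns the frequency side into a convolution of [u] with the cosine transform of the
    cutoff. That kernel is dominated by a Poisson kernel and has integral at least 1/2, which
    replaces normalisation at the cost of a factor 2. Independence of [h] and [N] always has the
    same source: on each cell the quantity is bounded, up to powers of [h], by the increment of a
    bounded function ([cumul] of an integrable function, or [cdf] of a measure), and such increments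
    telescope. Tails are pushed below a threshold [eta] rather than summed, and [eta] is capped so
    that the barrier at 1 is available for every positive eps. *)

Lemma Rintegral_sum {R : realType} d (T : measurableType d)
    (m : {measure set T -> \bar R}) n (F : nat -> T -> R) :
  (forall i, (i < n)%N -> m.-integrable setT (EFin \o F i)) ->
  m.-integrable setT (EFin \o (fun x => \sum_(i < n) F i x)) /\
  Rintegral m setT (fun x => \sum_(i < n) F i x) = \sum_(i < n) Rintegral m setT (F i).
Proof.
elim: n => [|n IH] iF.
  rewrite big_ord0; have -> : (fun x => \sum_(i < 0) F i x) = cst 0.
    by apply/funext => x; rewrite big_ord0.
  by split; [exact: integrable0|rewrite Rintegral_cst// mul0r].
have [i1 E1] := IH (fun i h => iF i (ltn_trans h (ltnSn n))).
have -> : (fun x => \sum_(i < n.+1) F i x) = (fun x => \sum_(i < n) F i x + F n x).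
  by apply/funext => x; rewrite big_ord_recr.
have iFn := iF n (ltnSn n).
split; first exact: (integrableD measurableT i1 iFn).
by rewrite RintegralD// E1 big_ord_recr.
Qed.

Section IntegralFacts.
Context {R : realType}.
Local Notation mu := (@lebesgue_measure R).
Implicit Types f g : R -> R.

Definition integ f := mu.-integrable setT (EFin \o f).

Lemma continuous_integrable_itv f (a b : R) : continuous f ->
  mu.-integrable `[a, b] (EFin \o f).
Proof.
move=> cf; apply: continuous_compact_integrable; first exact: segment_compact.
exact: continuous_subspaceT.
Qed.

Lemma integ_continuous_le f g : continuous f -> integ g ->
  (forall x, `|f x| <= g x) -> integ f.
Proof.
move=> cf ig fg; apply: le_integrable ig => //.
- by apply/measurable_EFinP; exact: continuous_measurable_fun.
- by move=> x _; rewrite lee_fin (le_trans (fg x))// ler_norm.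
Qed.

Lemma integ_measurable_le f g : measurable_fun setT f -> integ g ->
  (forall x, `|f x| <= g x) -> integ f.
Proof.
move=> mf ig fg; apply: le_integrable ig => //.
- exact/measurable_EFinP.
- by move=> x _; rewrite lee_fin (le_trans (fg x))// ler_norm.
Qed.

Lemma integ_measurable f : integ f -> measurable_fun setT f.
Proof. by move=> /integrableP[/measurable_EFinP]. Qed.

Lemma patch_out f (a b : R) : (forall x, ~~ (a <= x <= b) -> f x = 0) ->
  f \_ `[a, b] = f.
Proof.
move=> f0; apply/funext => x; rewrite patchE.
case: ifPn => //; rewrite notin_setE /= in_itv /= => /negP h.
by rewrite f0.
Qed.

Lemma integ_supp f (a b : R) : continuous f ->
  (forall x, ~~ (a <= x <= b) -> f x = 0) -> integ f.
Proof.
move=> cf f0; rewrite /integ -(patch_out f0) -restrict_EFin.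
by apply/integrable_restrict => //=; rewrite setTI; exact: continuous_integrable_itv.
Qed.

Lemma Rint_supp f (a b : R) :
  (forall x, ~~ (a <= x <= b) -> f x = 0) ->
  Rint f = \int[mu]_(x in `[a, b]) f x.
Proof.
by move=> f0; rewrite [RHS]Rintegral_mkcond (patch_out f0).
Qed.

Lemma RintE f : Rint f = fine (\int[mu]_x (f x)%:E)%E.
Proof. by []. Qed.

Lemma EFin_Rint f : integ f -> (\int[mu]_x (f x)%:E)%E = (Rint f)%:E.
Proof. by move=> fi; rewrite RintE fineK//; exact: integrable_fin_num. Qed.

Lemma integD f g : integ f -> integ g -> integ (fun x => f x + g x).
Proof. by move=> hf hg; exact: (integrableD measurableT hf hg). Qed.

Lemma integB f g : integ f -> integ g -> integ (fun x => f x - g x).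
Proof. by move=> hf hg; exact: (integrableB measurableT hf hg). Qed.

Lemma integZl (k : R) f : integ f -> integ (fun x => k * f x).
Proof. by move=> hf; exact: (@integrableZl _ _ _ mu setT measurableT k (EFin \o f) hf). Qed.

Lemma integ_norm f : integ f -> integ (fun x => `|f x|).
Proof. by move=> hf; apply: (@integrable_norm _ _ _ mu setT f). Qed.

Lemma RintD f g : integ f -> integ g -> Rint (fun x => f x + g x) = Rint f + Rint g.
Proof. exact: RintegralD. Qed.
Lemma RintB f g : integ f -> integ g -> Rint (fun x => f x - g x) = Rint f - Rint g.
Proof. exact: RintegralB. Qed.
Lemma RintZl (k : R) f : integ f -> Rint (fun x => k * f x) = k * Rint f.
Proof. by move=> hf; apply: RintegralZl. Qed.
Lemma le_Rint f g : integ f -> integ g -> (forall x, f x <= g x) -> Rint f <= Rint g.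
Proof. by move=> hf hg fg; apply: le_Rintegral. Qed.
Lemma Rint_ge0 f : (forall x, 0 <= f x) -> 0 <= Rint f.
Proof. by move=> f0; apply: Rintegral_ge0. Qed.

Lemma norm_Rint_le f g : measurable_fun setT f -> integ g ->
  (forall x, `|f x| <= g x) -> `|Rint f| <= Rint g.
Proof.
move=> mf ig fg; have jf := integ_measurable_le mf ig fg.
apply: (le_trans (le_normr_Rintegral _ jf)) => //.
by apply: le_Rint => //; exact: integ_norm.
Qed.

(** Lebesgue measure is determined by its values on half-open intervals, and reflection preserves
    their length. Translations need no separate proof: each is a composition of two reflections. *)
Lemma reflect_measure (x : R) (A : set R) : measurable A ->
  pushforward mu ((fun y => x - y) : _ -> measurableTypeR R) A = mu A.
Proof.
move=> mA.
have mf : measurable_fun setT (fun y : R => x - y) by apply: measurable_funB.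
apply/esym/lebesgue_measure_unique => //= _ [[a b]] _ <-.
rewrite /pushforward /=.
rewrite (_ : _ @^-1` _ = `[x - b, x - a[%classic); last first.
  apply/seteqP; split=> y /=; rewrite !in_itv /= => /andP[h1 h2]; lra.
rewrite !lebesgue_measure_itv/= !lte_fin.
have -> : (x - b < x - a) = (a < b) by apply/idP/idP; lra.
case: ifP => // _; rewrite -!EFinB; congr (_%:E); ring.
Qed.

Lemma measurable_reflect (x : R) : measurable_fun setT (fun y : R => x - y).
Proof. exact: measurable_funB. Qed.

Lemma integ_reflect (x : R) f : integ f -> integ (fun y => f (x - y)).
Proof.
move=> /integrableP[mf fi]; apply/integrableP; split.
  apply/measurable_EFinP; apply: measurableT_comp; last exact: measurable_reflect.
  exact/measurable_EFinP.
suff -> : (\int[mu]_y `|(EFin \o (fun y => f (x - y)%R)) y| =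
    \int[mu]_y `|(EFin \o f) y|)%E by [].
transitivity (\int[pushforward mu ((fun y => x - y)%R : _ -> measurableTypeR R)]_y `|(EFin \o f) y|)%E.
  rewrite ge0_integral_pushforward//=; first exact: measurable_reflect.
  by apply/measurable_EFinP; apply: measurableT_comp => //; exact/measurable_EFinP.
apply: eq_measure_integral => [|? A mA _]; first exact: measurable_reflect.
exact: reflect_measure.
Qed.

Lemma Rint_reflect (x : R) f : integ f -> Rint (fun y => f (x - y)) = Rint f.
Proof.
move=> fi; rewrite /Rint /Rintegral; congr fine.
transitivity (\int[pushforward mu ((fun y => x - y)%R : _ -> measurableTypeR R)]_y (EFin \o f) y)%E.
  rewrite integral_pushforward//=; first exact: measurable_reflect.
  - by move: fi => /integrableP[].
  - by rewrite preimage_setT; exact: integ_reflect.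
apply: eq_measure_integral => [|? A mA _]; first exact: measurable_reflect.
exact: reflect_measure.
Qed.

Lemma integ_shift (x : R) f : integ f -> integ (fun y => f (y - x)).
Proof.
move=> /(integ_reflect 0) /(integ_reflect x).
by congr integ; apply/funext => y; congr f; ring.
Qed.

Lemma Rint_shift (x : R) f : integ f -> Rint (fun y => f (y - x)) = Rint f.
Proof.
move=> fi; rewrite -[RHS](Rint_reflect 0)// -[RHS](Rint_reflect x); last exact: integ_reflect.
by congr Rint; apply/funext => y; congr f; ring.
Qed.

Lemma lipschitz_continuous f (K : R) : (forall x y, `|f x - f y| <= K * `|x - y|) ->
  continuous f.
Proof.
move=> lip x; apply/cvgrPdist_le => e e0.
have K1 : 0 < `|K| + 1 by rewrite ltr_wpDl.
exists (e / (`|K| + 1)) => /=; first by rewrite divr_gt0.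
move=> y /=; rewrite ltr_pdivlMr// => h; apply: (le_trans (lip x y)).
have := ler_norm K; have := normr_ge0 (x - y); nra.
Qed.

(** Variation function of a primitive of [f]. Its increments bound those of any function with weak
    derivative [f], and they telescope along the grid. *)
Definition cumul f (x : R) := \int[mu]_(y in `]-oo, x]) `|f y|.

Lemma integ_on f (D : set R) : measurable D -> integ f -> mu.-integrable D (EFin \o f).
Proof. by move=> mD; apply: integrableS. Qed.

Lemma cumulB f (a b : R) : a <= b -> integ f ->
  cumul f b - cumul f a = \int[mu]_(y in `]a, b]) `|f y|.
Proof.
move=> ab fi; apply: Rintegral_itvB => //.
by apply: integ_on => //; exact: integ_norm.
Qed.

Lemma cumul_ge0 f x : 0 <= cumul f x.
Proof. exact: Rintegral_ge0. Qed.

Lemma cumul_le f x : integ f -> cumul f x <= Rint (fun y => `|f y|).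
Proof.
move=> fi; rewrite /cumul Rintegral_mkcond; apply: le_Rint.
- rewrite /integ -restrict_EFin; apply/integrable_restrict => //=.
  by rewrite setTI; apply: integ_on => //; exact: integ_norm.
- exact: integ_norm.
- by move=> y; rewrite patchE; case: ifP => _; [exact: lexx|exact: normr_ge0].
Qed.

Lemma norm_Rint_cumul f g (a b : R) : a <= b -> integ f -> measurable_fun setT g ->
  (forall x, `|g x| <= `|f x|) -> (forall x, ~~ (a < x <= b) -> g x = 0) ->
  `|Rint g| <= cumul f b - cumul f a.
Proof.
move=> ab fi mg gf g0; rewrite cumulB// Rintegral_mkcond.
apply: norm_Rint_le => //.
- rewrite /integ -restrict_EFin; apply/integrable_restrict => //=.
  by rewrite setTI; apply: integ_on => //; exact: integ_norm.
- move=> x; rewrite patchE; case: ifPn => [_|]; first exact: gf.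
  by rewrite notin_setE /= in_itv /= => /negP h; rewrite g0// normr0.
Qed.

Lemma continuous_derive f (F : R -> R) :
  (forall x : R, is_derive x (1 : R) F (f x)) -> continuous F.
Proof.
by move=> dF x; apply/differentiable_continuous/derivable1_diffP; exact: ex_derive.
Qed.

Lemma Rint_FTC f (F : R -> R) (a b : R) : a < b -> continuous f ->
  (forall x : R, is_derive x (1 : R) F (f x)) ->
  \int[mu]_(x in `[a, b]) f x = F b - F a.
Proof.
move=> ab cf dF; have cF := continuous_derive dF.
rewrite /Rintegral (@continuous_FTC2 _ f F)//.
- exact: continuous_subspaceT.
- split.
  + by move=> x _; exact: ex_derive.
  + by apply: cvg_at_right_filter; exact: cF.
  + by apply: cvg_at_left_filter; exact: cF.
- by move=> x _; rewrite derive1E; exact: derive_val.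
Qed.

(** Integrating from minus infinity, rather than from a base point, gives a two-sided derivative at
    every real number; the integrals converge because [f] vanishes left of [a]. *)
Lemma primitive_zero_left f (a : R) : continuous f -> (forall x, x <= a -> f x = 0) ->
  exists F : R -> R, (forall x : R, is_derive x (1 : R) F (f x)) /\ forall x, x <= a -> F x = 0.
Proof.
move=> cf f0; exists (fun x => \int[mu]_(y in `]-oo, x]) f y); split => [x|x xa].
  have fi u : mu.-integrable `]-oo, u] (EFin \o f).
    have fE : f \_ `]-oo, u] = f \_ `[a, u].
      apply/funext => y; rewrite !patchE !mem_setE !in_itv /=.
      by case: (leP y u); case: (leP a y) => //= ya _; rewrite f0// ltW.
    rewrite -(setTI `]-oo, u]%classic); apply/integrable_restrict => //=.
    rewrite restrict_EFin fE -restrict_EFin; apply/integrable_restrict => //=.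
    by rewrite setTI; exact: continuous_integrable_itv.
  have x1 : x < x + 1 by rewrite ltrDl.
  have [dF F'] := @continuous_FTC1 _ f -oo%O x (x + 1) x1 (fi (x + 1)) (ltNyr x) (cf x).
  by split; [exact: dF | rewrite -derive1E; exact: F'].
rewrite (@eq_Rintegral _ _ _ mu _ (cst 0)).
  by rewrite Rintegral_cst// mul0r.
by move=> y; rewrite inE /= in_itv /= => yx; rewrite f0// (le_trans yx).
Qed.

End IntegralFacts.

(** * Smooth functions and cutoffs *)

Section Smooth.
Context {R : realType}.
Local Notation mu := (@lebesgue_measure R).
Implicit Types f g : R -> R.

Definition smooth f := forall n (x : R), derivable (derive1n n f) x 1.

Lemma derive1nSr n f : derive1n n.+1 f = derive1n n (derive1 f).
Proof. by rewrite /derive1n iterSr. Qed.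

(** Applied to explicit classes (trigonometric combinations, affine substitutions, flat
    exponentials), for which closure under one derivative is a short computation. *)
Lemma smooth_class (P : (R -> R) -> Prop) :
  (forall f, P f -> forall x, derivable f x 1) ->
  (forall f, P f -> P (derive1 f)) -> forall f, P f -> smooth f.
Proof.
move=> Pd PD f Pf n; suff : P (derive1n n f) by exact: Pd.
by elim: n => // n IH; exact: PD.
Qed.

Lemma smooth_derivable f x : smooth f -> derivable f x 1.
Proof. by move/(_ 0%N). Qed.

Lemma smooth_derive f : smooth f -> smooth (derive1 f).
Proof. by move=> sf n x; rewrite -derive1nSr; exact: sf. Qed.

Lemma smooth_is_derive f x : smooth f -> is_derive (x : R) (1 : R) f ((derive1 f) x).
Proof. by move=> sf; split; [exact: smooth_derivable|rewrite derive1E]. Qed.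

Lemma smooth_continuous f : smooth f -> continuous f.
Proof.
by move=> sf x; apply/differentiable_continuous/derivable1_diffP; exact: smooth_derivable.
Qed.

Lemma is_derive_fun f g : (forall x, is_derive (x : R) (1 : R) f (g x)) -> (derive1 f) = g.
Proof. by move=> h; apply/funext => x; rewrite derive1E; exact: derive_val. Qed.

Lemma smooth_primitive f g : (forall x, is_derive (x : R) (1 : R) f (g x)) -> smooth g -> smooth f.
Proof.
move=> fg sg [|n] x /=; first exact: ex_derive.
by have := sg n x; rewrite -(is_derive_fun fg) -derive1nSr.
Qed.

(* Closing under sums and products first avoids Leibniz' formula for n-th derivatives. *)
Inductive smooth_alg : (R -> R) -> Prop :=
| SmoothBase f of smooth f : smooth_alg f
| SmoothAdd f g of smooth_alg f & smooth_alg g : smooth_alg (fun x => f x + g x)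
| SmoothMul f g of smooth_alg f & smooth_alg g : smooth_alg (fun x => f x * g x).

Lemma smooth_alg_derivable f : smooth_alg f ->
  (forall x, derivable f x 1) /\ smooth_alg (derive1 f).
Proof.
elim=> {f} [f sf|f g _ [df f'] _ [dg g']|f g sf [df f'] sg [dg g']].
- by split=> [x|]; [exact: smooth_derivable|exact/SmoothBase/smooth_derive].
- split=> [x|]; first exact: derivableD.
  rewrite (_ : (derive1 _) = fun x => (derive1 f) x + (derive1 g) x); first exact: SmoothAdd.
  by apply/funext => x; rewrite !derive1E deriveD.
- split=> [x|]; first exact: derivableM.
  rewrite (_ : (derive1 _) = fun x => f x * (derive1 g) x + g x * (derive1 f) x).
    by apply: SmoothAdd; apply: SmoothMul.
  by apply/funext => x; rewrite !derive1E deriveM.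
Qed.

Lemma smooth_algP f : smooth_alg f -> smooth f.
Proof. by apply: smooth_class => g /smooth_alg_derivable[]. Qed.

Lemma smoothD f g : smooth f -> smooth g -> smooth (fun x => f x + g x).
Proof. by move=> sf sg; apply/smooth_algP/SmoothAdd; exact: SmoothBase. Qed.

Lemma smoothM f g : smooth f -> smooth g -> smooth (fun x => f x * g x).
Proof. by move=> sf sg; apply/smooth_algP/SmoothMul; exact: SmoothBase. Qed.

Lemma smooth_cst (c : R) : smooth (cst c).
Proof.
apply: (@smooth_class (fun f => exists c, f = cst c)); last by exists c.
- by move=> f [k ->] x; exact: derivable_cst.
- by move=> f [k ->]; exists 0; apply/funext => x; rewrite derive1_cst.
Qed.

Lemma smooth_affine f (a b : R) : smooth f -> smooth (fun x => f (a * x + b)).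
Proof.
have D g x : smooth g -> is_derive (x : R) (1 : R) (fun x => g (a * x + b)) (a * (derive1 g) (a * x + b)).
  move=> sg; have := smooth_is_derive (a * x + b) sg => dg.
  have da : is_derive (x : R) (1 : R) (fun x => a * x + b) a.
    by apply: is_derive_eq; rewrite addr0 scaler1.
  by have := @is_derive1_comp _ g (fun x => a * x + b) x _ _ dg da; rewrite mulrC.
move=> sf; apply: (@smooth_class (fun h => exists g c, smooth g /\
    h = fun x => c * g (a * x + b))).
- move=> h [g [c [sg ->]]] x; apply: derivableM; first exact: derivable_cst.
  by have [] := D g x sg.
- move=> h [g [c [sg ->]]]; exists (derive1 g), (c * a); split; first exact: smooth_derive.
  apply/is_derive_fun => x; have := D g x sg => dg.
  by apply: is_derive_eq; rewrite /GRing.scale /=; ring.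
- by exists f, 1; split => //; apply/funext => x; rewrite mul1r.
Qed.

Lemma smoothZ f (c : R) : smooth f -> smooth (fun x => c * f x).
Proof. by move=> sf; apply: (smoothM _ sf); exact: smooth_cst. Qed.

Lemma smoothB f g : smooth f -> smooth g -> smooth (fun x => f x - g x).
Proof.
move=> sf sg; rewrite (_ : (fun x => f x - g x) = fun x => f x + (-1) * g x).
  by apply: (smoothD sf); exact: smoothZ.
by apply/funext => x; rewrite mulN1r.
Qed.

Lemma smooth_trig (c : R) :
  smooth (fun x => cos (c * x)) /\ smooth (fun x => sin (c * x)).
Proof.
pose P f := exists a b : R, f = fun x => a * cos x + b * sin x.
have PS : forall f, P f -> smooth f.
  apply: smooth_class => f [a [b ->]].
    by move=> x; apply: ex_derive.
  exists b, (- a); apply/is_derive_fun => x; apply: is_derive_eq.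
  by rewrite /GRing.scale /=; ring.
have sc : smooth cos.
  by apply: PS; exists 1, 0; apply/funext => x; rewrite mul1r mul0r addr0.
have ss : smooth sin.
  by apply: PS; exists 0, 1; apply/funext => x; rewrite mul1r mul0r add0r.
split.
- have := @smooth_affine cos c 0 sc; by congr smooth; apply/funext => x; rewrite addr0.
- have := @smooth_affine sin c 0 ss; by congr smooth; apply/funext => x; rewrite addr0.
Qed.

End Smooth.

Section Bump.
Context {R : realType}.
Implicit Types f g : R -> R.

Lemma is_derive_epsP f (x l : R) : is_derive x (1 : R) f l <->
  forall e, 0 < e -> exists d, 0 < d /\
    forall h, 0 < `|h| < d -> `|(f (x + h) - f x) / h - l| <= e.
Proof.
have E h : h^-1 *: ((f \o shift x) (h *: (1 : R)) - f x) = (f (x + h) - f x) / h.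
  by rewrite /= /GRing.scale /= mulr1 (addrC h) mulrC.
split=> [df e e0|H].
  have [dfx dfl] := df.
  have /cvgrPdist_le /(_ e e0) : (fun h => h^-1 *: ((f \o shift x) (h *: (1 : R)) - f x)) @ 0^' --> l.
    by rewrite -dfl; exact: dfx.
  rewrite near_withinE => /nbhs_ballP[d /= d0 hd]; exists d; split => // h /andP[h0 hlt].
  rewrite -E distrC; apply: hd; last by rewrite -normr_gt0.
  by rewrite /ball /= sub0r normrN.
have C : (fun h => h^-1 *: ((f \o shift x) (h *: (1 : R)) - f x)) @ 0^' --> l.
  apply/cvgrPdist_le => e e0; have [d [d0 hd]] := H e e0.
  rewrite near_withinE; apply/nbhs_ballP; exists d => //= h.
  rewrite /ball /= sub0r normrN => hlt h0.
  by rewrite distrC E; apply: hd; rewrite hlt andbT normr_gt0.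
by split; [apply/cvg_ex; exists l|apply/cvg_lim].
Qed.

Lemma is_derive_local f g (x l d : R) : 0 < d ->
  (forall h, `|h| < d -> f (x + h) = g (x + h)) ->
  is_derive x (1 : R) g l -> is_derive x (1 : R) f l.
Proof.
move=> d0 fg /is_derive_epsP H; apply/is_derive_epsP => e /H[d' [d'0 h]].
exists (Num.min d d'); rewrite lt_min d0 d'0; split => // k /andP[k0].
rewrite lt_min => /andP[kd kd']; rewrite fg//.
have := fg 0; rewrite normr0 addr0 => -> //.
by apply: h; rewrite k0.
Qed.

(* Multiples of exp(-1/x) by polynomials in 1/x: a class stable under differentiation. *)
Definition flat_exp (p : {poly R}) (x : R) := if 0 < x then p.[x^-1] * expR (- x^-1) else 0.

(** The exponent [k] is general because the induction on [p] moves each factor X into it. A constant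
    coefficient leaves t^k exp(-t), which for t > 1 is controlled by the term t^(k+1)/(k+1)! of the
    exponential series and for t <= 1 by 1. *)
Lemma poly_exp_bound (p : {poly R}) k :
  exists C, 0 <= C /\ forall t, 0 < t -> `|p.[t]| * t ^+ k * expR (- t) <= C.
Proof.
elim/poly_ind: p k => [|p c IH] k.
  by exists 0; split => // t t0; rewrite horner0 normr0 !mul0r.
have [C [C0 hC]] := IH k.+1.
exists (C + `|c| * (k.+1)`!%:R + `|c|); split; first by rewrite !addr_ge0 ?mulr_ge0.
move=> t t0; rewrite hornerMXaddC.
have t0' := ltW t0.
have tk : t ^+ k * expR (- t) <= (k.+1)`!%:R + 1.
  rewrite expRN ler_pdivrMr ?expR_gt0//.
  have [t1|t1] := lerP t 1.
    apply: (@le_trans _ _ 1); first by rewrite exprn_ile1.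
    apply: (@le_trans _ _ (1 * expR t)); first by rewrite mul1r -expR0 ler_expR.
    by rewrite ler_wpM2r ?expR_ge0// lerDr.
  have h := expR_ge1Dxn k t0'.
  have f0 : 0 < (k.+1)`!%:R :> R by rewrite ltr0n fact_gt0.
  apply: (@le_trans _ _ (t ^+ k.+1)); first by rewrite exprS ler_peMl ?exprn_ge0 ?ltW.
  apply: (@le_trans _ _ ((k.+1)`!%:R * expR t)); last by rewrite ler_wpM2r ?expR_ge0// lerDl.
  rewrite -ler_pdivrMl// mulrC; apply: le_trans h; by rewrite lerDr.
have := hC t t0; rewrite exprS => hCt.
apply: (@le_trans _ _ ((`|p.[t]| * t + `|c|) * t ^+ k * expR (- t))).
  rewrite ler_wpM2r ?expR_ge0// ler_wpM2r ?exprn_ge0//.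
  by rewrite (le_trans (ler_normD _ _))// normrM (gtr0_norm t0).
rewrite 2!mulrDl -addrA lerD//; first by rewrite -!mulrA; rewrite !mulrA in hCt *.
by rewrite -mulrA -[X in _ + X]mulr1 -mulrDr ler_wpM2l.
Qed.

(** The case [k = 2] with t = 1/x; a quadratic bound makes the difference quotient at 0 tend to
    0. *)
Lemma flat_exp_bound (p : {poly R}) :
  exists C, 0 <= C /\ forall x, `|flat_exp p x| <= C * x ^+ 2.
Proof.
have [C [C0 hC]] := poly_exp_bound p 2; exists C; split => // x.
rewrite /flat_exp; case: ifPn => x0; last by rewrite normr0 mulr_ge0// sqr_ge0.
have := hC x^-1; rewrite invr_gt0 => /(_ x0).
rewrite normrM (ger0_norm (expR_ge0 _)) mulrAC -ler_pdivlMr ?exprn_gt0 ?invr_gt0//.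
by rewrite -exprVn invrK.
Qed.

(** With t = 1/x one has dt/dx = -t^2, so p(t) exp(-t) has derivative t^2 (p(t) - p'(t)) exp(-t). At
    the origin the quadratic bound takes over. *)
Lemma is_derive_flat_exp (p : {poly R}) (x : R) :
  is_derive x (1 : R) (flat_exp p) (flat_exp ('X^2 * (p - p^`())) x).
Proof.
have [x0|x0|<-] := ltgtP 0 x.
- apply: (@is_derive_local _ (fun x => p.[x^-1] * expR (- x^-1)) x _ x) => //.
    move=> h hx; rewrite /flat_exp ifT//.
    by move: hx; rewrite ltr_norml => /andP[h1 _]; lra.
  have xn0 : x != 0 by rewrite gt_eqF.
  have di : is_derive x (1 : R) (fun x => x^-1) (- x ^- 2).
    by have := is_deriveV xn0 (is_derive_id x (1 : R)); rewrite /GRing.scale /= mulr1.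
  have dn : is_derive x (1 : R) (fun x => - x^-1) (x ^- 2).
    by apply: is_derive_eq; rewrite opprK.
  have de := @is_derive1_comp _ expR (fun x => - x^-1) x _ _ (is_derive_expR _) dn.
  have dp := @is_derive1_comp _ (fun y => p.[y]) (fun x => x^-1) x _ _ (is_derive_poly p _) di.
  have := is_deriveM dp de; rewrite /flat_exp x0 => H.
  apply: is_derive_eq; rewrite /GRing.scale /= hornerM hornerXn hornerD hornerN exprVn.
  ring.
- apply: (@is_derive_local _ (cst 0) x _ (- x)); first by lra.
    move=> h hx; rewrite /flat_exp ifF//; apply/negbTE; rewrite -leNgt.
    by move: hx; rewrite ltr_norml => /andP[_ h1]; lra.
  by rewrite /flat_exp ltNge (ltW x0) /=; exact: is_derive_cst.
- rewrite {2}/flat_exp ltxx; apply/is_derive_epsP => e e0.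
  have [C [C0 hC]] := flat_exp_bound p.
  exists (e / (C + 1)); rewrite divr_gt0//; last by lra.
  split => // h /andP[h0 hd]; rewrite add0r {2}/flat_exp ltxx !subr0.
  rewrite normrM normfV ler_pdivrMr// (le_trans (hC h))//.
  have -> : h ^+ 2 = `|h| * `|h| by rewrite -expr2 real_normK ?num_real.
  rewrite mulrA ler_wpM2r//.
  move: hd; rewrite ltr_pdivlMr; last by lra.
  have := normr_ge0 h; nra.
Qed.

Lemma smooth_flat_exp (p : {poly R}) : smooth (flat_exp p).
Proof.
apply: (@smooth_class _ (fun f => exists p, f = flat_exp p)); last by exists p.
- by move=> f [q ->] x; have [] := is_derive_flat_exp q x.
- move=> f [q ->]; exists ('X^2 * (q - q^`())).
  exact/is_derive_fun/is_derive_flat_exp.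
Qed.

End Bump.

Section Step.
Context {R : realType}.
Implicit Types f g : R -> R.

Lemma mean_value f f' (a b : R) : a < b -> (forall x, is_derive (x : R) (1 : R) f (f' x)) ->
  exists c, a < c < b /\ f b - f a = f' c * (b - a).
Proof.
move=> ab df; have [c cab ->] := MVT ab (fun x _ => df x)
  (continuous_subspaceT (continuous_derive df)).
by exists c; split => //; move: cab; rewrite in_itv.
Qed.

Lemma mean_value_le f f' (a b L : R) : (forall x, is_derive (x : R) (1 : R) f (f' x)) ->
  (forall x, Num.min a b <= x <= Num.max a b -> `|f' x| <= L) -> `|f b - f a| <= L * `|b - a|.
Proof.
move=> df; wlog ab : a b / a < b => [H f'L|f'L].
  have [ab|ba|->] := ltgtP a b; first exact: H.
  - by rewrite distrC (distrC b); apply: H => // x; rewrite minC maxC; exact: f'L.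
  - by rewrite !subrr normr0 mulr0.
have [c [/andP[ac cb] ->]] := mean_value ab df.
rewrite normrM ler_wpM2r// f'L// (min_idPl (ltW ab)) (max_idPr (ltW ab)).
by rewrite !ltW.
Qed.

Lemma nondecreasing_derive_ge0 f f' : (forall x, is_derive (x : R) (1 : R) f (f' x)) ->
  (forall x, 0 <= f' x) -> {homo f : x y / x <= y}.
Proof.
move=> df f'0 x y; rewrite le_eqVlt => /predU1P[->//|xy].
have [c [_ E]] := mean_value xy df.
by rewrite -subr_ge0 E mulr_ge0// subr_ge0 ltW.
Qed.

(* [P], a primitive of [S], is a smooth approximation of the positive part. *)
Lemma smooth_step : exists rho S P : R -> R,
  [/\ smooth rho, (forall x, 0 <= rho x) & forall x, 1 <= `|x| -> rho x = 0] /\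
  [/\ forall x, is_derive (x : R) (1 : R) S (rho x), (forall x, x <= -1 -> S x = 0),
      (forall x, 1 <= x -> S x = 1) & (forall x, 0 <= S x <= 1)] /\
  [/\ forall x, is_derive (x : R) (1 : R) P (S x), (forall x, x <= -1 -> P x = 0),
      (forall x, 1 <= x -> P x = x + (P 1 - 1)) &
      (forall x, `|P x - Num.max x 0| <= 2)].
Proof.
pose e0 := @flat_exp R 1.
have se : smooth e0 by exact: smooth_flat_exp.
have e0_ge0 x : 0 <= e0 x.
  by rewrite /e0 /flat_exp; case: ifP => // _; rewrite hornerC mul1r expR_ge0.
have e0_gt0 x : 0 < x -> 0 < e0 x.
  by move=> x0; rewrite /e0 /flat_exp x0 hornerC mul1r expR_gt0.
have e0_0 x : x <= 0 -> e0 x = 0.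
  by move=> x0; rewrite /e0 /flat_exp ltNge x0.
(* A bump supported in [-1, 1]. Its primitive [F] is 0 up to -1 and constant after 1, so division by
   [F 1] yields a step from 0 to 1. *)
pose r0 x := e0 (1 * x + 1) * e0 (-1 * x + 1).
have sr : smooth r0 by apply: smoothM; exact: smooth_affine.
have r0_ge0 x : 0 <= r0 x by rewrite mulr_ge0.
have r0_0 x : 1 <= `|x| -> r0 x = 0.
  rewrite ler_normr /r0 => /orP[h|h].
  - by rewrite (e0_0 (-1 * x + 1)) ?mulr0//; lra.
  - by rewrite (e0_0 (1 * x + 1)) ?mul0r//; lra.
have [F [dF F0]] : exists F : R -> R, (forall x : R, is_derive (x : R) (1 : R) F (r0 x)) /\
    forall x, x <= -1 -> F x = 0.
  apply: primitive_zero_left; first exact: smooth_continuous.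
  by move=> x x1; rewrite r0_0// ler_normr; apply/orP; right; lra.
have F1 : 0 < F 1.
  have m1 : -1 < 1 :> R by lra.
  have [c [/andP[c1 c2]]] := mean_value m1 dF.
  rewrite (F0 (-1))// subr0 => ->; apply: mulr_gt0; last by lra.
  by apply: mulr_gt0; apply: e0_gt0; lra.
have Fc x : 1 <= x -> F x = F 1.
  rewrite le_eqVlt => /predU1P[<-//|x1].
  have [c [/andP[c1 c2] E]] := mean_value x1 dF.
  by apply/eqP; rewrite -subr_eq0 E r0_0 ?mul0r// ger0_norm; lra.
pose rho x := (F 1)^-1 * r0 x; pose S x := (F 1)^-1 * F x.
have dS x : is_derive (x : R) (1 : R) S (rho x).
  by rewrite /S /rho; have := dF x => dFx; apply: is_derive_eq; rewrite /GRing.scale /=; ring.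
have iF : 0 < (F 1)^-1 by rewrite invr_gt0.
have rho_ge0 x : 0 <= rho x by rewrite mulr_ge0 // ltW.
have rho0 x : 1 <= `|x| -> rho x = 0 by move=> h; rewrite /rho (r0_0 _ h) mulr0.
have S0 x : x <= -1 -> S x = 0 by move=> h; rewrite /S (F0 _ h) mulr0.
have S1 x : 1 <= x -> S x = 1 by move=> h; rewrite /S (Fc _ h) mulVf// gt_eqF.
have Sm := nondecreasing_derive_ge0 dS rho_ge0.
have S01 x : 0 <= S x <= 1.
  apply/andP; split.
  - by rewrite -(S0 (Num.min x (-1))) ?Sm// ge_min lexx ?orbT.
  - by rewrite -(S1 (Num.max x 1)) ?Sm// le_max lexx ?orbT.
have [P [dP P0]] : exists P : R -> R, (forall x : R, is_derive (x : R) (1 : R) P (S x)) /\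
    forall x, x <= -1 -> P x = 0.
  by apply: primitive_zero_left => //; exact: continuous_derive dS.
have Pc x : 1 <= x -> P x = x + (P 1 - 1).
  rewrite le_eqVlt => /predU1P[<-//|x1]; first by rewrite addrC subrK.
  have [c [/andP[c1 c2] E]] := mean_value x1 dP.
  by move: E; rewrite S1; lra.
have Pb x : -1 <= x -> 0 <= P x <= x + 1.
  rewrite le_eqVlt => /predU1P[<-|x1]; first by rewrite P0// addNr lexx.
  have [c [/andP[c1 c2]]] := mean_value x1 dP; rewrite (P0 (-1))// subr0 => ->.
  by have /andP[s0 s1] := S01 c; nra.
exists rho, S, P; split; last split; split; [|exact: rho_ge0|exact: rho0|exact: dS|
  exact: S0|exact: S1|exact: S01|exact: dP|exact: P0|exact: Pc|].
  exact: smoothZ.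
(* Left of -1 both functions vanish; right of 1 they differ by the constant [P 1 - 1], of modulus at
   most 1; in between both lie in [0, 2]. *)
move=> x; have [x1|x1] := lerP x (-1).
  by rewrite P0// sub0r normrN max_r ?normr0//; lra.
have [x2|x2] := lerP 1 x.
  rewrite Pc// max_l; last by lra.
  have m1 : -1 <= 1 :> R by lra.
  have /andP[p1 p2] := Pb 1 m1.
  by rewrite addrAC subrr add0r ler_norml; apply/andP; split; lra.
have /andP[p1 p2] := Pb x (ltW x1).
by rewrite ler_norml; case: (lerP x 0) => h; apply/andP; split; lra.
Qed.

End Step.

(** * Pointwise bounds in Sobolev spaces *)

Section CosineKernel.
Context {R : realType}.
Local Notation mu := (@lebesgue_measure R).
Implicit Types f g c w : R -> R.

(** Fubini with majorant |w(y)| |c(xi)|: the cosine transform is symmetric for the integral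
    pairing. *)
Lemma Rint_swap_cos w c : integ w -> integ c ->
  Rint (fun y => w y * Rint (fun xi => c xi * cos (y * xi))) =
  Rint (fun xi => c xi * Rint (fun y => w y * cos (y * xi))).
Proof.
move=> iw ic.
have mw := integ_measurable iw; have mc := integ_measurable ic.
have mcs : measurable_fun setT (@cos R).
  by apply: continuous_measurable_fun; exact: continuous_cos.
have mcos z : measurable_fun setT (fun x : R => cos (z * x)).
  apply: (measurableT_comp mcs).
  exact: measurable_funM.
have cos1 (z : R) : `|cos z| <= 1 by rewrite ler_norml cos_geN1 cos_le1.
have icw y : integ (fun xi => c xi * cos (y * xi)).
  apply: (@integ_measurable_le _ _ (fun xi => `|c xi|)); last first.
  - by move=> xi; rewrite normrM ler_piMr.
  - exact: integ_norm.
  - exact: measurable_funM.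
have iwc xi : integ (fun y => w y * cos (y * xi)).
  apply: (@integ_measurable_le _ _ (fun y => `|w y|)); last first.
  - by move=> y; rewrite normrM ler_piMr.
  - exact: integ_norm.
  - apply: measurable_funM => //.
    rewrite (_ : (fun x => cos (x * xi)) = fun x => cos (xi * x))//.
    by apply/funext => x; rewrite mulrC.
pose F (z : R * R) := w z.1 * (c z.2 * cos (z.1 * z.2)).
have mF : measurable_fun setT F.
  apply: measurable_funM; first exact: measurableT_comp mw measurable_fst.
  apply: measurable_funM; first exact: measurableT_comp mc measurable_snd.
  apply: (measurableT_comp mcs).
  by apply: measurable_funM; [exact: measurable_fst|exact: measurable_snd].
have iF : (mu \x mu)%E.-integrable setT (EFin \o F).
  apply/integrable12ltyP; first exact/measurable_EFinP.
  have /integrableP[_ iw2] := iw; have /integrableP[_ ic2] := ic.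
  apply: (@le_lt_trans _ _ (\int[mu]_y (`|w y|%:E * \int[mu]_xi `|c xi|%:E))%E).
    apply: ge0_le_integral => //.
    - by move=> y _; apply: integral_ge0.
    - apply: (@measurable_fun_fubini_tonelli_F _ _ _ _ _ mu (abse \o (EFin \o F))) => //=.
      by apply: measurableT_comp => //; exact/measurable_EFinP.
    - apply: emeasurable_funM; last exact: measurable_cst.
      by apply/measurable_EFinP; apply: measurableT_comp.
    move=> y _; rewrite -ge0_integralZl//; last first.
      by apply/measurable_EFinP; apply: measurableT_comp.
    apply: ge0_le_integral => //.
    - have := measurableT_comp mF (pair1_measurable y) => h.
      by apply/measurable_EFinP; apply: measurableT_comp.
    - apply/measurable_EFinP; apply: measurable_funM => //.
      by apply: measurableT_comp.
    move=> xi _; rewrite /F /= lee_fin normrM ler_wpM2l//.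
    by rewrite normrM ler_piMr.
  rewrite ge0_integralZr//.
  - by rewrite lte_mul_pinfty//; [exact: integral_ge0|rewrite ge0_fin_numE//; exact: integral_ge0].
  - by apply/measurable_EFinP; apply: measurableT_comp.
  - exact: integral_ge0.
have := @Fubini _ _ _ _ _ mu mu (EFin \o F) iF => H.
have E1 y : (\int[mu]_xi (EFin \o F) (y, xi))%E =
    (w y * Rint (fun xi => c xi * cos (y * xi)))%:E.
  by rewrite -(RintZl _ (icw y)) -EFin_Rint //; exact: integZl.
have E2 xi : (\int[mu]_y (EFin \o F) (y, xi))%E =
    (c xi * Rint (fun y => w y * cos (y * xi)))%:E.
  rewrite -(RintZl _ (iwc xi)) -EFin_Rint; last exact: integZl.
  by apply: eq_integral => y _ /=; rewrite /F /= mulrCA.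
rewrite [LHS]RintE [RHS]RintE; congr fine.
transitivity (\int[mu]_y \int[mu]_xi (EFin \o F) (y, xi))%E.
  by apply: eq_integral => y _; rewrite E1.
by rewrite H; apply: eq_integral => xi _; rewrite E2.
Qed.

(** Real part of the Fourier transform of [c]; for a wide cutoff [c] it acts as an unnormalised
    approximate identity. *)
Definition cos_ker c (y : R) := Rint (fun xi => c xi * cos (y * xi)).

End CosineKernel.

Section PoissonKernel.
Context {R : realType}.
Local Notation mu := (@lebesgue_measure R).
Implicit Types f g c w : R -> R.

Lemma continuous_bounded_itv f (a b : R) : continuous f ->
  exists C, 0 <= C /\ forall x, a <= x <= b -> `|f x| <= C.
Proof.
move=> cf; have [ab|ba] := lerP a b; last first.
  by exists 0; split => // x /andP[h1 h2]; exfalso; lra.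
have cn : continuous (fun x => `|f x|).
  by move=> x; apply: (@continuous_comp _ _ _ f Num.norm); [exact: cf|exact: norm_continuous].
have [d dab hd] := EVT_max ab (continuous_subspaceT cn).
by exists `|f d|; split => // x xab; apply: hd; rewrite in_itv.
Qed.

Lemma norm_Rint_supp f (a b B : R) : continuous f -> a <= b -> 0 <= B ->
  (forall x, ~~ (a <= x <= b) -> f x = 0) ->
  (forall x, a <= x <= b -> `|f x| <= B) -> `|Rint f| <= B * (b - a).
Proof.
move=> cf ab B0 f0 fB; rewrite (Rint_supp f0).
have fi := continuous_integrable_itv a b cf.
apply: (le_trans (le_normr_Rintegral _ fi)) => //.
apply: (@le_trans _ _ (\int[mu]_(x in `[a, b]) B)).
  apply: le_Rintegral => //.
  - exact: (@integrable_norm _ _ _ mu _ f).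
  - by apply: (continuous_integrable_itv a b (f := cst B)); exact: cst_continuous.
rewrite Rintegral_cst//= lebesgue_measure_itv /= lte_fin.
by case: ltP => _ //=; rewrite mulr0 mulr_ge0// subr_ge0.
Qed.

Lemma Rint_dominated (F : nat -> R -> R) f g : (forall n, measurable_fun setT (F n)) ->
  measurable_fun setT f -> integ g -> (forall n x, `|F n x| <= g x) ->
  (forall x, (fun n => F n x) @ \oo --> f x) ->
  (fun n => Rint (F n)) @ \oo --> Rint f.
Proof.
move=> mF mf ig Fg Ff.
have mF' n : measurable_fun setT (EFin \o F n) by exact/measurable_EFinP.
have mf' : measurable_fun setT (EFin \o f) by exact/measurable_EFinP.
have Ff' : {ae mu, forall x, setT x -> (fun n => (EFin \o F n) x) @ \oo --> (EFin \o f) x}.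
  by apply: aeW => x _; apply: cvg_EFin; [exact: nearW|exact: Ff].
have Fg' : {ae mu, forall x n, setT x -> (`|(EFin \o F n) x| <= (EFin \o g) x)%E}.
  by apply: aeW => x n _; rewrite /= lee_fin.
have [ifi _ H] := @dominated_convergence _ _ _ mu setT measurableT _ _ _ mF' mf' Ff' ig Fg'.
have iF n : integ (F n) by exact: integ_measurable_le (mF n) ig (Fg n).
move: H; rewrite (_ : [sequence _]_n = EFin \o (fun n => Rint (F n))); last first.
  by apply/funext => n /=; rewrite EFin_Rint.
rewrite EFin_Rint; last by [].
by move/fine_cvg.
Qed.

Lemma cos_mul_continuous (y : R) : continuous (fun x : R => cos (y * x)).
Proof.
move=> x; apply: (@continuous_comp _ _ _ (fun x => y * x) cos).
  exact: mulrl_continuous.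
exact: continuous_cos.
Qed.

(** On the support |x| <= A, so each y -> cos(y x) is A-Lipschitz there and the transform is
    Lipschitz with constant A times the integral of [c]. *)
Lemma cos_ker_continuous c (A : R) : continuous c -> (forall x, 0 <= c x) ->
  (forall x, ~~ (- A <= x <= A) -> c x = 0) -> continuous (cos_ker c).
Proof.
move=> cc c0 cA; have ic := integ_supp cc cA.
have ccos (y : R) : continuous (fun x : R => c x * cos (y * x)).
  by move=> x; apply: cvgM; [exact: cc|exact: cos_mul_continuous].
have icc (y : R) : integ (fun x : R => c x * cos (y * x)).
  by apply: (@integ_supp _ _ (- A) A (@ccos y)) => x /cA ->; rewrite mul0r.
have Lx x : `|c x * x| <= A * c x.
  rewrite normrM (ger0_norm (c0 x)) mulrC.
  have [h|h] := boolP (- A <= x <= A); last by rewrite cA// !mulr0.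
  by rewrite ler_wpM2r// ler_norml.
apply: (@lipschitz_continuous _ _ (A * Rint c)) => y z.
rewrite /cos_ker -RintB; [|exact: icc|exact: icc].
rewrite (mulrC _ `|y - z|) mulrA -RintZl; last exact: ic.
apply: norm_Rint_le.
- apply: continuous_measurable_fun => x.
  by apply: cvgB; exact: ccos.
- exact: integZl.
move=> x; rewrite -mulrBr normrM.
have : `|cos (y * x) - cos (z * x)| <= 1 * `|y * x - z * x|.
  apply: (@mean_value_le _ cos (fun x => - sin x)) => // t _.
  by rewrite normrN ler_norml sin_geN1 sin_le1.
rewrite mul1r -mulrBl normrM => h.
apply: (@le_trans _ _ (`|c x| * (`|y - z| * `|x|))); first by rewrite ler_wpM2l.
by rewrite mulrCA -normrM -mulrA ler_wpM2l.
Qed.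

(** Poisson kernel at scale 1/L without its factor 1/pi. As a majorant it has the advantage of an
    arctangent primitive and of the integral pi for every [L]. *)
Definition poisson (L y : R) := L / (1 + (L * y) ^+ 2).

Lemma poisson_ge0 L y : 0 < L -> 0 <= poisson L y.
Proof.
by move=> L0; apply: divr_ge0; [exact: ltW|apply: addr_ge0 => //; exact: sqr_ge0].
Qed.

Lemma poisson_continuous L : continuous (poisson L).
Proof.
apply: (@continuous_derive _ (derive1 (poisson L))) => x.
rewrite derive1E; apply: DeriveDef => //; rewrite /poisson.
have h : 1 + (L * x) ^+ 2 != 0 by rewrite gt_eqF// ltr_pwDl// sqr_ge0.
apply: derivableM; first exact: derivable_cst.
by apply: derivableV => //; apply: ex_derive.
Qed.

Lemma poisson_integral (L : R) : 0 < L -> integ (poisson L) /\ Rint (poisson L) = pi.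
Proof.
move=> L0.
have E : (\int[mu]_x (poisson L x)%:E)%E = (pi : R)%:E.
  rewrite ge0_symfun_integralT; last 3 first.
  - by move=> x; exact: poisson_ge0.
  - exact: poisson_continuous.
  - by move=> x; rewrite /poisson /= mulrN sqrrN.
  rewrite -set_itvcy.
  rewrite (@ge0_continuous_FTC2y _ (poisson L) (fun x => atan (L * x)) 0 (pi / 2)).
  - by rewrite mulr0 atan0 sube0 -EFinM; congr EFin; field.
  - by move=> x _; exact: poisson_ge0.
  - by apply: continuous_subspaceT; exact: poisson_continuous.
  - apply: (cvg_comp (fun x => L * x) (@atan R)); last exact: cvgy_atan.
    by apply: gt0_cvgMry => //; exact: cvg_id.
  - by move=> x _; apply: ex_derive.
  - apply: cvg_at_right_filter; apply: (@continuous_comp _ _ _ (fun x => L * x) atan).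
      exact: mulrl_continuous.
    exact: continuous_atan.
  - move=> x _; rewrite derive1E; apply: derive_val.
    by apply: is_derive_eq; rewrite /poisson /GRing.scale /=; ring.
split; last by rewrite RintE E.
apply/integrableP; split.
  by apply/measurable_EFinP; apply: continuous_measurable_fun; exact: poisson_continuous.
suff -> : (\int[mu]_x `|(EFin \o poisson L) x| = \int[mu]_x (poisson L x)%:E)%E by rewrite E ltry.
by apply: eq_integral => x _ /=; rewrite ger0_norm// poisson_ge0.
Qed.

End PoissonKernel.

Section Cutoff.
Context {R : realType}.
Local Notation mu := (@lebesgue_measure R).
Implicit Types f g c w : R -> R.

Lemma is_derive_affine f f' (a b x : R) : (forall y : R, is_derive (y : R) (1 : R) f (f' y)) ->
  is_derive (x : R) (1 : R) (fun x => f (a * x + b)) (a * f' (a * x + b)).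
Proof.
move=> df; have dg := df (a * x + b).
have da : is_derive x (1 : R) (fun x => a * x + b) a.
  by apply: is_derive_eq; rewrite addr0 scaler1.
by have := @is_derive1_comp _ f (fun x => a * x + b) x _ _ dg da; rewrite mulrC.
Qed.

Lemma cutoff : exists C2 : R, 0 <= C2 /\ forall L, 1 <= L -> exists c c1 c2 : R -> R,
  [/\ smooth c, (forall x, 0 <= c x <= 1), (forall x, `|x| <= L -> c x = 1) &
      (forall x, 2 * L <= `|x| -> c x = 0)] /\
  [/\ forall x, is_derive (x : R) (1 : R) c (c1 x), forall x, is_derive (x : R) (1 : R) c1 (c2 x),
      continuous c2, c1 (3 * L) = 0 /\ c1 (- (3 * L)) = 0 &
      forall x, `|x| <= 3 * L -> `|c2 x| <= C2 / L ^+ 2].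
Proof.
have [rho [S [P [[sr _ _] [[dS S0 S1 S01] _]]]]] := @smooth_step R.
have sS : smooth S by exact: smooth_primitive dS sr.
(* The first factor rises from 0 to 1 on [-2, -1], the second falls from 1 to 0 on [1, 2]. *)
pose chi x := S (2 * x + 3) * S (-2 * x + 3).
have schi : smooth chi by apply: smoothM; exact: smooth_affine.
pose chi1 := derive1 chi; pose chi2 := derive1 chi1.
have schi1 : smooth chi1 by exact: smooth_derive.
have schi2 : smooth chi2 by exact: smooth_derive.
have [C [C0 hC]] := continuous_bounded_itv (-3) 3 (smooth_continuous schi2).
have chi_1 x : `|x| <= 1 -> chi x = 1.
  by rewrite ler_norml => /andP[h1 h2]; rewrite /chi !S1 ?mulr1//; lra.
have chi_0 x : 2 <= `|x| -> chi x = 0.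
  rewrite ler_normr /chi => /orP[h|h].
  - by rewrite (S0 (-2 * x + 3)) ?mulr0//; lra.
  - by rewrite (S0 (2 * x + 3)) ?mul0r//; lra.
(* Vanishing of the derivative is read off a neighbourhood, hence the strict inequality; the end
   points 3L and -3L used below leave room for it. *)
have chi1_0 x : 2 < `|x| -> chi1 x = 0.
  move=> h; rewrite /chi1 derive1E; apply: derive_val.
  apply: (@is_derive_local _ _ (cst 0) _ _ (`|x| - 2)); first by rewrite subr_gt0.
  move=> k hk; apply: chi_0; have := lerB_normD x k; lra.
exists C; split => // L L1; have L0 : 0 < L by lra.
exists (fun x => chi (L^-1 * x + 0)), (fun x => L^-1 * chi1 (L^-1 * x + 0)),
  (fun x => L^-1 * (L^-1 * chi2 (L^-1 * x + 0))).
have nL (x : R) : `|L^-1 * x + 0| = `|x| / L.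
  by rewrite addr0 normrM mulrC (@ger0_norm _ L^-1) // invr_ge0 ltW.
split; split.
- exact: smooth_affine.
- move=> x; rewrite /chi; have /andP[a1 a2] := S01 (2 * (L^-1 * x + 0) + 3).
  have /andP[b1 b2] := S01 (-2 * (L^-1 * x + 0) + 3).
  by rewrite mulr_ge0//= mulr_ile1.
- by move=> x xL; rewrite chi_1// nL ler_pdivrMr// mul1r.
- by move=> x xL; rewrite chi_0// nL ler_pdivlMr.
- move=> x; apply: is_derive_affine => y; exact: smooth_is_derive.
- move=> x; have H := @is_derive_affine chi1 chi2 L^-1 0 x (fun y => smooth_is_derive y schi1).
  by apply: is_derive_eq; rewrite /GRing.scale /=; ring.
- have s2 : smooth (fun x => L^-1 * (L^-1 * chi2 (L^-1 * x + 0))).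
    by apply: smoothZ; apply: smoothZ; exact: smooth_affine.
  exact: smooth_continuous s2.
- by rewrite !chi1_0 ?mulr0// nL ?normrN (@ger0_norm _ (3 * L)) ?mulfK ?gt_eqF//; lra.
- move=> x xL; have iL : 0 <= L^-1 by rewrite invr_ge0 ltW.
  rewrite !normrM (ger0_norm iL) mulrA -expr2 exprVn [leLHS]mulrC.
  rewrite ler_wpM2r ?invr_ge0 ?sqr_ge0//.
  apply: hC; rewrite -ler_norml nL ler_pdivrMr//.
Qed.

End Cutoff.

Section KernelBounds.
Context {R : realType}.
Local Notation mu := (@lebesgue_measure R).
Variables (L C2 : R) (c c1 c2 : R -> R).
Hypotheses (L1 : 1 <= L) (C20 : 0 <= C2) (sc : smooth c)
  (c01 : forall x, 0 <= c x <= 1) (cL : forall x, `|x| <= L -> c x = 1)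
  (c_out : forall x, 2 * L <= `|x| -> c x = 0)
  (dc : forall x, is_derive (x : R) (1 : R) c (c1 x))
  (dc1 : forall x, is_derive (x : R) (1 : R) c1 (c2 x))
  (cc2 : continuous c2) (c1_end : c1 (3 * L) = 0 /\ c1 (- (3 * L)) = 0)
  (c2B : forall x, `|x| <= 3 * L -> `|c2 x| <= C2 / L ^+ 2).

Let L0 : 0 < L. Proof. exact: lt_le_trans L1. Qed.
Let cc : continuous c. Proof. exact: smooth_continuous. Qed.
Let c_supp (x : R) : ~~ (- (2 * L) <= x <= 2 * L) -> c x = 0.
Proof. by rewrite -ler_norml -ltNge => /ltW; exact: c_out. Qed.
Let ccos_cont (y : R) : continuous (fun x : R => c x * cos (y * x)).
Proof. by move=> x; apply: cvgM; [exact: cc|exact: cos_mul_continuous]. Qed.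

Let norm_cos_le1 (z : R) : `|cos z| <= 1.
Proof. by rewrite ler_norml cos_geN1 cos_le1. Qed.

(** Two bounds add up to the Poisson majorant: the kernel is at most 4L, the length of the support,
    and y^2 times the kernel is at most 6 C2 / L after two integrations by parts on an interval of
    length 6L. *)
Lemma cos_ker_bound (y : R) : `|cos_ker c y| <= (4 + 6 * C2) * poisson L y.
Proof.
have L1' := L1; have L0' := L0; have C20' := C20.
have b1 : `|cos_ker c y| <= 4 * L.
  rewrite (_ : 4 * L = 1 * (2 * L - - (2 * L))); last by ring.
  have ab : - (2 * L) <= 2 * L by lra.
  apply: (norm_Rint_supp (@ccos_cont y) ab) => //.
  - by move=> x /c_supp ->; rewrite mul0r.
  - move=> x _; have /andP[h1 h2] := c01 x.
    by rewrite normrM mulr_ile1// ger0_norm.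
have b2 : `|y ^+ 2 * cos_ker c y| <= 6 * C2 / L.
  (* An antiderivative of c'' cos(y x) + y^2 c cos(y x), which carries out both integrations by
     parts at once; it vanishes at 3L and -3L. *)
  pose D x := c1 x * cos (y * x) + y * (c x * sin (y * x)).
  pose d1 x := c2 x * cos (y * x); pose d2 x := c x * cos (y * x).
  have dD x : is_derive (x : R) (1 : R) D (d1 x + y ^+ 2 * d2 x).
    rewrite /D /d1 /d2; have h1 := dc x; have h2 := dc1 x.
    by apply: is_derive_eq; rewrite /GRing.scale /=; ring.
  have cd1 : continuous d1 by move=> x; apply: cvgM; [exact: cc2|exact: cos_mul_continuous].
  have cd : continuous (fun x : R => d1 x + y ^+ 2 * d2 x).
    move=> x; apply: cvgD; first exact: cd1.
    by apply: cvgM; [exact: cvg_cst|exact: ccos_cont].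
  have L3 : - (3 * L) < 3 * L by lra.
  have := Rint_FTC L3 cd dD.
  have [e1 e2] := c1_end.
  rewrite /D e1 e2 !c_out ?mul0r ?mulr0 ?addr0 ?subr0; last 2 first.
  - by rewrite normrN ger0_norm; lra.
  - by rewrite ger0_norm; lra.
  have i1 := continuous_integrable_itv (- (3 * L)) (3 * L) cd1.
  have i2 := continuous_integrable_itv (- (3 * L)) (3 * L) (@ccos_cont y).
  rewrite RintegralD//; last exact: (@integrableZl _ _ _ mu _ _ (y ^+ 2) _ i2).
  rewrite RintegralZl// -(@Rint_supp _ d2 (- (3 * L)) (3 * L)); last first.
    move=> x h; rewrite /d2 c_supp ?mul0r//; apply: contra h => /andP[h1 h2].
    by apply/andP; split; lra.
  rewrite -/(cos_ker c y) => /eqP; rewrite addrC addr_eq0 => /eqP ->; rewrite normrN.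
  apply: (le_trans (le_normr_Rintegral _ i1)) => //.
  apply: (@le_trans _ _ (\int[mu]_(x in `[- (3 * L), 3 * L]) (C2 / L ^+ 2))).
    apply: le_Rintegral => //.
    - exact: (@integrable_norm _ _ _ mu _ d1).
    - by apply: (continuous_integrable_itv _ _ (f := cst _)); exact: cst_continuous.
    - move=> x /=; rewrite in_itv /= -ler_norml => xL.
      rewrite /d1 normrM -[leRHS]mulr1 ler_pM//; exact: c2B.
  rewrite Rintegral_cst//= lebesgue_measure_itv /= lte_fin L3 /=.
  rewrite (_ : _ * _ = 6 * C2 / L)//; field; lra.
rewrite /poisson mulrA ler_pdivlMr; last by rewrite ltr_pwDl ?sqr_ge0.
move: b2; rewrite normrM ger0_norm ?sqr_ge0// ler_pdivlMr// => b2.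
have : y ^+ 2 * `|cos_ker c y| * L * L <= 6 * C2 * L by rewrite ler_wpM2r// ltW.
rewrite exprMn; nra.
Qed.

Let cK : continuous (cos_ker c).
Proof.
apply: (@cos_ker_continuous _ c (2 * L)) => //; by move=> x; have /andP[] := c01 x.
Qed.

Lemma cos_ker_integ : integ (cos_ker c).
Proof.
apply: (integ_continuous_le cK (g := fun y => (4 + 6 * C2) * poisson L y)).
  by apply: integZl; have [] := poisson_integral L0.
exact: cos_ker_bound.
Qed.

End KernelBounds.

Section Mass.
Context {R : realType}.
Local Notation mu := (@lebesgue_measure R).
Implicit Types f g c : R -> R.

Lemma Rint_ge_on f (a b B : R) : a <= b -> integ f -> (forall x, 0 <= f x) ->
  (forall x, a <= x <= b -> B <= f x) -> B * (b - a) <= Rint f.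
Proof.
move=> ab fi f0 fB.
have E : Rint (cst B \_ `[a, b]) = B * (b - a).
  rewrite -[LHS]Rintegral_mkcond Rintegral_cst//= lebesgue_measure_itv /= lte_fin.
  by case: ltP => //= ba; have -> : a = b by [apply/eqP; rewrite eq_le ab]; rewrite subrr.
rewrite -E; apply: le_Rint => //.
  rewrite /integ -restrict_EFin; apply/integrable_restrict => //=; rewrite setTI.
  by apply: (continuous_integrable_itv _ _ (f := cst B)); exact: cst_continuous.
move=> x; rewrite patchE; case: ifPn => [|_]; last exact: f0.
by rewrite inE /= in_itv /=; exact: fB.
Qed.

Lemma cos_ge (t : R) : 1 - t ^+ 2 <= cos t.
Proof.
have dsin (x : R) : is_derive x (1 : R) sin (cos x) by exact: is_derive_sin.
have s (z : R) : `|sin z| <= `|z|.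
  have := @mean_value_le _ sin cos 0 z 1 dsin; rewrite sin0 !subr0 mul1r; apply=> x _.
  by rewrite ler_norml cos_geN1 cos_le1.
have := @mean_value_le _ cos (fun x => - sin x) 0 t `|t|.
rewrite cos0 subr0 -expr2 real_normK ?num_real// => h.
suff : `|cos t - 1| <= t ^+ 2 by rewrite ler_norml => /andP[]; lra.
apply: h => x hx; rewrite normrN (le_trans (s x))// ler_norml.
move: hx; have [t0|t0] := lerP 0 t.
  by rewrite (ger0_norm t0) => /andP[h1 h2]; apply/andP; split; lra.
by rewrite (ltr0_norm t0) => /andP[h1 h2]; apply/andP; split; lra.
Qed.

Lemma max0_dist (a b : R) : `|Num.max 0 a - Num.max 0 b| <= `|a - b|.
Proof.
by case: (leP 0 a) => h1; case: (leP 0 b) => h2;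
  rewrite ?subrr ?subr0 ?sub0r ?normr0// ?normrN; rewrite ?(ler_normr, ler_norml);
  apply/orP; (by left; lra) || (by right; lra).
Qed.

(* The cosine transform of the tent is nonnegative (Fejer), which bounds the integral of
   [cos_ker c] from below without Fourier inversion. *)
Definition tent (n y : R) := Num.max 0 (1 - `|y| / n).

Lemma tent_continuous (n : R) : continuous (tent n).
Proof.
apply: (@lipschitz_continuous _ _ `|n^-1|) => x y.
apply: (@le_trans _ _ `|(1 - `|x| / n) - (1 - `|y| / n)|).
  exact: max0_dist.
rewrite (_ : _ - _ = n^-1 * (`|y| - `|x|)); last by ring.
by rewrite normrM ler_wpM2l// distrC ler_dist_dist.
Qed.

Lemma tent_supp (n y : R) : 0 < n -> ~~ (- n <= y <= n) -> tent n y = 0.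
Proof.
move=> n0; rewrite -ler_norml -ltNge => h; apply/max_idPl.
by rewrite subr_le0 ler_pdivlMr// mul1r ltW.
Qed.

Lemma tent_ge0 (n y : R) : 0 <= tent n y. Proof. by rewrite le_max lexx. Qed.

Lemma tent_le1 (n y : R) : 0 < n -> tent n y <= 1.
Proof. by move=> n0; rewrite ge_max ler01 /= gerBl divr_ge0// ltW. Qed.

Lemma tent_cos_integ (n xi : R) : 0 < n -> integ (fun y : R => tent n y * cos (y * xi)).
Proof.
move=> n0; apply: (@integ_supp _ _ (- n) n).
- move=> y; apply: cvgM; first exact: tent_continuous.
  apply: (@continuous_comp _ _ _ (fun y : R => y * xi) cos).
    exact: mulrr_continuous.
  exact: continuous_cos.
- by move=> y h; rewrite tent_supp// mul0r.
Qed.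

Lemma tent_cos_ge0 (n xi : R) : 0 < n -> 0 <= Rint (fun y => tent n y * cos (y * xi)).
Proof.
move=> n0; have [->|xi0] := eqVneq xi 0.
  by apply: Rint_ge0 => y; rewrite mulr0 cos0 mulr1 tent_ge0.
rewrite (@Rint_supp _ _ (- n) n); last by move=> y h; rewrite tent_supp// mul0r.
(* Antiderivatives on the two sides of the kink of the tent at 0. Together they give 2 (1 - cos(n
   xi)) / (n xi^2), the Fejer kernel. *)
pose G1 y := (1 - y / n) * (sin (y * xi) / xi) - cos (y * xi) / (n * xi ^+ 2).
pose G2 y := (1 + y / n) * (sin (y * xi) / xi) + cos (y * xi) / (n * xi ^+ 2).
have n0' : n != 0 by rewrite gt_eqF.
have d1 y : is_derive (y : R) (1 : R) G1 ((1 - y / n) * cos (y * xi)).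
  by apply: is_derive_eq; rewrite /GRing.scale /=; field; rewrite n0' xi0.
have d2 y : is_derive (y : R) (1 : R) G2 ((1 + y / n) * cos (y * xi)).
  by apply: is_derive_eq; rewrite /GRing.scale /=; field; rewrite n0' xi0.
have cl (k : R) : continuous (fun y : R => (1 + k * y / n) * cos (y * xi)).
  apply: (@continuous_derive _ (fun y => k / n * cos (y * xi) - (1 + k * y / n) * (xi * sin (y * xi)))).
  by move=> y; apply: is_derive_eq; rewrite /GRing.scale /=; ring.
have c1 : continuous (fun y : R => (1 - y / n) * cos (y * xi)).
  by move: (cl (-1)); under eq_fun do rewrite mulN1r mulNr.
have c2 : continuous (fun y : R => (1 + y / n) * cos (y * xi)).
  by move: (cl 1); under eq_fun do rewrite mul1r.
have fi := integ_on (measurable_itv `[- n, n]) (tent_cos_integ xi n0).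
have I := @Rintegral_itvB _ _ (BLeft (- n)) (BRight n) 0 fi.
have n00 : - n < 0 by lra.
move: I; rewrite !bnd_simp (ltW n00) (ltW n0) => /(_ isT isT).
rewrite Rintegral_itv_obnd_cbnd; last first.
  by apply: integrableS fi => //; apply: subset_itvr; rewrite bnd_simp ltW.
rewrite (@eq_Rintegral _ _ _ mu `[0, n] (fun y => (1 - y / n) * cos (y * xi))); last first.
  move=> y; rewrite inE /= in_itv /= => /andP[y0 yn].
  rewrite /tent ger0_norm// max_r// subr_ge0 ler_pdivrMr// mul1r//.
rewrite (@eq_Rintegral _ _ _ mu `[- n, 0] (fun y => (1 + y / n) * cos (y * xi))); last first.
  move=> y; rewrite inE /= in_itv /= => /andP[y0 yn].
  rewrite /tent ler0_norm// mulNr opprK max_r//.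
  by rewrite -(mulfV n0') -mulrDl; apply: divr_ge0; lra.
rewrite (Rint_FTC n0 c1 d1) (Rint_FTC n00 c2 d2) => /eqP; rewrite subr_eq => /eqP ->.
rewrite /G1 /G2 !mul0r !mulNr sinN cosN sin0 cos0 mulfV//.
rewrite (_ : _ + _ = 2 * ((1 - cos (n * xi)) / (n * xi ^+ 2))); last first.
  by field; rewrite n0' xi0.
rewrite mulr_ge0// divr_ge0 ?subr_ge0 ?cos_le1// mulr_ge0 ?sqr_ge0// ltW//.
Qed.

(** For |y| <= n/2 both factors are at least 1/2, on an interval of length n; elsewhere the
    integrand is nonnegative, since |y xi| <= 1 on the support of the tent. *)
Lemma tent_cos_ge (n xi : R) : 0 < n -> `|xi| <= n^-1 ->
  n / 4 <= Rint (fun y => tent n y * cos (y * xi)).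
Proof.
move=> n0 hxi.
have b y : - n <= y <= n -> `|y * xi| <= `|y| / n.
  by move=> _; rewrite normrM ler_wpM2l.
rewrite (_ : n / 4 = 4^-1 * (n / 2 - - (n / 2))); last by field.
apply: Rint_ge_on; [by lra|exact: tent_cos_integ| |].
- move=> y; have [yn|yn] := boolP (- n <= y <= n); last by rewrite tent_supp// mul0r.
  rewrite mulr_ge0 ?tent_ge0// (le_trans _ (cos_ge _))// subr_ge0 -real_normK ?num_real//.
  by rewrite expr_le1// (le_trans (b _ yn))// ler_pdivrMr// mul1r ler_norml.
- move=> y yn2; have yn : - n <= y <= n by case/andP: yn2 => h1 h2; apply/andP; split; lra.
  have yn' : `|y| / n <= 2^-1 by rewrite ler_pdivrMr// mulrC ler_norml.
  have t2 : 2^-1 <= tent n y by rewrite le_max; apply/orP; right; lra.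
  have : 2^-1 <= cos (y * xi).
    rewrite (le_trans _ (cos_ge _))//.
    have := le_trans (b _ yn) yn'; rewrite -[(_ * xi) ^+ 2]real_normK ?num_real//.
    by have := normr_ge0 (y * xi); nra.
  nra.
Qed.

(** Fubini moves the cosine transform onto the tent, where it is nonnegative. On |xi| <= 1/m, where
    [c] is 1, it is at least m/4, which contributes (m/4)(2/m) = 1/2. *)
Lemma tent_ker_mass (m L : R) c : 1 <= m -> 1 <= L -> continuous c -> integ c ->
  (forall x, 0 <= c x) -> (forall x, `|x| <= L -> c x = 1) ->
  2^-1 <= Rint (fun y => tent m y * cos_ker c y).
Proof.
move=> m1 L1 cc ic c0 cL; have m0 : 0 < m by exact: lt_le_trans m1.
have iw : integ (tent m).
  apply: (@integ_supp _ _ (- m) m); first exact: tent_continuous.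
  by move=> y; exact: tent_supp.
rewrite (Rint_swap_cos iw ic).
have -> : 2^-1 = m / 4 * (m^-1 - - m^-1) by field; rewrite gt_eqF.
have im : 0 < m^-1 by rewrite invr_gt0.
pose q := cos_ker (tent m).
have qE xi : Rint (fun y => tent m y * cos (y * xi)) = q xi.
  by rewrite /q /cos_ker; congr Rint; apply/funext => y; rewrite (mulrC y).
have cq : continuous q.
  by apply: (@cos_ker_continuous _ _ m); [exact: tent_continuous|exact: tent_ge0|move=> x; exact: tent_supp].
have qb xi : `|q xi| <= Rint (tent m).
  rewrite -qE; apply: norm_Rint_le => //.
  - exact: integ_measurable (tent_cos_integ xi m0).
  - by move=> y; rewrite normrM ger0_norm ?tent_ge0// ler_piMr ?tent_ge0// ler_norml cos_geN1 cos_le1.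
apply: Rint_ge_on; first by apply: (@le_trans _ _ 0); rewrite ?oppr_le0 ltW.
- apply: (@integ_measurable_le _ _ (fun xi => Rint (tent m) * c xi)).
  + apply: measurable_funM; first exact: integ_measurable.
    rewrite (_ : (fun _ => _) = q); last by apply/funext => xi; exact: qE.
    exact: continuous_measurable_fun.
  + exact: integZl.
  + by move=> xi; rewrite qE normrM (ger0_norm (c0 xi)) mulrC ler_wpM2r.
- by move=> xi; rewrite mulr_ge0// tent_cos_ge0.
- move=> xi hx; have xim : `|xi| <= m^-1 by rewrite ler_norml.
  rewrite cL; first by rewrite mul1r tent_cos_ge.
  by rewrite (le_trans xim)// (le_trans _ L1)// invf_le1.
Qed.

(** The tents tend to 1 pointwise as they widen, and the lower bound 1/2 survives the limit by
    dominated convergence. *)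
Lemma cos_ker_mass (L : R) c : 1 <= L -> continuous c -> integ c ->
  (forall x, 0 <= c x) -> (forall x, `|x| <= L -> c x = 1) ->
  continuous (cos_ker c) -> integ (cos_ker c) -> 2^-1 <= Rint (cos_ker c).
Proof.
move=> L1 cc ic c0 cL cK iK.
pose F (n : nat) y := tent n.+1%:R y * cos_ker c y.
have cF n : continuous (F n).
  by move=> y; apply: cvgM; [exact: tent_continuous|exact: cK].
have lim : (fun n => Rint (F n)) @ \oo --> Rint (cos_ker c).
  apply: (@Rint_dominated _ F _ (fun y => `|cos_ker c y|)).
  - by move=> n; apply: continuous_measurable_fun; exact: cF.
  - by apply: continuous_measurable_fun; exact: cK.
  - exact: integ_norm.
  - by move=> n y; rewrite normrM ler_piMl// ger0_norm ?tent_ge0// tent_le1.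
  move=> y; rewrite -[X in _ --> X]mul1r; apply: cvgM; last exact: cvg_cst.
  apply/cvgrPdist_le => e e0; near=> n.
  have n0 : 0 < n.+1%:R :> R by rewrite ltr0n.
  have ye : `|y| / n.+1%:R <= e.
    rewrite ler_pdivrMr// mulrC -ler_pdivrMr//; apply: ltW.
    apply: (@lt_trans _ _ n%:R); last by rewrite ltr_nat.
    by near: n; exact: nbhs_infty_gtr.
  have := tent_le1 y n0 => t1; rewrite ger0_norm ?subr_ge0// /tent lerBlDr -lerBlDl.
  by rewrite le_max; apply/orP; right; rewrite lerB.
apply: (cvgr_to_ge lim); apply: nearW => n.
by apply: (tent_ker_mass _ L1) => //; rewrite ler1n.
Unshelve. all: by end_near.
Qed.

End Mass.

Section ApproxIdentity.
Context {R : realType}.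
Local Notation mu := (@lebesgue_measure R).
Implicit Types f g c v K : R -> R.

(** The kernels are not normalised: a mass bounded below and a Poisson majorant with [A] independent
    of [L] take the place of mass one. *)
Lemma cos_ker_family : exists A : R, 0 <= A /\ forall L, 1 <= L -> exists c : R -> R,
  [/\ smooth c, (forall x, 0 <= c x <= 1) &
      forall x, ~~ (- (2 * L) <= x <= 2 * L) -> c x = 0] /\
  [/\ continuous (cos_ker c), (forall y, `|cos_ker c y| <= A * poisson L y) &
      2^-1 <= Rint (cos_ker c)].
Proof.
have [C2 [C20 H]] := @cutoff R; exists (4 + 6 * C2); split; first by lra.
move=> L L1; have [c [c1 [c2 [[sc c01 cL cout] [dc dc1 cc2 ce c2B]]]]] := H L L1.
have cs x : ~~ (- (2 * L) <= x <= 2 * L) -> c x = 0.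
  by rewrite -ler_norml -ltNge => /ltW; exact: cout.
have c0 x : 0 <= c x by have /andP[] := c01 x.
have cc := smooth_continuous sc.
have cK := cos_ker_continuous cc c0 cs.
exists c; split; split; [exact: sc|exact: c01|exact: cs|exact: cK| |].
- exact: (cos_ker_bound L1 C20 sc c01 cout dc dc1 cc2 ce c2B).
- apply: (cos_ker_mass L1 cc (integ_supp cc cs) c0 cL cK).
  exact: (cos_ker_integ L1 C20 sc c01 cout dc dc1 cc2 ce c2B).
Qed.

(** L/(1 + L^2 y^2) <= 1/(L y^2), and 1/y^2 <= ((1 + d^2)/d^2) / (1 + y^2) for |y| >= d. Away from
    the origin the kernel is thus O(1/L) times an integrable function independent of [L]. *)
Lemma poisson_far (L d y : R) : 0 < L -> 0 < d -> d <= `|y| ->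
  poisson L y <= (1 + d ^+ 2) / d ^+ 2 / L * poisson 1 y.
Proof.
move=> L0 d0 dy; rewrite /poisson mul1r.
have y2 : d ^+ 2 <= y ^+ 2 by rewrite -[y ^+ 2]real_normK ?num_real// lerXn2r// nnegrE ltW.
have d2 : 0 < d ^+ 2 by rewrite exprn_gt0.
have y20 : 0 < y ^+ 2 by exact: lt_le_trans y2.
have h1 : 0 < 1 + (L * y) ^+ 2 by rewrite ltr_pwDl// sqr_ge0.
have h2 : 0 < 1 + y ^+ 2 by lra.
rewrite mul1r ler_pdivrMr// -(mulrA _ _ (1 + _)) mulrC.
rewrite -subr_ge0 (_ : _ - _ = ((1 + (L * y) ^+ 2) * (1 + d ^+ 2) - L ^+ 2 * d ^+ 2 * (1 + y ^+ 2))
   / (d ^+ 2 * L * (1 + y ^+ 2))); last first.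
  by field; rewrite !gt_eqF.
apply: divr_ge0; last by rewrite ltW// !mulr_gt0.
rewrite exprMn; have L2 : 0 <= L ^+ 2 by rewrite sqr_ge0.
by have : 0 <= L ^+ 2 * (y ^+ 2 - d ^+ 2) by [rewrite mulr_ge0// subr_ge0]; nra.
Qed.

(** Here [v] is continuous and square integrable, without a known bound. Near [x0] continuity
    suffices; far away |v| p <= v^2 + p, where p is [poisson 1] and p <= 1, and [poisson_far]
    supplies the factor 1/L. The estimate is uniform over all kernels under the same majorant. *)
Lemma approx_identity v (A x0 : R) : 0 <= A -> continuous v -> integ (fun x => v x ^+ 2) ->
  (forall K L, 1 <= L -> continuous K -> (forall y, `|K y| <= A * poisson L y) ->
    integ (fun x => v x * K (x - x0))) /\
  forall e, 0 < e -> exists L0, forall L, 1 <= L -> L0 <= L -> forall K,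
    continuous K -> (forall y, `|K y| <= A * poisson L y) ->
    `|Rint (fun x => v x * K (x - x0)) - v x0 * Rint K| <= e.
Proof.
move=> A0 cv iv.
have iP (L : R) : 0 < L -> integ (fun x => poisson L (x - x0)).
  by move=> L0; apply: integ_shift; have [] := poisson_integral L0.
have RP (L : R) : 0 < L -> Rint (fun x => poisson L (x - x0)) = pi.
  by move=> L0; rewrite Rint_shift; have [] := poisson_integral L0.
have iK K L : 1 <= L -> continuous K -> (forall y, `|K y| <= A * poisson L y) ->
    integ (fun x => K (x - x0)).
  move=> L1 cK KA; apply: integ_shift; apply: (integ_continuous_le cK) KA.
  by apply: integZl; have [] := poisson_integral (lt_le_trans ltr01 L1).
have csh K : continuous K -> continuous (fun x => K (x - x0)).
  move=> cK x; apply: (@continuous_comp _ _ _ (fun x => x - x0) K); last exact: cK.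
  by apply: cvgB; [exact: cvg_id|exact: cvg_cst].
pose M d (L : R) x := A * ((1 + d ^+ 2) / d ^+ 2 / L) *
  (v x ^+ 2 + (1 + `|v x0|) * poisson 1 (x - x0)).
have iM d L : integ (M d L).
  by apply: integZl; apply: integD => //; apply: integZl; exact: iP.
have key K (L d eta : R) : 1 <= L -> continuous K -> (forall y, `|K y| <= A * poisson L y) ->
    0 < d -> 0 <= eta -> (forall x, `|x - x0| < d -> `|v x - v x0| <= eta) ->
    forall x, `|(v x - v x0) * K (x - x0)| <= eta * A * poisson L (x - x0) + M d L x.
  move=> L1 cK KA d0 eta0 hd x; have L0 : 0 < L by exact: lt_le_trans L1.
  rewrite normrM; set y := x - x0.
  have pL := poisson_ge0 y L0; have p1 := poisson_ge0 y (@ltr01 R).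
  have d2 : 0 < (1 + d ^+ 2) / d ^+ 2 / L.
    by rewrite !divr_gt0 ?exprn_gt0// ltr_pwDl// sqr_ge0.
  have M0 : 0 <= M d L x.
    apply: mulr_ge0; first by apply: mulr_ge0 => //; exact: ltW.
    apply: addr_ge0; first exact: sqr_ge0.
    by apply: mulr_ge0 => //; apply: addr_ge0.
  have [yd|yd] := ltP `|y| d.
    rewrite -[leLHS]addr0 lerD// -mulrA ler_pM//; exact: hd.
  apply: (@le_trans _ _ (M d L x)); last by rewrite lerDr; apply: mulr_ge0 => //; exact: mulr_ge0.
  apply: (@le_trans _ _ ((`|v x| + `|v x0|) * (A * ((1 + d ^+ 2) / d ^+ 2 / L * poisson 1 y)))).
    rewrite ler_pM ?ler_normB// (le_trans (KA y))// ler_wpM2l//.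
    exact: poisson_far.
  have -> : (`|v x| + `|v x0|) * (A * ((1 + d ^+ 2) / d ^+ 2 / L * poisson 1 y)) =
     A * ((1 + d ^+ 2) / d ^+ 2 / L) * (`|v x| * poisson 1 y + `|v x0| * poisson 1 y).
    by move: ((1 + d ^+ 2) / d ^+ 2 / L) => k; ring.
  apply: ler_wpM2l; first by apply: mulr_ge0 => //; exact: ltW.
  rewrite mulrDl mul1r addrA lerD2r.
  have p1' : poisson 1 y <= 1.
    by rewrite /poisson ler_pdivrMr ?mul1r ?lerDl ?sqr_ge0// ltr_pwDl// sqr_ge0.
  rewrite -[v x ^+ 2]real_normK ?num_real//.
  by have := normr_ge0 (v x); nra.
split=> [K L L1 cK KA|e e0].
  have [/= d d0 hd] : exists2 d : R, 0 < d & forall x, `|x - x0| < d -> `|v x - v x0| <= 1.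
    have /cvgrPdist_le /(_ 1 ltr01)/nbhs_ballP[d /= d0 hd] := cv x0.
    by exists d => // x xd; rewrite distrC; apply: hd; rewrite /ball /= distrC.
  have := key K L d 1 L1 cK KA d0 ler01 hd => B.
  have i1 : integ (fun x => (v x - v x0) * K (x - x0)).
    apply: (integ_continuous_le _ _ B).
      move=> x; apply: cvgM; last exact: csh.
      by apply: cvgB; [exact: cv|exact: cvg_cst].
    by apply: integD => //; apply: integZl; apply: iP; exact: lt_le_trans L1.
  have := integD i1 (integZl (v x0) (iK K L L1 cK KA)).
  by congr integ; apply/funext => x; ring.
(* The near part costs at most eta A pi, and pi <= 4, so this choice keeps it below e/2. *)
pose eta := e / (8 * (A + 1)).
have eta0 : 0 < eta by rewrite divr_gt0//; lra.
have [/= d d0 hd] : exists2 d : R, 0 < d & forall x, `|x - x0| < d -> `|v x - v x0| <= eta.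
  have /cvgrPdist_le /(_ eta eta0)/nbhs_ballP[d /= d0 hd] := cv x0.
  by exists d => // x xd; rewrite distrC; apply: hd; rewrite /ball /= distrC.
pose I := Rint (fun x => v x ^+ 2) + (1 + `|v x0|) * pi.
pose Cd := A * ((1 + d ^+ 2) / d ^+ 2) * I.
have I0 : 0 <= I.
  apply: addr_ge0; first by apply: Rint_ge0 => x; exact: sqr_ge0.
  by apply: mulr_ge0; [apply: addr_ge0|exact: pi_ge0].
have Cd0 : 0 <= Cd.
  apply: mulr_ge0 => //; apply: mulr_ge0 => //; apply: divr_ge0; last exact: sqr_ge0.
  by apply: addr_ge0 => //; exact: sqr_ge0.
exists (2 * Cd / e) => L L1 LL K cK KA.
have L0 : 0 < L by exact: lt_le_trans L1.
have i1 : integ (fun x => (v x - v x0) * K (x - x0)).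
  apply: (integ_continuous_le _ _ (key K L d eta L1 cK KA d0 (ltW eta0) hd)).
    move=> x; apply: cvgM; last exact: csh.
    by apply: cvgB; [exact: cv|exact: cvg_cst].
  by apply: integD => //; apply: integZl; exact: iP.
have -> : Rint (fun x => v x * K (x - x0)) - v x0 * Rint K =
    Rint (fun x => (v x - v x0) * K (x - x0)).
  rewrite -[Rint K](Rint_shift x0); last first.
    apply: (integ_continuous_le cK) KA; apply: integZl.
    by have [] := poisson_integral L0.
  rewrite -RintZl; last exact: iK KA.
  have := integD i1 (integZl (v x0) (iK K L L1 cK KA)) => i2.
  rewrite -RintB; last 2 first.
  - by move: i2; congr integ; apply/funext => x; ring.
  - exact: integZl (iK K L L1 cK KA).
  by congr Rint; apply/funext => x; ring.
apply: (le_trans (norm_Rint_le (integ_measurable i1) _ (key K L d eta L1 cK KA d0 (ltW eta0) hd))).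
  by apply: integD => //; apply: integZl; exact: iP.
rewrite RintD//; last by apply: integZl; exact: iP.
rewrite RintZl ?RP//; last exact: iP.
rewrite /M RintZl; last by apply: integD => //; apply: integZl; exact: iP.
rewrite RintD//; last by apply: integZl; exact: iP.
rewrite RintZl ?RP//; last exact: iP.
rewrite -/I.
have -> : A * ((1 + d ^+ 2) / d ^+ 2 / L) * I = Cd / L by rewrite /Cd; ring.
have h1 : Cd / L <= e / 2.
  by move: LL; rewrite !ler_pdivrMr//; lra.
have h2 : eta * A * pi <= e / 2.
  have p4 : pi <= 4 :> R by have := @pihalf_lt2 R; lra.
  have A1 : A + 1 != 0 by rewrite gt_eqF// ltr_wpDl.
  have e8 : eta * (A + 1) = e / 8 by rewrite /eta; field.
  have p0 := @pi_ge0 R.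
  have : eta * A * pi <= eta * A * 4 by rewrite ler_wpM2l// mulr_ge0// ltW.
  nra.
lra.
Qed.

End ApproxIdentity.

Section Sobolev.
Context {R : realType}.
Local Notation mu := (@lebesgue_measure R).
Implicit Types f g c v K : R -> R.

Lemma Rint_sum n (F : nat -> R -> R) : (forall i, (i < n)%N -> integ (F i)) ->
  integ (fun x => \sum_(i < n) F i x) /\
  Rint (fun x => \sum_(i < n) F i x) = \sum_(i < n) Rint (F i).
Proof. exact: Rintegral_sum. Qed.

Lemma eventually_forall n (P : nat -> R -> Prop) :
  (forall i, (i < n)%N -> exists L0, forall L, L0 <= L -> P i L) ->
  exists L0, forall i, (i < n)%N -> forall L, L0 <= L -> P i L.
Proof.
elim: n => [|n IH] H; first by exists 0.
have [L1 H1] := IH (fun i h => H i (ltn_trans h (ltnSn n))).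
have [L2 H2] := H n (ltnSn n); exists (Num.max L1 L2) => i.
rewrite ltnS leq_eqVlt => /orP[/eqP ->|hi] L; rewrite ge_max => /andP[h1 h2].
- exact: H2.
- exact: H1.
Qed.

(** Young's inequality in place of Cauchy-Schwarz: with w = 1 + xi^2, the product w a = (w^(3/2) a)
    w^(-1/2) is split with weight sqrt M, so that both resulting integrals are of order sqrt M. The
    constant 5 is 1 + 4, from pi <= 4. *)
Lemma Hs_weighted_L1 (s M : R) (g1 g2 : R -> R) : 3 <= s -> 0 < M ->
  measurable_fun setT g1 -> measurable_fun setT g2 ->
  (\int[mu]_(xi in setT) (((1 + xi ^+ 2) `^ s * (g1 xi ^+ 2 + g2 xi ^+ 2))%:E) <= M%:E)%E ->
  exists G, [/\ integ G, Rint G <= 5 * Num.sqrt M &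
    forall xi, (1 + xi ^+ 2) * (`|g1 xi| + `|g2 xi|) <= G xi].
Proof.
move=> s3 M0 mg1 mg2 HM.
pose H xi := (1 + xi ^+ 2) `^ s * (g1 xi ^+ 2 + g2 xi ^+ 2).
have H0 xi : 0 <= H xi by rewrite mulr_ge0 ?powR_ge0// addr_ge0 ?sqr_ge0.
have iH : integ H.
  apply/integrableP; split.
    apply/measurable_EFinP; apply: measurable_funM.
      apply: (measurableT_comp (measurable_powR s)).
      by apply: measurable_funD => //; exact: exprn_measurable.
    by apply: measurable_funD; apply: measurable_funX.
  apply: (@le_lt_trans _ _ M%:E); last exact: ltry.
  suff -> : (\int[mu]_x `|(EFin \o H) x| = \int[mu]_x (H x)%:E)%E by [].
  by apply: eq_integral => x _ /=; rewrite ger0_norm.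
have RH : Rint H <= M by rewrite -lee_fin -EFin_Rint.
pose l := Num.sqrt M; have l0 : 0 < l by rewrite sqrtr_gt0.
have ll : l * l = M by rewrite -expr2 sqr_sqrtr// ltW.
have [iP RP] := poisson_integral (@ltr01 R).
exists (fun xi => l^-1 * H xi + l * poisson 1 xi).
have i1 : integ (fun xi => l^-1 * H xi) by exact: integZl.
have i2 : integ (fun xi => l * poisson 1 xi) by exact: integZl.
split; first exact: integD.
  rewrite RintD// RintZl// RintZl// RP.
  have p4 : pi <= 4 :> R by have := @pihalf_lt2 R; lra.
  have : l^-1 * Rint H <= l.
    by rewrite -(ler_pM2l l0) mulrA divff ?gt_eqF// mul1r ll.
  have : l * pi <= l * 4 by rewrite ler_wpM2l// ltW.
  rewrite -/l; lra.
move=> xi; set W := 1 + xi ^+ 2.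
have W1 : 1 <= W by rewrite lerDl sqr_ge0.
have W0 : 0 < W by exact: lt_le_trans W1.
have Ws : W ^+ 3 <= W `^ s by rewrite -(powR_mulrn 3 (ltW W0)) ler_powR.
have HW : W ^+ 3 * (g1 xi ^+ 2 + g2 xi ^+ 2) <= H xi.
  by rewrite ler_wpM2r// addr_ge0 ?sqr_ge0.
apply: (@le_trans _ _ (l^-1 * (W ^+ 3 * (g1 xi ^+ 2 + g2 xi ^+ 2)) + l * poisson 1 xi)); last first.
  by rewrite lerD2r ler_wpM2l// invr_ge0 ltW.
rewrite /poisson mul1r -/W mul1r -[g1 xi ^+ 2]real_normK ?num_real// -[g2 xi ^+ 2]real_normK ?num_real//.
have key (k w a b : R) : 0 < k -> 0 < w ->
    w * (a + b) <= k^-1 * (w ^+ 3 * (a ^+ 2 + b ^+ 2)) + k * w^-1.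
  move=> k0 w0; rewrite -subr_ge0.
  have -> : k^-1 * (w ^+ 3 * (a ^+ 2 + b ^+ 2)) + k * w^-1 - w * (a + b) =
      ((w ^+ 2 * a - k / 2) ^+ 2 + (w ^+ 2 * b - k / 2) ^+ 2 + k ^+ 2 / 2) / (k * w).
    by field; rewrite !gt_eqF.
  apply: divr_ge0; last by apply: mulr_ge0; exact: ltW.
  by apply: addr_ge0; [apply: addr_ge0; exact: sqr_ge0|apply: divr_ge0 => //; exact: sqr_ge0].
exact: key.
Qed.

Lemma test_fun_cutoff c (L x0 : R) : smooth c ->
  (forall x, ~~ (- (2 * L) <= x <= 2 * L) -> c x = 0) ->
  test_fun (fun xi => c xi * cos (x0 * xi)) /\ test_fun (fun xi => c xi * sin (x0 * xi)).
Proof.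
move=> sc cs; have [s1 s2] := smooth_trig x0.
have c0 x : 2 * L < `|x| -> c x = 0.
  by move=> h; apply: cs; rewrite -ler_norml -ltNge.
split; (split; [exact: smoothM|exists (2 * L) => x /c0 ->; rewrite mul0r//]).
Qed.

(* The weight [1 + xi^2] on the symbol of the functional is what two extra derivatives of
   [v] pay for: a second difference satisfies the bound with [b] the product of its steps. *)
Lemma Hs_functional_bound (s M : R) v n (a X : nat -> R) (b : R) :
  3 <= s -> 0 < M -> continuous v -> Hs_bound s v M -> 0 <= b ->
  (forall xi, `|\sum_(i < n) a i * cos (X i * xi)| <= b * (1 + xi ^+ 2)) ->
  (forall xi, `|\sum_(i < n) a i * sin (X i * xi)| <= b * (1 + xi ^+ 2)) ->
  `|\sum_(i < n) a i * v (X i)| <= 10 * Num.sqrt M * b.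
Proof.
move=> s3 M0 cv [g1 [g2 [[[mv iv] [mg1 [mg2 FT]]] HM]]] b0 bc bs.
have [G [iG RG gG]] := Hs_weighted_L1 s3 M0 mg1 mg2 HM.
have [A [A0 fam]] := @cos_ker_family R.
have gle xi : `|g1 xi| <= G xi /\ `|g2 xi| <= G xi.
  have := gG xi; have := sqr_ge0 xi; have := normr_ge0 (g1 xi); have := normr_ge0 (g2 xi).
  by split; nra.
have id i L : 1 <= L -> forall c, smooth c -> (forall x, 0 <= c x <= 1) ->
    (forall x, ~~ (- (2 * L) <= x <= 2 * L) -> c x = 0) -> continuous (cos_ker c) ->
    (forall y, `|cos_ker c y| <= A * poisson L y) ->
    let F := fun xi => g1 xi * (c xi * cos (X i * xi)) - g2 xi * (c xi * sin (X i * xi)) in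
    integ F /\ Rint F = Rint (fun x => v x * cos_ker c (x - X i)).
  move=> L1 c sc c01 cs cK KA F.
  have [t1 t2] := test_fun_cutoff (X i) sc cs.
  have [E1 _] := FT _ t1; have [_ E2] := FT _ t2.
  have ct1 := smooth_continuous (proj1 t1); have ct2 := smooth_continuous (proj1 t2).
  have i1 : integ (fun xi => g1 xi * (c xi * cos (X i * xi))).
    apply: integ_measurable_le iG _.
      by apply: measurable_funM => //; exact: continuous_measurable_fun.
    move=> xi; have [h _] := gle xi; rewrite normrM (le_trans _ h)// ler_piMr//.
    have /andP[h1 h2] := c01 xi; rewrite normrM mulr_ile1// ?(ger0_norm h1)//.
    by rewrite ler_norml cos_geN1 cos_le1.
  have i2 : integ (fun xi => g2 xi * (c xi * sin (X i * xi))).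
    apply: integ_measurable_le iG _.
      by apply: measurable_funM => //; exact: continuous_measurable_fun.
    move=> xi; have [_ h] := gle xi; rewrite normrM (le_trans _ h)// ler_piMr//.
    have /andP[h1 h2] := c01 xi; rewrite normrM mulr_ile1// ?(ger0_norm h1)//.
    by rewrite ler_norml sin_geN1 sin_le1.
  split; first exact: integB.
  rewrite /F (RintB i1 i2) E1 E2 opprK.
  have cc := smooth_continuous sc.
  have ik (y : R) : integ (fun xi => c xi * cos (y * xi)).
    apply: (@integ_supp _ _ (- (2 * L)) (2 * L)).
      by move=> x; apply: cvgM; [exact: cc|exact: cos_mul_continuous].
    by move=> x /cs ->; rewrite mul0r.
  (* With K = [cos_ker c], the product formulas give half the sum and half the difference of K(x -
     X) and K(x + X). In [F] the reflected terms cancel, which leaves K(x - X). *)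
  have C (x : R) : cos_tr (fun xi => c xi * cos (X i * xi)) x =
      2^-1 * (cos_ker c (x - X i) + cos_ker c (x - - X i)).
    rewrite /cos_ker -(RintD (ik _) (ik _)) -(RintZl _ (integD (ik _) (ik _))).
    by congr Rint; apply/funext => xi; rewrite (mulrC xi x) opprK mulrBl mulrDl cosB cosD; field.
  have Sn (x : R) : sin_tr (fun xi => c xi * sin (X i * xi)) x =
      2^-1 * (cos_ker c (x - X i) - cos_ker c (x - - X i)).
    rewrite /cos_ker -(RintB (ik _) (ik _)) -(RintZl _ (integB (ik _) (ik _))).
    by congr Rint; apply/funext => xi; rewrite (mulrC xi x) opprK mulrBl mulrDl cosB cosD; field.
  have [j1 _] := approx_identity (X i) A0 cv iv.
  have [j2 _] := approx_identity (- X i) A0 cv iv.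
  have {}j1 := j1 _ L L1 cK KA; have {}j2 := j2 _ L L1 cK KA.
  rewrite (_ : (fun xi => v xi * cos_tr _ xi) = fun x => 2^-1 * (v x * cos_ker c (x - X i))
      + 2^-1 * (v x * cos_ker c (x - - X i))); last first.
    by apply/funext => x; rewrite C; ring.
  rewrite (_ : (fun xi => v xi * sin_tr _ xi) = fun x => 2^-1 * (v x * cos_ker c (x - X i))
      - 2^-1 * (v x * cos_ker c (x - - X i))); last first.
    by apply/funext => x; rewrite Sn; ring.
  rewrite RintD; [|exact: integZl|exact: integZl].
  rewrite RintB; [|exact: integZl|exact: integZl].
  by rewrite (RintZl _ j1) (RintZl _ j2); field.
apply/ler_addgt0Pr => e e0.
pose Sa : R := \sum_(i < n) `|a i|; have Sa0 : 0 <= Sa by exact: sumr_ge0.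
pose e' : R := e / (2 * (Sa + 1)).
have e'0 : 0 < e' by rewrite divr_gt0//; lra.
have [L0 HL] : exists L0, forall i, (i < n)%N -> forall L, L0 <= L -> 1 <= L ->
    forall K, continuous K -> (forall y, `|K y| <= A * poisson L y) ->
    `|Rint (fun x => v x * K (x - X i)) - v (X i) * Rint K| <= e'.
  apply: eventually_forall => i _; have [_ H] := approx_identity (X i) A0 cv iv.
  by have [L0 HL] := H e' e'0; exists L0 => L h1 h2; exact: HL.
pose L := Num.max L0 1.
have L1 : 1 <= L by rewrite le_max lexx orbT.
have LL0 : L0 <= L by rewrite le_max lexx.
have [c [[sc c01 cs] [cK KA J]]] := fam L L1.
set J0 := Rint (cos_ker c) in J.
pose F i xi := a i * (g1 xi * (c xi * cos (X i * xi)) - g2 xi * (c xi * sin (X i * xi))).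
have iF i : (i < n)%N -> integ (F i).
  by move=> _; apply: integZl; have [] := id i L L1 c sc c01 cs cK KA.
have [iS ES] := Rint_sum iF.
have B1 : `|Rint (fun x => \sum_(i < n) F i x)| <= b * (5 * Num.sqrt M).
  apply: (@le_trans _ _ (b * Rint G)); last by rewrite ler_wpM2l.
  rewrite -RintZl//; apply: norm_Rint_le; [exact: integ_measurable|exact: integZl|].
  move=> xi; rewrite /F.
  have -> : \sum_(i < n) a i * (g1 xi * (c xi * cos (X i * xi)) - g2 xi * (c xi * sin (X i * xi)))
    = g1 xi * c xi * (\sum_(i < n) a i * cos (X i * xi)) -
      g2 xi * c xi * (\sum_(i < n) a i * sin (X i * xi)).
    rewrite !mulr_sumr -sumrB; apply: eq_bigr => i _; ring.
  rewrite (le_trans (ler_normB _ _))// !normrM.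
  have /andP[h1 h2] := c01 xi; rewrite (ger0_norm h1).
  have cW (x y : R) : 0 <= x -> x * c xi * `|y| <= x * `|y|.
    by move=> x0; rewrite -mulrA ler_wpM2l// ler_piMl.
  apply: (@le_trans _ _ (b * ((1 + xi ^+ 2) * (`|g1 xi| + `|g2 xi|)))); last by rewrite ler_wpM2l.
  have k1 := cW _ (\sum_(i < n) a i * cos (X i * xi)) (normr_ge0 (g1 xi)).
  have k2 := cW _ (\sum_(i < n) a i * sin (X i * xi)) (normr_ge0 (g2 xi)).
  have k3 := ler_wpM2l (normr_ge0 (g1 xi)) (bc xi).
  have k4 := ler_wpM2l (normr_ge0 (g2 xi)) (bs xi).
  lra.
have B2 : `|\sum_(i < n) a i * (v (X i) * J0) - Rint (fun x => \sum_(i < n) F i x)| <= Sa * e'.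
  rewrite ES -sumrB /Sa mulr_suml (le_trans (ler_norm_sum _ _ _))//.
  apply: ler_sum => i _.
  have [iFi EFi] := id i L L1 c sc c01 cs cK KA.
  rewrite /F RintZl// EFi -mulrBr normrM ler_wpM2l// distrC.
  exact: (HL i (ltn_ord i) L LL0 L1 _ cK KA).
have E : \sum_(i < n) a i * (v (X i) * J0) = (\sum_(i < n) a i * v (X i)) * J0.
  by rewrite mulr_suml; apply: eq_bigr => i _; rewrite mulrA.
rewrite E in B2.
have Se : Sa * e' <= e / 2.
  have e8 : e' * (Sa + 1) = e / 2 by rewrite /e'; field; rewrite gt_eqF//; lra.
  nra.
set V := \sum_(i < n) a i * v (X i) in B2 *.
have J00 : 0 <= J0 by lra.
(* Dividing by J0 >= 1/2 doubles the right side: the constant 10 is twice the 5 of the weighted L^1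
   bound. *)
have : `|V| * J0 <= b * (5 * Num.sqrt M) + e / 2.
  rewrite -{1}(ger0_norm J00) -normrM.
  have := lerB_dist (V * J0) (Rint (fun x => \sum_(i < n) F i x)); lra.
have := normr_ge0 V; nra.
Qed.

End Sobolev.

(** * Weak derivatives and differences *)

Section Mollify.
Context {R : realType}.
Local Notation mu := (@lebesgue_measure R).
Implicit Types f g : R -> R.

(** The rescaled bump has mass one by the fundamental theorem applied to [S], without a dilation of
    integrals; its support shrinks into a neighbourhood where [g] varies by at most eta. *)
Lemma mollify rho S g (a : R) : smooth rho -> (forall x, 0 <= rho x) ->
  (forall x, 1 <= `|x| -> rho x = 0) ->
  (forall x, is_derive (x : R) (1 : R) S (rho x)) ->
  (forall x, x <= -1 -> S x = 0) -> (forall x, 1 <= x -> S x = 1) ->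
  continuous g -> forall eta, 0 < eta -> exists2 e0 : R, 0 < e0 &
  forall e, 0 < e -> e < e0 ->
    integ (fun x => g x * (e^-1 * rho (e^-1 * x - a / e))) /\
    `|Rint (fun x => g x * (e^-1 * rho (e^-1 * x - a / e))) - g a| <= eta.
Proof.
move=> sr r0 rs dS S0 S1 cg eta eta0.
have /cvgrPdist_le /(_ eta eta0)/nbhs_ballP[d /= d0 hd] := cg a.
exists d => // e e0 ed; have ie : 0 < e^-1 by rewrite invr_gt0.
pose r x := e^-1 * rho (e^-1 * x - a / e).
have cr : continuous r.
  by apply: smooth_continuous; apply: smoothZ; exact: smooth_affine.
have rE x : e^-1 * x - a / e = (x - a) / e by rewrite mulrBl mulrC.
have rsupp x : ~~ (a - e <= x <= a + e) -> r x = 0.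
  move=> h; rewrite /r rs ?mulr0// rE normrM (ger0_norm (ltW ie)) ler_pdivlMr// mul1r.
  rewrite leNgt; apply: contra h; rewrite ltr_norml => /andP[h1 h2].
  by apply/andP; split; lra.
have dR x : is_derive (x : R) (1 : R) (fun x => S (e^-1 * x - a / e)) (r x).
  exact: is_derive_affine.
have ae : a - e < a + e by lra.
have R1 : Rint r = 1.
  rewrite (Rint_supp rsupp) (Rint_FTC ae cr dR) !rE S1 ?S0 ?subr0//.
  - by rewrite ler_pdivrMr//; lra.
  - by rewrite ler_pdivlMr//; lra.
have ir : integ r by exact: integ_supp rsupp.
have ig : integ (fun x => g x * r x).
  apply: (@integ_supp _ _ (a - e) (a + e)); last by move=> x /rsupp ->; rewrite mulr0.
  by move=> x; apply: cvgM; [exact: cg|exact: cr].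
split=> //; rewrite -[X in _ - X]mulr1 -R1 -RintZl// -RintB//; last exact: integZl.
rewrite -[leRHS]mulr1 -R1 -RintZl//; apply: norm_Rint_le.
- by apply: integ_measurable; apply: integB => //; exact: integZl.
- exact: integZl.
move=> x; rewrite -mulrBl normrM.
have rx0 : 0 <= r x by rewrite mulr_ge0 ?r0// ltW.
rewrite (ger0_norm rx0).
have [/rsupp ->|] := boolP (~~ (a - e <= x <= a + e)); first by rewrite !mulr0.
rewrite negbK => /andP[h1 h2]; rewrite ler_wpM2r// distrC; apply: hd.
by rewrite /ball /= ltr_norml; apply/andP; split; lra.
Qed.

End Mollify.

Section FiniteMeasure.
Context {R : realType}.
Variable m : {finite_measure set R -> \bar R}.
Implicit Types f g w : R -> R.

Definition mass : R := fine (m setT).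
Definition cdf (x : R) : R := fine (m `]-oo, x]%classic).

Lemma mass_ge0 : 0 <= mass.
Proof. by apply: fine_ge0; exact: measure_ge0. Qed.

Lemma integrable_bounded f B : measurable_fun setT f -> (forall x, `|f x| <= B) ->
  m.-integrable setT (EFin \o f).
Proof.
move=> mf fB; apply: (@le_integrable _ _ _ _ _ _ _ (EFin \o cst B)) => //.
- exact/measurable_EFinP.
- by move=> x _; rewrite lee_fin (le_trans (fB x))// ler_norm.
- exact: finite_measure_integrable_cst.
Qed.

Lemma norm_Rintegral_bounded f B : measurable_fun setT f -> (forall x, `|f x| <= B) ->
  `|Rintegral m setT f| <= B * mass.
Proof.
move=> mf fB; have fi := integrable_bounded mf fB.
apply: (le_trans (le_normr_Rintegral _ fi)) => //.
rewrite -Rintegral_cst//; apply: le_Rintegral => //.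
- exact: (@integrable_norm _ _ _ m setT f).
- exact: finite_measure_integrable_cst.
Qed.

Lemma cdf_ge0 x : 0 <= cdf x.
Proof. by apply: fine_ge0; exact: measure_ge0. Qed.

Lemma cdf_le x : cdf x <= mass.
Proof.
apply: fine_le; [exact: fin_num_measure|exact: fin_num_measure|].
by apply: le_measure; rewrite ?inE.
Qed.

(** Half-open intervals matter because the measure may have atoms: [cdf b - cdf a] is exactly the
    mass of ]a, b], and adjacent cells never share an atom. *)
Lemma norm_Rintegral_itv w (a b B : R) : a <= b -> 0 <= B -> measurable_fun setT w ->
  (forall x, a < x <= b -> `|w x| <= B) -> (forall x, ~~ (a < x <= b) -> w x = 0) ->
  `|Rintegral m setT w| <= B * (cdf b - cdf a).
Proof.
move=> ab B0 mw wB w0.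
have wB' x : `|w x| <= B.
  by have [/wB//|/w0 ->] := boolP (a < x <= b); rewrite normr0.
have wi := integrable_bounded mw wB'.
have wE : w = w \_ `]a, b].
  apply/funext => x; rewrite patchE; case: ifPn => //.
  by rewrite notin_setE /= in_itv /= => /negP h; rewrite w0.
rewrite wE -Rintegral_mkcond.
have wi' : m.-integrable `]a, b] (EFin \o w) by exact: integrableS wi.
apply: (le_trans (le_normr_Rintegral _ wi')) => //.
have -> : cdf b - cdf a = fine (m `]a, b]%classic).
  rewrite /cdf (@itv_bndbnd_setU _ _ _ (BRight a)) ?bnd_simp//.
  rewrite measureU//; last first.
    apply/seteqP; split => // x /= []; rewrite !in_itv /= => h /andP[h' _].
    by move: (lt_le_trans h' h); rewrite ltxx.
  by rewrite fineD ?fin_num_measure// addrAC subrr add0r.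
rewrite -Rintegral_cst//; apply: le_Rintegral => //.
- exact: (@integrable_norm _ _ _ m `]a, b] w).
- exact: finite_measure_integrable_cst.
Qed.

End FiniteMeasure.

Section WeakDerivatives.
Context {R : realType}.
Local Notation mu := (@lebesgue_measure R).
Implicit Types f g w phi : R -> R.

Lemma test_fun_local0 phi (M : R) : (forall x, M < `|x| -> phi x = 0) ->
  forall x, M < `|x| -> derive1 phi x = 0.
Proof.
move=> p0 x xM; rewrite derive1E; apply: derive_val.
apply: (@is_derive_local _ _ (cst 0) _ _ (`|x| - M)); first by rewrite subr_gt0.
by move=> k hk; apply: p0; have := lerB_normD x k; lra.
Qed.

Lemma test_fun_derive phi : test_fun phi -> test_fun (derive1 phi).
Proof.
move=> [sp [M pM]]; split; first exact: smooth_derive.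
by exists M; exact: test_fun_local0.
Qed.

(** The test function is a smoothed indicator of [a, b], whose derivative samples [f] near both end
    points. The margin [eta] is the room taken by the smoothing. *)
Lemma weak_deriv_increment f f' (a b eta : R) : continuous f -> integ f' ->
  weak_deriv f f' -> a <= b -> 0 < eta ->
  `|f b - f a| <= cumul f' (b + eta) - cumul f' (a - eta).
Proof.
move=> cf if' wf ab eta0.
have [rho [S [P [[sr r0 rs] [[dS S0 S1 S01] _]]]]] := @smooth_step R.
have sS : smooth S by exact: smooth_primitive dS sr.
apply/ler_addgt0Pl => t t0; have t20 : 0 < t / 2 by lra.
have [ea ea0 ha] := mollify a sr r0 rs dS S0 S1 cf t20.
have [eb eb0 hb] := mollify b sr r0 rs dS S0 S1 cf t20.
have [e [e0 eea eeb eeta]] : exists e : R, [/\ 0 < e, e < ea, e < eb & e <= eta].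
  exists (Num.min (Num.min ea eb) eta / 2).
  have m0 : 0 < Num.min (Num.min ea eb) eta by rewrite !lt_min ea0 eb0.
  have m1 : Num.min (Num.min ea eb) eta <= ea by rewrite !ge_min lexx.
  have m2 : Num.min (Num.min ea eb) eta <= eb by rewrite !ge_min lexx orbT.
  have m3 : Num.min (Num.min ea eb) eta <= eta by rewrite !ge_min lexx orbT.
  by split; lra.
have ie : 0 < e^-1 by rewrite invr_gt0.
have [ia {}ha] := ha e e0 eea; have [ib {}hb] := hb e e0 eeb.
have E x p : e^-1 * x - p / e = (x - p) / e by rewrite mulrBl mulrC.
pose phi x := S (e^-1 * x - a / e) - S (e^-1 * x - b / e).
have sphi : smooth phi by apply: smoothB; exact: smooth_affine.
have dphi x : is_derive (x : R) (1 : R) phi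
    (e^-1 * rho (e^-1 * x - a / e) - e^-1 * rho (e^-1 * x - b / e)).
  by apply: is_deriveB; exact: is_derive_affine.
have phi0 x : ~~ (a - eta < x <= b + eta) -> phi x = 0.
  rewrite negb_and -leNgt -ltNge /phi !E => /orP[h|h].
  - by rewrite !S0 ?subrr// ler_pdivrMr//; lra.
  - by rewrite !S1 ?subrr// ler_pdivlMr//; lra.
have tphi : test_fun phi.
  split=> //; exists (`|a| + `|b| + eta) => x hx; apply: phi0.
  apply/negP => /andP[h1 h2]; move: hx; rewrite ltNge => /negP; apply.
  have := ler_norm a; have := ler_norm (- a); have := ler_norm b; have := ler_norm (- b).
  rewrite !normrN => n1 n2 n3 n4; have := normr_ge0 a; have := normr_ge0 b => n5 n6.
  by rewrite ler_norml; apply/andP; split; lra.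
have := wf _ tphi; rewrite (is_derive_fun dphi).
have -> : (fun x => f x * (e^-1 * rho (e^-1 * x - a / e) - e^-1 * rho (e^-1 * x - b / e))) =
  (fun x => f x * (e^-1 * rho (e^-1 * x - a / e)) - f x * (e^-1 * rho (e^-1 * x - b / e))).
  by apply/funext => x; rewrite mulrBr.
rewrite (RintB ia ib) => W.
have B : `|Rint (fun x => f' x * phi x)| <= cumul f' (b + eta) - cumul f' (a - eta).
  apply: norm_Rint_cumul => //; first by lra.
  - apply: measurable_funM; first exact: integ_measurable.
    by apply: continuous_measurable_fun; exact: smooth_continuous sphi.
  - move=> x; rewrite normrM ler_piMr// /phi.
    have /andP[s1 s2] := S01 (e^-1 * x - a / e); have /andP[s3 s4] := S01 (e^-1 * x - b / e).
    by rewrite ler_norml; apply/andP; split; lra.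
  - by move=> x /phi0 ->; rewrite mulr0.
move: B; rewrite -normrN -W.
move: ha hb; rewrite !ler_norml => /andP[a1 a2] /andP[b1 b2] /andP[c1 c2].
by apply/andP; split; lra.
Qed.

(** Its distributional second derivative is delta_a - delta_y - delta_z + delta_b. For a <= y, z <=
    b with a + b = y + z it is a trapezoid, and a triangle if moreover y = z. *)
Definition kinks (a y z b t : R) : R :=
  Num.max (t - a) 0 - Num.max (t - y) 0 - Num.max (t - z) 0 + Num.max (t - b) 0.

Lemma ramp_continuous (a : R) : continuous (fun t : R => Num.max (t - a) 0).
Proof.
apply: (@lipschitz_continuous _ _ 1) => x y; rewrite mul1r.
rewrite ![Num.max _ 0]maxC (_ : x - y = (x - a) - (y - a)); last by ring.
exact: max0_dist.
Qed.

Lemma kinks_continuous a y z b : continuous (kinks a y z b).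
Proof.
by move=> t; apply: cvgD; [apply: cvgB; [apply: cvgB|]|]; exact: ramp_continuous.
Qed.

(* The ramps of [kinks] cancel at infinity because [a + b = y + z], so a mollified [kinks]
   is a test function whose second derivative samples [f] at the four points. *)
Lemma fourth_difference f f' (mu1 mu2 : {finite_measure set R -> \bar R}) (a y z b : R) :
  continuous f -> weak_deriv f f' -> cond_C2 f' mu1 mu2 -> a + b = y + z ->
  f a - f y - f z + f b =
  Rintegral mu1 setT (kinks a y z b) - Rintegral mu2 setT (kinks a y z b).
Proof.
move=> cf wf C2 ab.
have [rho [S [P [[sr r0 rs] [[dS S0 S1 S01] [dP P0 P1 PB]]]]]] := @smooth_step R.
have sS : smooth S by exact: smooth_primitive dS sr.
have sP : smooth P by exact: smooth_primitive dP sS.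
apply/eqP; rewrite -subr_eq0 -normr_le0; apply/ler_addgt0Pl => t t0; rewrite addr0.
pose k1 := mass mu1; pose k2 := mass mu2.
have k10 : 0 <= k1 := mass_ge0 mu1; have k20 : 0 <= k2 := mass_ge0 mu2.
have t80 : 0 < t / 8 by lra.
have [ea ea0 ha] := mollify a sr r0 rs dS S0 S1 cf t80.
have [ey ey0 hy] := mollify y sr r0 rs dS S0 S1 cf t80.
have [ez ez0 hz] := mollify z sr r0 rs dS S0 S1 cf t80.
have [eb eb0 hb] := mollify b sr r0 rs dS S0 S1 cf t80.
(* Budget for [t]: four mollified samples at t/8 each, and at most t/2 for replacing [kinks] by the
   test function. The latter has uniform error 8e (four ramps at 2e), tested against both masses. *)
pose m := Num.min (Num.min (Num.min ea ey) (Num.min ez eb)) (t / (16 * (k1 + k2 + 1))).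
have m0 : 0 < m by rewrite !lt_min ea0 ey0 ez0 eb0 divr_gt0//; lra.
have [e [e0 eea eey eez eeb] et] : exists2 e : R, [/\ 0 < e, e < ea, e < ey, e < ez & e < eb] &
    8 * e * (k1 + k2) <= t / 2.
  exists (m / 2).
    have m1 : m <= ea by rewrite !ge_min lexx.
    have m2 : m <= ey by rewrite !ge_min lexx !orbT.
    have m3 : m <= ez by rewrite !ge_min lexx !orbT.
    have m4 : m <= eb by rewrite !ge_min lexx !orbT.
    by split; lra.
  have : m <= t / (16 * (k1 + k2 + 1)) by rewrite ge_min lexx orbT.
  rewrite ler_pdivlMr; last by lra.
  nra.
have ie : 0 < e^-1 by rewrite invr_gt0.
have [ia {}ha] := ha e e0 eea; have [iy {}hy] := hy e e0 eey.
have [iz {}hz] := hz e e0 eez; have [ib {}hb] := hb e e0 eeb.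
have E x p : e^-1 * x - p / e = (x - p) / e by rewrite mulrBl mulrC.
pose q (g : R -> R) (p x : R) := g (e^-1 * x - p / e).
pose comb (g : R -> R -> R) x := g a x - g y x - g z x + g b x.
have dcomb (g g' : R -> R -> R) : (forall p x, is_derive (x : R) (1 : R) (g p) (g' p x)) ->
    forall x, is_derive (x : R) (1 : R) (comb g) (comb g' x).
  move=> H x; have h1 := H a x; have h2 := H y x; have h3 := H z x; have h4 := H b x.
  by rewrite /comb; apply: is_deriveD; apply: is_deriveB; apply: is_deriveB.
have dq (g g' : R -> R) (k : R) : (forall x, is_derive (x : R) (1 : R) g (g' x)) ->
    forall p x, is_derive (x : R) (1 : R) (fun x => k * q g p x) (k * (e^-1 * q g' p x)).
  move=> H p x; have Hk y' : is_derive (y' : R) (1 : R) (fun u => k * g u) (k * g' y').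
    by have h := H y'; apply: is_derive_eq; rewrite /GRing.scale /=; ring.
  by rewrite mulrCA; exact: (@is_derive_affine _ _ _ e^-1 (- (p / e)) x Hk).
pose phi := comb (fun p x => e * q P p x).
pose phi1 := comb (q S).
pose phi2 := comb (fun p x => e^-1 * q rho p x).
have d1 x : is_derive (x : R) (1 : R) phi (phi1 x).
  have := dcomb _ _ (dq P S e dP) x; congr is_derive.
  by rewrite /phi1 /comb; field; rewrite gt_eqF.
have d2 x : is_derive (x : R) (1 : R) phi1 (phi2 x).
  have := dcomb _ _ (dq S rho 1 dS) x; congr is_derive.
  - by rewrite /phi1 /comb; apply/funext => x'; rewrite !mul1r.
  - by rewrite /phi2 /comb !mul1r.
have sphi2 : smooth phi2.
  rewrite /phi2 /comb /q; apply: smoothD; [apply: smoothB; [apply: smoothB|]|];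
    by apply: smoothZ; exact: smooth_affine.
have sphi1 : smooth phi1 by exact: smooth_primitive d2 sphi2.
have sphi : smooth phi by exact: smooth_primitive d1 sphi1.
pose N := `|a| + `|y| + `|z| + `|b| + e.
have NB p : p \in [:: a; y; z; b] -> `|p| + e <= N.
  rewrite !inE /N; have := normr_ge0 a; have := normr_ge0 b; have := normr_ge0 z.
  have := normr_ge0 y => n1 n2 n3 n4.
  by move=> /orP[/eqP->|/orP[/eqP->|/orP[/eqP->|/eqP->]]]; lra.
have phi0 x : N < `|x| -> phi x = 0.
  move=> hx; have [x0|x0] := lerP 0 x.
    have Px p : p \in [:: a; y; z; b] -> e * q P p x = x - p + e * (P 1 - 1).
      move=> /NB hp; rewrite /q E P1; first by field; rewrite gt_eqF.
      rewrite ler_pdivlMr//; move: hx; rewrite (ger0_norm x0).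
      by have := ler_norm p; lra.
    by rewrite /phi /comb !Px ?inE ?eqxx ?orbT//; lra.
  have Px p : p \in [:: a; y; z; b] -> e * q P p x = 0.
    move=> /NB hp; rewrite /q E P0 ?mulr0// ler_pdivrMr//.
    by move: hx; rewrite (ltr0_norm x0); have := ler_norm (- p); rewrite normrN; lra.
  by rewrite /phi /comb !Px ?inE ?eqxx ?orbT// !subrr addr0.
have tphi : test_fun phi by split=> //; exists N.
have tphi1 : test_fun phi1 by rewrite -(is_derive_fun d1); exact: test_fun_derive.
have W1 := wf _ tphi1; have W2 := C2 _ tphi.
rewrite (is_derive_fun d1) in W2; rewrite (is_derive_fun d2) W2 opprK in W1.
have R2 : Rint (fun x => f x * phi2 x) =
    Rint (fun x => f x * (e^-1 * q rho a x)) - Rint (fun x => f x * (e^-1 * q rho y x))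
    - Rint (fun x => f x * (e^-1 * q rho z x)) + Rint (fun x => f x * (e^-1 * q rho b x)).
  rewrite -(RintB ia iy) -(RintB (integB ia iy) iz) -(RintD (integB (integB ia iy) iz) ib).
  by congr Rint; apply/funext => x; rewrite /phi2 /comb /q; ring.
have PK x : `|phi x - kinks a y z b x| <= 8 * e.
  have h p : `|e * q P p x - Num.max (x - p) 0| <= 2 * e.
    have -> : Num.max (x - p) 0 = e * Num.max ((x - p) / e) 0.
      rewrite maxr_pMr ?ltW// mulr0; congr Num.max; field; rewrite gt_eqF//.
    rewrite /q E -mulrBr normrM (gtr0_norm e0) mulrC ler_wpM2r// ltW//.
  have := h a; have := h y; have := h z; have := h b; rewrite /phi /comb /kinks.
  rewrite !ler_norml => /andP[? ?] /andP[? ?] /andP[? ?] /andP[? ?].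
  by apply/andP; split; lra.
have mK : measurable_fun setT (kinks a y z b).
  by apply: continuous_measurable_fun; exact: kinks_continuous.
have mphi : measurable_fun setT phi.
  by apply: continuous_measurable_fun; exact: smooth_continuous sphi.
have [Bp [Bp0 hBp]] := continuous_bounded_itv (- N) N (smooth_continuous sphi).
have phiB x : `|phi x| <= Bp.
  have [h|h] := lerP `|x| N; first by apply: hBp; rewrite -ler_norml.
  by rewrite phi0// normr0.
have KB x : `|kinks a y z b x| <= Bp + 8 * e.
  have := PK x; have := phiB x; rewrite !ler_norml => /andP[? ?] /andP[? ?].
  by apply/andP; split; lra.
have I (nu : {finite_measure set R -> \bar R}) :
    `|Rintegral nu setT phi - Rintegral nu setT (kinks a y z b)| <= 8 * e * mass nu.
  rewrite -RintegralB//; [|exact: integrable_bounded mphi phiB|exact: integrable_bounded mK KB].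
  by apply: norm_Rintegral_bounded => //; exact: measurable_funB.
have := I mu1; have := I mu2; move: W1; rewrite R2 /q -/k1 -/k2 => W1.
by move: ha hy hz hb W1; rewrite !ler_norml => /andP[? ?] /andP[? ?] /andP[? ?] /andP[? ?]
  W1 /andP[? ?] /andP[? ?]; apply/andP; split; lra.
Qed.

End WeakDerivatives.

Section Telescope.
Context {R : realType}.

(** The points decrease because kernels are evaluated at x - y with y running up the grid. In the
    next two lemmas the intervals have length 2h and 3h, so the sum splits into two and three
    shifted telescoping sums. *)
Lemma telescope_dec (W : R -> R) (K c h : R) n : (forall x, 0 <= W x <= K) ->
  \sum_(k < n) (W (c - k%:R * h + h) - W (c - k%:R * h)) <= K.
Proof.
move=> WK; suff -> : \sum_(k < n) (W (c - k%:R * h + h) - W (c - k%:R * h)) =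
    W (c + h) - W (c + h - n%:R * h).
  by have /andP[h1 h2] := WK (c + h); have /andP[h3 h4] := WK (c + h - n%:R * h); lra.
elim: n => [|n IH]; first by rewrite big_ord0 mul0r subr0 subrr.
rewrite big_ord_recr IH /=.
have -> : c - n%:R * h + h = c + h - n%:R * h by ring.
have -> : c + h - n.+1%:R * h = c - n%:R * h by rewrite -natr1; ring.
ring.
Qed.

Lemma telescope_dec2 (W : R -> R) (K c h : R) n : (forall x, 0 <= W x <= K) ->
  \sum_(k < n) (W (c - k%:R * h + h) - W (c - k%:R * h - h)) <= 2 * K.
Proof.
move=> WK; have := telescope_dec c h n WK; have := telescope_dec (c - h) h n WK.
have -> : \sum_(k < n) (W (c - k%:R * h + h) - W (c - k%:R * h - h)) =
  \sum_(k < n) (W (c - k%:R * h + h) - W (c - k%:R * h)) +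
  \sum_(k < n) (W (c - h - k%:R * h + h) - W (c - h - k%:R * h)).
  rewrite -big_split; apply: eq_bigr => k _ /=.
  have -> : c - h - k%:R * h + h = c - k%:R * h by ring.
  have -> : c - h - k%:R * h = c - k%:R * h - h by ring.
  ring.
lra.
Qed.

Lemma telescope_dec3 (W : R -> R) (K c h : R) n : (forall x, 0 <= W x <= K) ->
  \sum_(k < n) (W (c - k%:R * h + 2 * h) - W (c - k%:R * h - h)) <= 3 * K.
Proof.
move=> WK; have := telescope_dec2 c h n WK; have := telescope_dec (c + h) h n WK.
have -> : \sum_(k < n) (W (c - k%:R * h + 2 * h) - W (c - k%:R * h - h)) =
  \sum_(k < n) (W (c + h - k%:R * h + h) - W (c + h - k%:R * h)) +
  \sum_(k < n) (W (c - k%:R * h + h) - W (c - k%:R * h - h)).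
  rewrite -big_split; apply: eq_bigr => k _ /=.
  have -> : c + h - k%:R * h + h = c - k%:R * h + 2 * h by ring.
  have -> : c + h - k%:R * h = c - k%:R * h + h by ring.
  ring.
lra.
Qed.

Lemma telescope_inc (W : R -> R) (K c h : R) n : (forall x, 0 <= W x <= K) ->
  \sum_(k < n) (W (c + k%:R * h + h) - W (c + k%:R * h)) <= K.
Proof.
move=> WK; suff -> : \sum_(k < n) (W (c + k%:R * h + h) - W (c + k%:R * h)) =
    W (c + n%:R * h) - W c.
  by have /andP[h1 h2] := WK c; have /andP[h3 h4] := WK (c + n%:R * h); lra.
elim: n => [|n IH]; first by rewrite big_ord0 mul0r addr0 subrr.
rewrite big_ord_recr IH /=.
have -> : c + n.+1%:R * h = c + n%:R * h + h by rewrite -natr1; ring.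
ring.
Qed.

End Telescope.

(** * Kernel sums and truncation errors *)

Section KernelVariation.
Context {R : realType}.
Local Notation mu := (@lebesgue_measure R).
Variables (da d2a : R -> R) (mu1 mu2 : {finite_measure set R -> \bar R}).
Hypotheses (cda : continuous da) (ida : integ da) (id2a : integ d2a)
  (wda : weak_deriv da d2a) (c2 : cond_C2 d2a mu1 mu2).

Let V := cumul d2a.
Let M x := cdf mu1 x + cdf mu2 x.
Let A := cumul da.
Let mV := Rint (fun y => `|d2a y|).
Let mA := Rint (fun y => `|da y|).
Let mM := mass mu1 + mass mu2.

Lemma cumul_bound (f : R -> R) x : integ f -> 0 <= cumul f x <= Rint (fun y => `|f y|).
Proof. by move=> fi; rewrite cumul_ge0 cumul_le. Qed.

Lemma cumul_homo (f : R -> R) x y : integ f -> x <= y -> cumul f x <= cumul f y.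
Proof.
move=> fi xy; rewrite -subr_ge0 cumulB//; exact: Rintegral_ge0.
Qed.

Lemma cdf2_bound x : 0 <= M x <= mM.
Proof. by rewrite addr_ge0 ?cdf_ge0// lerD// cdf_le. Qed.

(** One increment of [V] serves all pairs of points of a cell, whatever their order. *)
Lemma kernel_increment (a b x y eta : R) : 0 < eta -> a <= x <= b -> a <= y <= b ->
  `|da x - da y| <= V (b + eta) - V (a - eta).
Proof.
move=> eta0; wlog yx : x y / y <= x.
  move=> H hx hy; have [yx|xy] := lerP y x; first exact: H.
  by rewrite distrC; apply: H => //; exact: ltW.
move=> /andP[ax xb] /andP[ay yb].
apply: (le_trans (weak_deriv_increment cda id2a wda yx eta0)).
have h1 : V (x + eta) <= V (b + eta) by apply: cumul_homo => //; lra.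
have h2 : V (a - eta) <= V (y - eta) by apply: cumul_homo => //; lra.
rewrite /V in h1 h2 *; lra.
Qed.

Lemma kinks_trapezoid (a b r t : R) : 0 <= r -> r <= b - a ->
  `|kinks a (a + r) (b - r) b t| <= b - a /\
  (~~ (a < t <= b) -> kinks a (a + r) (b - r) b t = 0).
Proof.
move=> r0 rb; split.
  rewrite /kinks ler_norml; apply/andP; split;
    case: (leP (t - a) 0) => h1; case: (leP (t - (a + r)) 0) => h2;
    case: (leP (t - (b - r)) 0) => h3; case: (leP (t - b) 0) => h4; lra.
rewrite negb_and -leNgt -ltNge /kinks => /orP[h|h].
- by rewrite !max_r; lra.
- by rewrite !max_l; lra.
Qed.

(** The difference is the integral of a trapezoid of height at most b - a, supported in ]a, b]. One
    factor of length is gained, and the remaining mass of the cell is summable. *)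
Lemma kernel_trapezoid (a b r : R) : 0 <= r -> r <= b - a ->
  `|da a - da (a + r) - da (b - r) + da b| <= (b - a) * (M b - M a).
Proof.
move=> r0 rb; have ab : a <= b by lra.
rewrite (fourth_difference cda wda c2); last by ring.
have mk : measurable_fun setT (kinks a (a + r) (b - r) b).
  by apply: continuous_measurable_fun; exact: kinks_continuous.
have ba0 : 0 <= b - a by lra.
have B (m : {finite_measure set R -> \bar R}) :
    `|Rintegral m setT (kinks a (a + r) (b - r) b)| <= (b - a) * (cdf m b - cdf m a).
  apply: norm_Rintegral_itv => // x; first by move=> _; have [] := kinks_trapezoid x r0 rb.
  by move=> h; have [_] := kinks_trapezoid x r0 rb; apply.
rewrite (le_trans (ler_normB _ _))// (le_trans (lerD (B mu1) (B mu2)))//.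
by rewrite -mulrDr /M; apply: ler_wpM2l => //; lra.
Qed.

Lemma kernel_bound x : `|da x| <= `|da 0| + mV.
Proof.
have [b [b0 bx]] : exists b : R, - b <= x <= b /\ - b <= 0 <= b.
  exists `|x|; rewrite -ler_norml lexx oppr_le0 normr_ge0; split=> //.
have := @kernel_increment (- b) b x 0 1 ltr01 b0 bx.
have /andP[_ h1] := cumul_bound (b + 1) id2a; have /andP[h2 _] := cumul_bound (- b - 1) id2a.
have := lerB_dist (da x) (da 0); rewrite /V /mV; lra.
Qed.

(** Each sample is compared with the integral of |da| over the next cell. The error is h times the
    variation of [da] on that cell, widened by h on both sides; these intervals overlap three times,
    hence the 3. *)
Lemma kernel_sum_bound (c h : R) n : 0 < h -> h <= 1 ->
  \sum_(k < n) h * `|da (c - k%:R * h)| <= mA + 3 * mV.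
Proof.
move=> h0 h1.
have P z : h * `|da z| <= (A (z + h) - A z) + h * (V (z + 2 * h) - V (z - h)).
  have zh : z <= z + h by lra.
  rewrite /A cumulB//.
  have ii : mu.-integrable `]z, z + h] (EFin \o (fun y => `|da y|)).
    by apply: integ_on => //; exact: integ_norm.
  have ic (k : R) : mu.-integrable `]z, z + h] (EFin \o cst k).
    apply: (@integrableS _ _ _ mu `[z, z + h]) => //.
      by apply: subset_itvr; rewrite bnd_simp.
    exact: (continuous_integrable_itv _ _ (@cst_continuous _ _ k)).
  have C (k : R) : \int[mu]_(y in `]z, z + h]) (cst k y) = h * k.
    rewrite Rintegral_cst//= lebesgue_measure_itv /= lte_fin ltrDl h0 /=; ring.
  rewrite -[h * (_ - _)]C -RintegralD// -[h * `|da z|]C.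
  have mI : measurable (`]z, z + h]%classic : set (measurableTypeR R)) by [].
  apply: le_Rintegral; [by []|exact: ic|exact: (integrableD mI ii (ic _))|].
  move=> y /=; rewrite in_itv /= => /andP[y1 y2].
  have zz : z <= z <= z + h by rewrite lexx.
  have yz : z <= y <= z + h by rewrite (ltW y1).
  have := kernel_increment h0 zz yz.
  have -> : z + h + h = z + 2 * h by ring.
  have := lerB_dist (da z) (da y); lra.
apply: (@le_trans _ _ (\sum_(k < n) ((A (c - k%:R * h + h) - A (c - k%:R * h)) +
    h * (V (c - k%:R * h + 2 * h) - V (c - k%:R * h - h))))).
  by apply: ler_sum => k _; exact: P.
rewrite big_split /= -mulr_sumr.
have t1 := telescope_dec c h n (fun x => cumul_bound x ida).
have t2 := telescope_dec3 c h n (fun x => cumul_bound x id2a).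
apply: lerD => //; apply: (@le_trans _ _ (h * (3 * mV))); first by rewrite ler_wpM2l// ltW.
have mV0 : 0 <= mV by exact: Rint_ge0.
by rewrite -[leRHS]mul1r ler_wpM2r// mulr_ge0.
Qed.

(** The trapezoid bound on [z - h, z + h] with r = h: its length 2h against h h^(-2) gives one
    factor 2, the double overlap of these intervals the other. *)
Lemma kernel_D2_sum_bound (c h : R) n : 0 < h ->
  \sum_(k < n) h * `|h ^- 2 * (da (c - k%:R * h + h) - 2 * da (c - k%:R * h) + da (c - k%:R * h - h))|
    <= 4 * mM.
Proof.
move=> h0.
have P z : h * `|h ^- 2 * (da (z + h) - 2 * da z + da (z - h))| <= 2 * (M (z + h) - M (z - h)).
  have r0 : 0 <= h by exact: ltW.
  have rb : h <= z + h - (z - h) by lra.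
  have := kernel_trapezoid r0 rb.
  have -> : z - h + h = z by ring.
  have -> : z + h - h = z by ring.
  have -> : da (z - h) - da z - da z + da (z + h) = da (z + h) - 2 * da z + da (z - h) by ring.
  have -> : z + h - (z - h) = 2 * h by ring.
  move=> B; rewrite normrM mulrA ger0_norm; last by rewrite invr_ge0 exprn_ge0.
  have -> : h * h ^- 2 = h^-1 by field; rewrite gt_eqF.
  by rewrite -(ler_pM2l h0) !mulrA mulfV ?gt_eqF// mul1r (mulrC h).
apply: (@le_trans _ _ (\sum_(k < n) 2 * (M (c - k%:R * h + h) - M (c - k%:R * h - h)))).
  by apply: ler_sum => k _; exact: P.
rewrite -mulr_sumr; have := telescope_dec2 c h n cdf2_bound; lra.
Qed.

End KernelVariation.

(** * The trapezoidal rule for a kernel whose second derivative is a measure *)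

Section Quadrature.
Context {R : realType}.
Local Notation mu := (@lebesgue_measure R).
Variables (da d2a : R -> R) (mu1 mu2 : {finite_measure set R -> \bar R}).
Hypotheses (cda : continuous da) (ida : integ da) (id2a : integ d2a)
  (wda : weak_deriv da d2a) (c2 : cond_C2 d2a mu1 mu2).
Variables (g : R -> R) (G0 G1 G2 : R).
Hypotheses (cg : continuous g) (g0 : forall x, `|g x| <= G0)
  (g1 : forall x y, `|g x - g y| <= G1 * `|x - y|)
  (g2 : forall x p q, 0 <= p -> 0 <= q ->
     `|g x - g (x + p) - g (x + q) + g (x + p + q)| <= G2 * (p * q))
  (G10 : 0 <= G1) (G20 : 0 <= G2).

Let V := cumul d2a.
Let M x := cdf mu1 x + cdf mu2 x.
Let mV := Rint (fun y => `|d2a y|).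
Let mA := Rint (fun y => `|da y|).
Let mM := mass mu1 + mass mu2.

(* Summation by parts of the mixed difference of [da (x - .) * g], which distributes the
   two orders of smallness between [da] and [g]. *)
Lemma product_trapezoid (x a b y h : R) : 0 < h -> b = a + h -> a <= y <= b ->
  `|da (x - a) * g a - da (x - y) * g y - da (x - (a + b - y)) * g (a + b - y)
    + da (x - b) * g b| <=
  h * (G0 * (M (x - a) - M (x - b)) + 2 * G1 * (V (x - a + h) - V (x - b - h)))
  + G2 * h ^+ 2 * `|da (x - y)|.
Proof.
move=> h0 bE /andP[ay yb].
set a1 := da (x - a); set a2 := da (x - y); set a3 := da (x - (a + b - y)).
set a4 := da (x - b); set DV := V (x - a + h) - V (x - b - h).
have k1 : `|a1 - a2 - a3 + a4| <= h * (M (x - a) - M (x - b)).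
  have r0 : 0 <= b - y by lra.
  have rb : b - y <= x - a - (x - b) by lra.
  have := kernel_trapezoid cda wda c2 r0 rb.
  have -> : x - b + (b - y) = x - y by ring.
  have -> : x - a - (b - y) = x - (a + b - y) by ring.
  have -> : x - a - (x - b) = h by rewrite bE; ring.
  rewrite -/a1 -/a2 -/a3 -/a4; have -> : a4 - a2 - a3 + a1 = a1 - a2 - a3 + a4 by ring.
  by [].
have inc u v : x - b <= u <= x - a -> x - b <= v <= x - a -> `|da u - da v| <= DV.
  by move=> hu hv; exact: (kernel_increment cda id2a wda h0 hu hv).
have k2 : `|a4 - a3| <= DV by apply: inc; apply/andP; split; lra.
have k3 : `|a3 - a2| <= DV by apply: inc; apply/andP; split; lra.
have l1 : `|g b - g a| <= G1 * h.
  by rewrite (le_trans (g1 _ _))// bE (_ : a + h - a = h) ?gtr0_norm//; ring.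
have l2 : `|g b - g (a + b - y)| <= G1 * h.
  rewrite (le_trans (g1 _ _))// ler_wpM2l// ger0_norm; lra.
have l3 : `|g a - g y - g (a + b - y) + g b| <= G2 * h ^+ 2.
  have p0 : 0 <= y - a by lra.
  have q0 : 0 <= b - y by lra.
  have := g2 a p0 q0.
  have -> : a + (y - a) = y by ring.
  have -> : a + (b - y) = a + b - y by ring.
  have -> : y + (b - y) = b by ring.
  move=> /le_trans; apply; rewrite ler_wpM2l// expr2 ler_pM//; lra.
have -> : a1 * g a - a2 * g y - a3 * g (a + b - y) + a4 * g b =
  (a1 - a2 - a3 + a4) * g a + (a4 - a3) * (g b - g a)
  + (a3 - a2) * (g b - g (a + b - y)) + a2 * (g a - g y - g (a + b - y) + g b) by ring.
rewrite (le_trans (ler_normD _ _))// (le_trans (lerD (ler_normD _ _) (lexx _)))//.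
rewrite (le_trans (lerD (lerD (ler_normD _ _) (lexx _)) (lexx _)))//.
rewrite !normrM.
have m1 : `|a1 - a2 - a3 + a4| * `|g a| <= h * (M (x - a) - M (x - b)) * G0.
  by rewrite ler_pM.
have m2 : `|a4 - a3| * `|g b - g a| <= DV * (G1 * h) by rewrite ler_pM.
have m3 : `|a3 - a2| * `|g b - g (a + b - y)| <= DV * (G1 * h) by rewrite ler_pM.
have m4 : `|a2| * `|g a - g y - g (a + b - y) + g b| <= `|a2| * (G2 * h ^+ 2).
  by rewrite ler_wpM2l.
move: m1 m2 m3 m4; lra.
Qed.

Lemma kernel_refl_continuous (x : R) : continuous (fun y => da (x - y)).
Proof.
move=> y; apply: (@continuous_comp _ _ _ (fun y => x - y) da); last exact: cda.
by apply: cvgB; [exact: cvg_cst|exact: cvg_id].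
Qed.

(** With F the integrand and b = a + h, the reflection y -> a + b - y preserves the integral, so the
    error is half the integral of F(a) + F(b) - F(y) - F(a + b - y). This expression vanishes for
    affine F, hence only second differences enter. *)
Lemma cell_quadrature (x a h : R) : 0 < h ->
  `|h / 2 * (da (x - a) * g a + da (x - (a + h)) * g (a + h))
    - \int[mu]_(y in `[a, a + h]) (da (x - y) * g y)| <=
  h ^+ 2 / 2 * (G0 * (M (x - a) - M (x - (a + h)))
    + 2 * G1 * (V (x - a + h) - V (x - (a + h) - h))
    + G2 * (cumul (fun y => da (x - y)) (a + h) - cumul (fun y => da (x - y)) a)).
Proof.
move=> h0; set b := a + h; pose F y := da (x - y) * g y.
have ab : a < b by rewrite ltrDl.
have cF : continuous F.
  by move=> y; apply: cvgM; [exact: kernel_refl_continuous|exact: cg].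
have iF := continuous_integrable_itv a b cF.
have cFr : continuous (fun y => F (a + b - y)).
  move=> y; apply: (@continuous_comp _ _ _ (fun y => a + b - y) F); last exact: cF.
  by apply: cvgB; [exact: cvg_cst|exact: cvg_id].
have iFr := continuous_integrable_itv a b cFr.
have sym : \int[mu]_(y in `[a, b]) F (a + b - y) = \int[mu]_(y in `[a, b]) F y.
  rewrite [LHS]Rintegral_mkcond [RHS]Rintegral_mkcond.
  have iFp : integ (F \_ `[a, b]).
    by rewrite /integ -restrict_EFin; apply/integrable_restrict => //=; rewrite setTI.
  rewrite -[RHS](Rint_reflect (a + b) iFp); congr Rintegral; apply/funext => y.
  rewrite !patchE; congr (if _ then _ else _).
  by apply/idP/idP; rewrite !inE /= !in_itv /= => /andP[h1 h2]; apply/andP; split; lra.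
have ic (k : R) : mu.-integrable `[a, b] (EFin \o cst k).
  exact: (continuous_integrable_itv _ _ (@cst_continuous _ _ k)).
have C (k : R) : \int[mu]_(y in `[a, b]) (cst k y) = h * k.
  rewrite Rintegral_cst//= lebesgue_measure_itv /= lte_fin ab /=.
  by rewrite /b addrAC subrr add0r mulrC.
pose c0 := F a + F b.
have mI : measurable (`[a, b]%classic : set (measurableTypeR R)) by [].
have iB1 := integrableB mI (ic c0) iF.
have iB := integrableB mI iB1 iFr.
have E : h / 2 * c0 - \int[mu]_(y in `[a, b]) F y =
    2^-1 * \int[mu]_(y in `[a, b]) (cst c0 y - F y - F (a + b - y)).
  rewrite (@RintegralB _ _ _ mu `[a, b] (fun y => cst c0 y - F y))//.
  by rewrite (@RintegralB _ _ _ mu `[a, b] (cst c0))// C sym; field.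
rewrite -/(F a) -/(F b) -/c0 -/F E normrM ger0_norm ?invr_ge0//.
have -> : forall w : R, h ^+ 2 / 2 * w = 2^-1 * (h ^+ 2 * w) by move=> w; ring.
rewrite ler_wpM2l ?invr_ge0//.
apply: (le_trans (le_normr_Rintegral mI iB)).
pose k1 := h * (G0 * (M (x - a) - M (x - b)) + 2 * G1 * (V (x - a + h) - V (x - b - h))).
have idr : integ (fun y => da (x - y)) by exact: integ_reflect.
have iN : mu.-integrable `[a, b] (EFin \o (fun y => G2 * h ^+ 2 * `|da (x - y)|)).
  by apply: integ_on => //; apply: integZl; exact: integ_norm.
apply: (@le_trans _ _ (\int[mu]_(y in `[a, b]) (cst k1 y + G2 * h ^+ 2 * `|da (x - y)|))).
  apply: le_Rintegral; [by []|exact: integrable_norm iB|exact: (integrableD mI (ic k1) iN)|].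
  move=> y /=; rewrite in_itv /= => yab.
  have := product_trapezoid x h0 (erefl _ : b = a + h) yab; rewrite -/b /k1 /c0 /F.
  by congr (_ <= _); congr Num.norm; ring.
rewrite (RintegralD mI (ic k1) iN) C RintegralZl//; last first.
  by apply: integ_on => //; exact: integ_norm.
have -> : \int[mu]_(y in `[a, b]) `|da (x - y)| =
    cumul (fun y => da (x - y)) b - cumul (fun y => da (x - y)) a.
  rewrite cumulB ?ltW// Rintegral_itv_obnd_cbnd//.
  by apply: integ_on => //; exact: integ_norm.
by rewrite le_eqVlt; apply/orP; left; apply/eqP; rewrite /k1; ring.
Qed.

(** The 6 is the factor 2 of the two first-order cross terms times the threefold overlap of the
    widened cells. *)
Definition quadrature_const := 2^-1 * (G0 * mM + 6 * G1 * mV + G2 * mA).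

Lemma trapezoid_rule (x a0 h : R) n : 0 < h -> 0 <= G0 ->
  `|\sum_(k < n) (h / 2 * (da (x - (a0 + k%:R * h)) * g (a0 + k%:R * h)
      + da (x - (a0 + k%:R * h + h)) * g (a0 + k%:R * h + h)))
    - \int[mu]_(y in `[a0, a0 + n%:R * h]) (da (x - y) * g y)| <= quadrature_const * h ^+ 2.
Proof.
move=> h0 G00; pose F y := da (x - y) * g y.
have cF : continuous F.
  by move=> y; apply: cvgM; [exact: kernel_refl_continuous|exact: cg].
have I : \int[mu]_(y in `[a0, a0 + n%:R * h]) F y =
    \sum_(k < n) \int[mu]_(y in `[a0 + k%:R * h, a0 + k%:R * h + h]) F y.
  elim: n => [|n IH]; first by rewrite big_ord0 mul0r addr0 set_itv1 Rintegral_set1.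
  rewrite big_ord_recr /= -IH.
  have e1 : a0 + n.+1%:R * h = a0 + n%:R * h + h by rewrite -natr1; ring.
  rewrite e1; set c := a0 + n%:R * h.
  have a0c : a0 <= c by rewrite lerDl mulr_ge0// ltW.
  have iF := continuous_integrable_itv a0 (c + h) cF.
  have := @Rintegral_itvB _ F (BLeft a0) (BRight (c + h)) c iF.
  have ch : c < c + h by rewrite ltrDl.
  rewrite !bnd_simp a0c (ltW ch) => /(_ isT isT).
  rewrite Rintegral_itv_obnd_cbnd; first by move/eqP; rewrite subr_eq addrC => /eqP.
  by apply: integrableS iF => //; apply: subset_itvr; rewrite bnd_simp.
rewrite I -sumrB (le_trans (ler_norm_sum _ _ _))//.
apply: le_trans.
  by apply: ler_sum => k _; exact: (cell_quadrature x (a0 + k%:R * h) h0).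
rewrite -mulr_sumr !big_split /= -!mulr_sumr.
have t1 : \sum_(k < n) (M (x - (a0 + k%:R * h)) - M (x - (a0 + k%:R * h + h))) <= mM.
  have := telescope_dec (x - a0 - h) h n (cdf2_bound mu1 mu2).
  apply: le_trans; rewrite le_eqVlt; apply/orP; left; apply/eqP.
  by apply: eq_bigr => k _; congr (M _ - M _); ring.
have t2 : \sum_(k < n) (V (x - (a0 + k%:R * h) + h) - V (x - (a0 + k%:R * h + h) - h)) <= 3 * mV.
  have := telescope_dec3 (x - a0 - h) h n (fun x => cumul_bound x id2a).
  apply: le_trans; rewrite le_eqVlt; apply/orP; left; apply/eqP.
  by apply: eq_bigr => k _; congr (V _ - V _); ring.
have t3 : \sum_(k < n) (cumul (fun y => da (x - y)) (a0 + k%:R * h + h) -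
    cumul (fun y => da (x - y)) (a0 + k%:R * h)) <= mA.
  have idr : integ (fun y => da (x - y)) by exact: integ_reflect.
  have := telescope_inc a0 h n (fun z => cumul_bound z idr).
  by move=> /le_trans; apply; rewrite (Rint_reflect x (integ_norm ida)).
have -> : quadrature_const * h ^+ 2 = h ^+ 2 / 2 * (G0 * mM + 6 * G1 * mV + G2 * mA).
  by rewrite /quadrature_const; ring.
apply: ler_wpM2l; first by apply: divr_ge0 => //; exact: sqr_ge0.
have s1 := ler_wpM2l G00 t1.
have s2 := ler_wpM2l (mulr_ge0 (ler0n R 2) G10) t2.
have s3 := ler_wpM2l G20 t3.
move: s1 s2 s3; lra.
Qed.

End Quadrature.

(** * Piecewise linear interpolation by hat functions *)

Section Interpolation.
Context {R : realType}.

(** This is max(0, 1 - |r|), written with ramps so that it is visibly a rescaled [kinks]. *)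
Definition hat (r : R) : R := Num.max (r + 1) 0 - 2 * Num.max r 0 + Num.max (r - 1) 0.

Lemma hat_out r : 1 <= `|r| -> hat r = 0.
Proof.
rewrite ler_normr /hat => /orP[h|h].
- by rewrite !max_l; lra.
- by rewrite !max_r; lra.
Qed.

Lemma hat_pos r : 0 <= r <= 1 -> hat r = 1 - r.
Proof. by move=> /andP[h1 h2]; rewrite /hat max_l ?(max_l h1) ?max_r; lra. Qed.

Lemma hat_neg r : -1 <= r <= 0 -> hat r = 1 + r.
Proof. by move=> /andP[h1 h2]; rewrite /hat max_l ?(max_r h2) ?max_r; lra. Qed.

Lemma hatN r : hat (- r) = hat r.
Proof.
have [r1|r1] := lerP 1 `|r|; first by rewrite !hat_out ?normrN.
move: r1; rewrite ltr_norml => /andP[h1 h2]; have [r0|r0] := lerP 0 r.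
- by rewrite hat_neg ?hat_pos; [ring|apply/andP; split; lra..].
- by rewrite hat_pos ?hat_neg; [ring|apply/andP; split; lra..].
Qed.

Lemma hat_01 r : 0 <= hat r <= 1.
Proof.
have [r1|r1] := lerP 1 `|r|; first by rewrite hat_out// lexx ler01.
move: r1; rewrite ltr_norml => /andP[h1 h2]; have [r0|r0] := lerP 0 r.
- by rewrite hat_pos; apply/andP; split; lra.
- by rewrite hat_neg; apply/andP; split; lra.
Qed.

Lemma kinks_hat (h z t : R) : 0 < h -> h^-1 * kinks (z - h) z z (z + h) t = hat ((t - z) / h).
Proof.
move=> h0; rewrite /kinks /hat.
have H p : h^-1 * Num.max p 0 = Num.max (p / h) 0.
  by rewrite maxr_pMr ?invr_ge0 ?ltW// mulr0 mulrC.
rewrite mulrDr !mulrBr !H.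
have -> : (t - (z - h)) / h = (t - z) / h + 1 by field; rewrite gt_eqF.
have -> : (t - (z + h)) / h = (t - z) / h - 1 by field; rewrite gt_eqF.
ring.
Qed.

(** Induction on the last node: either its hat vanishes at [q], or [q] lies in the last cell and
    only the last two hats are active. The witnesses are the cell and the relative position in
    it. *)
Lemma hat_sum_inside (c : nat -> R) n (q : R) : 0 <= q <= n.+1%:R ->
  exists m th, [/\ (m <= n)%N, 0 <= th <= 1, q = m%:R + th &
    \sum_(k < n.+2) c k * hat (q - k%:R) = (1 - th) * c m + th * c m.+1].
Proof.
elim: n q => [|n IH] q /andP[q0 qn].
  exists 0%N, q; split => //; [by rewrite q0|by rewrite add0r|].
  rewrite !big_ord_recr big_ord0 /= subr0 hat_pos ?q0// hat_neg; first by ring.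
  by apply/andP; split; lra.
have [qn1|qn1] := lerP q n.+1%:R.
  have q0n : 0 <= q <= n.+1%:R by rewrite q0.
  have [m [th [mn th01 qE E]]] := IH q q0n.
  exists m, th; split => //; first exact: leqW.
  rewrite big_ord_recr E /= (@hat_out (q - _)) ?mulr0 ?addr0//.
  by rewrite -natr1 ler_normr; apply/orP; right; lra.
move: qn qn1; rewrite -[n.+2%:R]natr1 => qn qn1.
exists n.+1, (q - n.+1%:R); split => //; [by apply/andP; split; lra|by ring|].
rewrite !big_ord_recr /= big1.
  rewrite add0r (@hat_out (q - n%:R)) ?mulr0 ?add0r; last first.
    by rewrite ler_normr; apply/orP; left; move: qn1; rewrite -natr1; lra.
  rewrite hat_pos; last by apply/andP; split; lra.
  rewrite (@hat_neg (q - n.+2%:R)); last by rewrite -[n.+2%:R]natr1; apply/andP; split; lra.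
  by rewrite -[n.+2%:R]natr1; ring.
move=> k _; rewrite hat_out ?mulr0// ler_normr; apply/orP; left.
have : (k%:R : R) <= n%:R by rewrite ler_nat ltnW.
by move: qn1; rewrite -natr1; lra.
Qed.

(** Beyond the grid all hats vanish except possibly that of the nearest end node. *)
Lemma hat_sum_outside (c : nat -> R) n (q e : R) : ~~ (0 <= q <= n%:R) -> 0 <= e ->
  `|c 0%N| <= e -> `|c n| <= e -> `|\sum_(k < n.+1) c k * hat (q - k%:R)| <= e.
Proof.
move=> hq e0 c0 cn; have hB r x : `|x| <= e -> `|x * hat r| <= e.
  by have /andP[h1 h2] := hat_01 r => hx; rewrite normrM (ger0_norm h1) (le_trans _ hx)// ler_piMr.
move: hq; rewrite negb_and -!ltNge => /orP[h|h].
  rewrite big_ord_recl /= subr0 big1 ?addr0; first exact: hB.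
  move=> k _; rewrite hat_out ?mulr0// ler_normr; apply/orP; right.
  by rewrite /bump /= add1n -natr1; have := ler0n R k; lra.
rewrite big_ord_recr /= big1 ?add0r; first exact: hB.
move=> k _; rewrite hat_out ?mulr0// ler_normr; apply/orP; left.
have : (k.+1%:R : R) <= n%:R by rewrite ler_nat.
by rewrite -natr1; lra.
Qed.

End Interpolation.

Section Truncation.
Context {R : realType}.
Local Notation mu := (@lebesgue_measure R).
Variables (da d2a : R -> R) (mu1 mu2 : {finite_measure set R -> \bar R}).
Hypotheses (cda : continuous da) (ida : integ da) (id2a : integ d2a)
  (wda : weak_deriv da d2a) (c2 : cond_C2 d2a mu1 mu2).

Let mV := Rint (fun y => `|d2a y|).
Let mA := Rint (fun y => `|da y|).
Let mM := mass mu1 + mass mu2.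

Lemma grid_point (h : R) (N k : nat) : (k%:Z - N%:Z)%:~R * h = - (N%:R * h) + k%:R * h.
Proof. by rewrite intrD mulrDl rmorphN /= mulNr addrC. Qed.

Lemma grid_diff (h : R) (i : int) (N k : nat) :
  (i - (k%:Z - N%:Z))%:~R * h = i%:~R * h - (- (N%:R * h) + k%:R * h).
Proof. by rewrite intrB mulrBl grid_point. Qed.

(** Besides the cell errors there are two contributions of the tail: the integral beyond the grid,
    at most mA eta, and the end nodes, which the scheme weights fully and the trapezoidal rule by
    half. The bound [h <= 1] absorbs their factor h/2. *)
Lemma conv_quadrature (g : R -> R) (G0 G1 G2 h eta : R) (N : nat) (i : int) :
  continuous g -> (forall x, `|g x| <= G0) ->
  (forall x y, `|g x - g y| <= G1 * `|x - y|) ->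
  (forall x p q, 0 <= p -> 0 <= q ->
     `|g x - g (x + p) - g (x + q) + g (x + p + q)| <= G2 * (p * q)) ->
  0 <= G1 -> 0 <= G2 -> 0 < h -> h <= 1 -> 0 <= eta ->
  (forall y, N%:R * h <= `|y| -> `|g y| <= eta) ->
  `|kconv da g (i%:~R * h) - isum N (fun j => h * da ((i - j)%:~R * h) * g (j%:~R * h))|
   <= quadrature_const da d2a mu1 mu2 G0 G1 G2 * h ^+ 2 + (mA + (`|da 0| + mV)) * eta.
Proof.
move=> cg g0 g1 g2 G10 G20 h0 h1 eta0 tail.
set x := i%:~R * h; pose F y := da (x - y) * g y; pose a0 := - (N%:R * h).
have G00 : 0 <= G0 by rewrite (le_trans _ (g0 0)).
have Nh : a0 + (2 * N)%:R * h = N%:R * h by rewrite /a0 natrM; ring.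
have NN : - (N%:R * h) <= N%:R * h.
  by have : 0 <= N%:R * h by [rewrite mulr_ge0// ltW]; lra.
have cF : continuous F.
  by move=> y; apply: cvgM; [exact: kernel_refl_continuous|exact: cg].
have idr : integ (fun y => `|da (x - y)|) by apply: integ_norm; exact: integ_reflect.
have iF : integ F.
  apply: (@integ_continuous_le _ _ (fun y => G0 * `|da (x - y)|)) => //.
    exact: integZl.
  by move=> y; rewrite normrM mulrC ler_wpM2r.
have S : isum N (fun j => h * da ((i - j)%:~R * h) * g (j%:~R * h)) =
    \sum_(k < (2 * N).+1) h * F (a0 + k%:R * h).
  by rewrite /isum; apply: eq_bigr => k _; rewrite grid_diff grid_point /F mulrA.
(* Passage from trapezoidal weights to equal weights; the discrepancy is half of the two end
   values. *)
have T n (G : nat -> R) : \sum_(k < n) (h / 2 * (G k + G k.+1)) =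
    \sum_(k < n.+1) h * G k - h / 2 * (G 0%N + G n).
  elim: n => [|n IH]; first by rewrite big_ord0 big_ord_recl big_ord0 /=; field.
  by rewrite big_ord_recr IH [in RHS]big_ord_recr /=; field.
have Q := trapezoid_rule cda ida id2a wda c2 cg g0 g1 g2 G10 G20 x a0 (2 * N) h0 G00.
have E1 : \sum_(k < 2 * N) (h / 2 * (da (x - (a0 + k%:R * h)) * g (a0 + k%:R * h)
      + da (x - (a0 + k%:R * h + h)) * g (a0 + k%:R * h + h))) =
   \sum_(k < 2 * N) (h / 2 * (F (a0 + k%:R * h) + F (a0 + k.+1%:R * h))).
  apply: eq_bigr => k _; rewrite /F.
  by have -> : a0 + k.+1%:R * h = a0 + k%:R * h + h by rewrite -natr1; ring.
rewrite E1 (T _ (fun k => F (a0 + k%:R * h))) Nh mul0r addr0 in Q.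
have FB y : `|y| = N%:R * h -> `|F y| <= (`|da 0| + mV) * eta.
  move=> yE; rewrite normrM ler_pM//; first exact: kernel_bound cda id2a wda _.
  by apply: tail; rewrite yE.
have N0 : 0 <= N%:R * h by rewrite mulr_ge0// ltW.
have na0 : `|a0| = N%:R * h by rewrite normrN ger0_norm.
have F1 := FB a0 na0.
have F2 := FB (N%:R * h) (ger0_norm N0).
have iFp : integ (F \_ `[a0, N%:R * h]).
  rewrite /integ -restrict_EFin; apply/integrable_restrict => //=; rewrite setTI.
  exact: continuous_integrable_itv.
have Tl : `|Rint F - \int[mu]_(y in `[a0, N%:R * h]) F y| <= eta * mA.
  rewrite [X in _ - X]Rintegral_mkcond -/(Rint (F \_ _)) -RintB//.
  rewrite /mA -(Rint_reflect x (integ_norm ida)) -RintZl//; apply: norm_Rint_le.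
  - by apply: integ_measurable; exact: integB.
  - exact: integZl.
  move=> y; rewrite patchE; case: ifPn => [_|]; first by rewrite subrr normr0 mulr_ge0.
  rewrite notin_setE /= in_itv /= => /negP; rewrite -ler_norml -ltNge => /ltW hy.
  by rewrite subr0 normrM mulrC ler_wpM2r// tail.
rewrite S -/(Rint F) /kconv -/F.
set I := Rintegral _ _ _ in Q Tl; set Sm := \sum_(k < _) _ in Q *.
have hB : `|h / 2 * (F a0 + F (N%:R * h))| <= (`|da 0| + mV) * eta.
  rewrite normrM ger0_norm; last by apply: divr_ge0 => //; exact: ltW.
  have D0 : 0 <= (`|da 0| + mV) * eta by exact: le_trans F1.
  have := le_trans (ler_normD _ _) (lerD F1 F2); have := normr_ge0 (F a0 + F (N%:R * h)).
  by nra.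
move: Q Tl hB; rewrite !ler_norml => /andP[? ?] /andP[? ?] /andP[? ?].
by apply/andP; split; lra.
Qed.

Lemma mconv_interpolation (u : R -> R) (B U h eta : R) (N : nat) (i : int) :
  continuous u -> (forall x, `|u x| <= B) ->
  (forall x th, 0 <= th <= 1 -> `|(1 - th) * u x + th * u (x + h) - u (x + th * h)| <= U * h ^+ 2) ->
  0 <= U -> 0 < h -> (0 < N)%N -> 0 <= eta ->
  (forall y, N%:R * h <= `|y| -> `|u y| <= eta) ->
  `|mconv mu1 mu2 u (i%:~R * h) - isum N (fun j => h * D2h h da (i - j) * u (j%:~R * h))|
   <= mM * (U * h ^+ 2 + 2 * eta).
Proof.
move=> cu uB uI U0 h0 N0 eta0 tail; set x := i%:~R * h.
pose a (k : nat) := - (N%:R * h) + k%:R * h; pose z k := x - a k.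
(* As a function of the measure variable [t], the linear interpolant of [u] on the nodes [a k],
   taken at x - t. The sum in the scheme is its integral against [mu1] minus [mu2]. *)
pose I t := \sum_(k < (2 * N).+1) u (a k) * (h^-1 * kinks (z k - h) (z k) (z k) (z k + h) t).
have h0' := ltW h0.
have D z' : h * (h ^- 2 * (da (z' + h) - 2 * da z' + da (z' - h))) =
    h^-1 * (Rintegral mu1 setT (kinks (z' - h) z' z' (z' + h)) -
            Rintegral mu2 setT (kinks (z' - h) z' z' (z' + h))).
  rewrite -(fourth_difference cda wda c2); last by ring.
  by field; rewrite gt_eqF.
have ck k : continuous (kinks (z k - h) (z k) (z k) (z k + h)) by exact: kinks_continuous.
have bk k t : `|kinks (z k - h) (z k) (z k) (z k + h) t| <= h.
  have := kinks_hat (z k) t h0; have /andP[p1 p2] := hat_01 ((t - z k) / h).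
  move=> /(congr1 ( *%R h)); rewrite mulrA mulfV ?gt_eqF// mul1r => ->.
  by rewrite normrM (ger0_norm p1) ger0_norm// ler_piMr.
have ik (m : {finite_measure set R -> \bar R}) k :
    m.-integrable setT (EFin \o kinks (z k - h) (z k) (z k) (z k + h)).
  by apply: (@integrable_bounded _ m _ h) => //; exact: continuous_measurable_fun.
have SI (m : {finite_measure set R -> \bar R}) : m.-integrable setT (EFin \o I) /\
    Rintegral m setT I =
    \sum_(k < (2 * N).+1) u (a k) * (h^-1 * Rintegral m setT (kinks (z k - h) (z k) (z k) (z k + h))).
  have iZ k := @integrableZl _ _ _ m setT measurableT h^-1 _ (ik m k).
  have iZ2 k := @integrableZl _ _ _ m setT measurableT (u (a k)) _ (iZ k).
  have [h1 h2] := @Rintegral_sum R _ _ m (2 * N).+1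
    (fun k t => u (a k) * (h^-1 * kinks (z k - h) (z k) (z k) (z k + h) t)) (fun k _ => iZ2 k).
  split; first exact: h1.
  rewrite /I h2; apply: eq_bigr => k _.
  rewrite (@RintegralZl _ _ _ m setT
    (fun t => h^-1 * kinks (z k - h) (z k) (z k) (z k + h) t) _ measurableT (iZ k)).
  by rewrite (@RintegralZl _ _ _ m setT _ _ measurableT (ik m k)).
have -> : isum N (fun j => h * D2h h da (i - j) * u (j%:~R * h)) =
    Rintegral mu1 setT I - Rintegral mu2 setT I.
  rewrite (SI mu1).2 (SI mu2).2 /isum -sumrB; apply: eq_bigr => k _.
  rewrite /D2h grid_point -/(a k).
  have e0 : (i - (k%:Z - N%:Z))%:~R * h = z k by rewrite grid_diff.
  have -> : (i - (k%:Z - N%:Z) + 1)%:~R * h = z k + h by rewrite -e0 (intrD _ (_ - _) 1) mulrDl mulr1z mul1r.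
  have -> : (i - (k%:Z - N%:Z) - 1)%:~R * h = z k - h by rewrite -e0 (intrB _ (_ - _) 1) mulrBl mulr1z mul1r.
  by rewrite e0 D; ring.
(* The interpolation lemma wants n + 2 nodes; there are 2N + 1, so n = 2N - 1, which needs N > 0. *)
have N2 : (2 * N)%N = (2 * N).-1.+1 by rewrite prednK// muln_gt0.
have Ierr t : `|u (x - t) - I t| <= U * h ^+ 2 + 2 * eta.
  (* Position of x - t, counted in cells from the left end of the grid. Inside, the interpolation
     defect of [u] applies; outside, u(x - t) and [I t] are each at most eta. *)
  pose q := (x - t + N%:R * h) / h.
  have qE : x - t = - (N%:R * h) + q * h by rewrite /q divfK ?gt_eqF//; ring.
  have IE : I t = \sum_(k < (2 * N).+1) u (a k) * hat (q - k%:R).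
    apply: eq_bigr => k _; rewrite kinks_hat// -hatN; congr (_ * hat _).
    by rewrite /z /a /q; field; rewrite gt_eqF.
  rewrite IE; have [q01|q01] := boolP (0 <= q <= (2 * N)%:R).
    rewrite N2 in q01 *; have [m [th [mn th01 qm ->]]] := hat_sum_inside (fun k => u (a k)) q01.
    have -> : a m.+1 = a m + h by rewrite /a -natr1; ring.
    have -> : x - t = a m + th * h by rewrite qE qm /a; ring.
    rewrite distrC (le_trans (uI _ _ th01))// lerDl; lra.
  have Nh0 : 0 <= N%:R * h by rewrite mulr_ge0.
  have t1 : `|u (x - t)| <= eta.
    apply: tail; rewrite qE ler_normr; move: q01; rewrite negb_and -!ltNge => /orP[hq|hq].
    - by apply/orP; right; have : 0 <= - q * h by [rewrite mulr_ge0//; lra]; lra.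
    - apply/orP; left; have : 0 <= (q - (2 * N)%:R) * h by rewrite mulr_ge0//; lra.
      by rewrite natrM; lra.
  have t2 : `|\sum_(k < (2 * N).+1) u (a k) * hat (q - k%:R)| <= eta.
    apply: (hat_sum_outside (c := fun k => u (a k))) => //; apply: tail.
    - by rewrite /a mul0r addr0 normrN ger0_norm.
    - by rewrite /a natrM (_ : _ + _ = N%:R * h) ?ger0_norm//; ring.
  rewrite (le_trans (ler_normB _ _))//.
  have : 0 <= U * h ^+ 2 by rewrite mulr_ge0// sqr_ge0.
  lra.
have cur : continuous (fun t : R => u (x - t)).
  move=> t; apply: (@continuous_comp _ _ _ (fun t => x - t) u); last exact: cu.
  by apply: cvgB; [exact: cvg_cst|exact: cvg_id].
have mur : measurable_fun setT (fun t : R => u (x - t)) by exact: continuous_measurable_fun.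
have mI : measurable_fun setT I by have /integrableP[/measurable_EFinP] := (SI mu1).1.
have E (m : {finite_measure set R -> \bar R}) :
    `|Rintegral m setT (fun t : R => u (x - t)) - Rintegral m setT I| <= (U * h ^+ 2 + 2 * eta) * mass m.
  have iu : m.-integrable setT (EFin \o (fun t : R => u (x - t))).
    by apply: (@integrable_bounded _ m _ B).
  rewrite -(RintegralB measurableT iu (SI m).1).
  by apply: norm_Rintegral_bounded => //; exact: measurable_funB.
rewrite /mconv mulrC mulrDr.
have := E mu1; have := E mu2; rewrite !ler_norml => /andP[? ?] /andP[? ?].
by apply/andP; split; lra.
Qed.

End Truncation.

(** * Ordinary differential equations *)

Section Barrier.
Context {R : realType}.

(** The epsilon-delta form of [semi_sol], one-sided at 0 and at T. *)
Definition deriv_on (T : R) (x : R -> R) (t l : R) : Prop :=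
  forall e : R, 0 < e -> exists d : R, 0 < d /\ forall t', 0 <= t' <= T ->
    0 < `|t' - t| < d -> `|(x t' - x t) / (t' - t) - l| < e.

Lemma deriv_on_lip T x t l e : deriv_on T x t l -> 0 < e ->
  exists2 d : R, 0 < d & forall t', 0 <= t' <= T -> `|t' - t| < d ->
    `|x t' - x t| <= (`|l| + e) * `|t' - t|.
Proof.
move=> dx e0; have [d [d0 hd]] := dx e e0; exists d => // t' tT td.
have [->|tt] := eqVneq t' t; first by rewrite !subrr normr0 mulr0.
have tt0 : 0 < `|t' - t| by rewrite normr_gt0 subr_eq0.
have := hd t' tT; rewrite tt0 td => /(_ isT) /ltW H.
rewrite -ler_pdivrMr// -normfV -normrM.
have := lerB_dist ((x t' - x t) / (t' - t)) l; lra.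
Qed.

Lemma common_radius n (P : nat -> R -> Prop) :
  (forall i, (i < n)%N -> exists2 d : R, 0 < d & forall s, s < d -> P i s) ->
  exists2 d : R, 0 < d & forall i, (i < n)%N -> forall s, s < d -> P i s.
Proof.
elim: n => [|n IH] H; first by exists 1.
have [d1 d10 H1] := IH (fun i h => H i (ltn_trans h (ltnSn n))).
have [d2 d20 H2] := H n (ltnSn n); exists (Num.min d1 d2); first by rewrite lt_min d10.
move=> i; rewrite ltnS leq_eqVlt => /orP[/eqP ->|hi] s; rewrite lt_min => /andP[h1 h2].
- exact: H2.
- exact: H1.
Qed.

(** At the infimum of the failures, [P] holds by the left-limit step and persists a little beyond by
    the right step, a contradiction. It serves both the barrier argument and the compactness of
    [0, T]. *)
Lemma real_induction (T : R) (P : R -> Prop) : 0 <= T -> P 0 ->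
  (forall t, 0 <= t -> t < T -> P t -> exists2 d : R, 0 < d &
    forall s, t < s -> s < t + d -> s <= T -> P s) ->
  (forall t, 0 < t -> t <= T -> (forall s, 0 <= s -> s < t -> P s) -> P t) ->
  forall t, 0 <= t <= T -> P t.
Proof.
move=> T0 P0 Pr Pl t /andP[t0 tT]; apply: contrapT => nPt.
pose S := [set s : R | 0 <= s <= T /\ ~ P s].
have St : S t by split => //; rewrite t0.
have hS : has_inf S by split; [exists t|exists 0 => s [/andP[]]].
pose m := inf S.
have mt : m <= t by exact: (ge_inf hS.2 St).
have m0 : 0 <= m by apply: lb_le_inf; [exists t|move=> s [/andP[]]].
have before s : 0 <= s -> s < m -> P s.
  move=> s0 sm; have sT : s <= T by lra.
  apply: contrapT => nPs; move: sm; rewrite ltNge => /negP; apply.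
  by apply: (ge_inf hS.2); split => //; rewrite s0.
have Pm : P m.
  move: m0; rewrite le_eqVlt => /predU1P[<-//|m0]; apply: Pl => //; lra.
have mltT : m < T.
  rewrite lt_neqAle (le_trans mt tT) andbT; apply/negP => /eqP mT; apply: nPt.
  have tm : t <= m by rewrite mT.
  by have -> : t = m by apply: le_anti; rewrite tm mt.
have [d d0 hd] := Pr m m0 mltT Pm.
have [s [/andP[s0 sT] nPs] sd] := inf_adherent d0 hS.
have ms : m <= s by apply: (ge_inf hS.2); split; [rewrite s0|exact: nPs].
apply: nPs.
move: ms; rewrite le_eqVlt => /predU1P[<-//|ms].
exact: hd.
Qed.

(* The growth bound is only assumed while the error is at most 1. *)
Lemma gronwall_barrier n (T A tau delta : R) (e : R -> nat -> R) : 0 <= T -> 0 <= A ->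
  0 <= tau -> tau < delta -> delta * expR ((A + 1) * T) <= 1 ->
  (forall i, (i < n)%N -> e 0 i = 0) ->
  (forall i, (i < n)%N -> forall t, 0 <= t <= T -> exists l, deriv_on T (e ^~ i) t l /\
     forall b, b <= 1 -> (forall j, (j < n)%N -> `|e t j| <= b) -> `|l| <= A * b + tau) ->
  forall t, 0 <= t <= T -> forall i, (i < n)%N -> `|e t i| <= delta * expR ((A + 1) * t).
Proof.
move=> T0 A0 tau0 taud dT e0 de.
have d0 : 0 < delta by exact: le_lt_trans taud.
pose B t := delta * expR ((A + 1) * t).
have Bm s t : s <= t -> B s <= B t.
  by move=> st; rewrite ler_pM2l// ler_expR ler_wpM2l//; lra.
have Bd t : 0 <= t -> delta <= B t.
  by move=> t0; rewrite -[leLHS]mulr1 -expR0 -(mulr0 (A + 1)); exact: Bm.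
have B1 t : t <= T -> B t <= 1 by move=> tT; exact: le_trans (Bm _ _ tT) dT.
(* The barrier lies above its tangents, by exp x >= 1 + x. *)
have Bc s t : B s + (A + 1) * B s * (t - s) <= B t.
  have -> : B t = B s * expR ((A + 1) * (t - s)).
    by rewrite /B -mulrA -expRD; congr (_ * expR _); ring.
  have -> : B s + (A + 1) * B s * (t - s) = B s * (1 + (A + 1) * (t - s)) by ring.
  rewrite ler_wpM2l ?expR_ge1Dx// mulr_ge0 ?expR_ge0// ltW//.
apply: real_induction => // [i hi|t t0 tT Pt|t t0 tT Pt i hi].
- by rewrite e0// normr0 mulr_ge0 ?expR_ge0// ltW.
- have tT' : 0 <= t <= T by rewrite t0 ltW.
  have [d d00 hd] : exists2 d : R, 0 < d & forall i, (i < n)%N -> forall s, s < d ->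
      0 < s -> t + s <= T -> `|e (t + s) i| <= B (t + s).
    apply: common_radius => i hi; have [l [dl hl]] := de i hi t tT'.
    have lB := hl (B t) (B1 t (ltW tT)) Pt.
    (* The surplus [B t - tau], positive because tau < delta <= B t, fills the bound A B + tau on
       |l| up to (A + 1) B, the slope of the barrier. This is why the exponent is A + 1. *)
    have ep : 0 < B t - tau by have := Bd t t0; lra.
    have [d d00 hd] := deriv_on_lip dl ep; exists d => // s sd s0 tsT.
    have ts : 0 <= t + s <= T by rewrite tsT addr_ge0// ltW.
    have ss : t + s - t = s by ring.
    have := hd (t + s) ts; rewrite ss (gtr0_norm s0) => /(_ sd) H.
    have := Bc t (t + s); rewrite ss => Bcs.
    have := Pt i hi; rewrite -/(B t) => Pti.
    have := lerB_dist (e (t + s) i) (e t i).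
    have : (`|l| + (B t - tau)) * s <= (A + 1) * B t * s.
      by apply: ler_wpM2r; [exact: ltW|lra].
    move: H Bcs; lra.
  exists d => // s ts sd sT i hi.
  have -> : s = t + (s - t) by ring.
  by apply: hd => //; lra.
- have tT' : 0 <= t <= T by rewrite (ltW t0).
  have [l [dl _]] := de i hi t tT'.
  have [d d00 hd] := deriv_on_lip dl ltr01.
  rewrite -/(B t); apply/ler_addgt0Pr => ep ep0.
  pose k := Num.min (Num.min (d / 2) (t / 2)) (ep / (`|l| + 1)).
  have l1 : 0 < `|l| + 1 by rewrite ltr_wpDl.
  have k0 : 0 < k by rewrite !lt_min !divr_gt0.
  have k1 : k <= d / 2 by rewrite !ge_min lexx.
  have k2 : k <= t / 2 by rewrite !ge_min lexx orbT.
  have k3 : k <= ep / (`|l| + 1) by rewrite !ge_min lexx orbT.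
  have tk : 0 <= t - k <= T by apply/andP; split; lra.
  have kk : `|t - k - t| = k by rewrite addrAC subrr add0r normrN gtr0_norm.
  have := hd (t - k) tk; rewrite kk => /(_ _) H.
  have {}H : `|e (t - k) i - e t i| <= (`|l| + 1) * k by apply: H; lra.
  have : `|e (t - k) i| <= B (t - k) by apply: Pt => //; lra.
  have : B (t - k) <= B t by apply: Bm; lra.
  move: k3; rewrite ler_pdivlMr// => k3.
  have := lerB_dist (e t i) (e (t - k) i); rewrite distrC; lra.
Qed.

End Barrier.

(** * Global solution of Lipschitz systems by Picard iteration *)

Section Picard.
Context {R : realType}.
Local Notation mu := (@lebesgue_measure R).

Definition primitive (a : R) (f : R -> R) (x : R) := \int[mu]_(y in `[a, x]) f y.

Lemma is_derive_primitive f (a x : R) : continuous f -> a < x ->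
  is_derive (x : R) (1 : R) (primitive a f) (f x).
Proof.
move=> cf ax; have x1 : x < x + 1 by rewrite ltrDl.
have [dF F'] := @continuous_FTC1_closed _ f a x (x + 1) x1
  (continuous_integrable_itv a (x + 1) cf) ax (cf x).
by split; [exact: dF | rewrite -derive1E; exact: F'].
Qed.

Lemma derive_compare (f b f' b' : R -> R) (t : R) : 0 <= t ->
  (forall x, -1 < x -> is_derive (x : R) (1 : R) f (f' x)) ->
  (forall x, -1 < x -> is_derive (x : R) (1 : R) b (b' x)) ->
  (forall x, 0 <= x <= t -> `|f' x| <= b' x) ->
  `|f t - f 0| <= b t - b 0.
Proof.
rewrite le_eqVlt => /predU1P[<-|t0] df db fb; first by rewrite !subrr normr0.
have key (s : R) : `|s| = 1 -> s * (f t - f 0) <= b t - b 0.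
  move=> s1; pose h x := b x - s * f x.
  have dh x : -1 < x -> is_derive (x : R) (1 : R) h (b' x - s * f' x).
    move=> x1; have d1 := df x x1; have d2 := db x x1.
    by apply: is_derive_eq; rewrite /GRing.scale /=; ring.
  have ch : {within `[0, t], continuous h}.
    apply: derivable_within_continuous => x; rewrite in_itv /= => /andP[x0 _].
    by have x1 : -1 < x by [lra]; have [] := dh x x1.
  have dh' x : x \in `]0, t[ -> is_derive (x : R) (1 : R) h (b' x - s * f' x).
    by rewrite in_itv /= => /andP[x0 _]; apply: dh; lra.
  have [c] := MVT t0 dh' ch; rewrite in_itv /= => /andP[c0 ct] E.
  have : 0 <= h t - h 0.
    rewrite E subr0 mulr_ge0 ?(ltW t0)// subr_ge0 (le_trans (ler_norm _))//.
    by rewrite normrM s1 mul1r fb// ltW// ltW.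
  rewrite /h; lra.
have := key 1 (normr1 _); have := key (-1) (normrN1 _).
by rewrite ler_norml => h1 h2; apply/andP; split; lra.
Qed.

Lemma deriv_on_is_derive (T t l : R) (f g : R -> R) : 0 <= t <= T ->
  (forall s, 0 <= s <= T -> g s = f s) -> is_derive (t : R) (1 : R) f l -> deriv_on T g t l.
Proof.
move=> tT gf df e e0; have [dfx dfl] := df.
have : (fun h => h^-1 *: ((f \o shift t) (h *: (1 : R)) - f t)) @ 0^' --> l.
  by rewrite -dfl; exact: dfx.
move=> /cvgrPdist_lt /(_ e e0); rewrite near_withinE => /nbhs_ballP[d /= d0 hd].
exists d; split => // t' t'T /andP[h0 hlt]; rewrite !gf// distrC.
have := hd (t' - t); rewrite /ball /= sub0r normrN => /(_ hlt).
rewrite -normr_gt0 => /(_ h0); rewrite /GRing.scale /= mulr1 subrK.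
by rewrite (mulrC (t' - t)^-1).
Qed.

Lemma min_dist (x y a : R) : `|Num.min x a - Num.min y a| <= `|x - y|.
Proof.
have n1 := ler_norm (x - y); have n2 := ler_norm (y - x); rewrite distrC in n2.
by case: (leP x a) => h1; case: (leP y a) => h2; rewrite ?subrr ?normr0//
  ler_norml; apply/andP; split; lra.
Qed.

Lemma near_forall_lt (t : R) n (Q : nat -> R -> Prop) :
  (forall j, (j < n)%N -> \forall s \near t, Q j s) ->
  \forall s \near t, forall j, (j < n)%N -> Q j s.
Proof.
elim: n => [|n IH] H; first by near=> s.
have h1 := IH (fun j h => H j (ltn_trans h (ltnSn n))).
apply: filterS2 h1 (H n (ltnSn n)) => s a b j.
by rewrite ltnS leq_eqVlt => /orP[/eqP ->//|]; exact: a.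
Unshelve. all: by end_near.
Qed.

Variables (n : nat) (T L : R) (F : (nat -> R) -> nat -> R) (v0 : nat -> R).
Hypotheses (T0 : 0 < T) (L0 : 0 < L)
  (FL : forall v w b, (forall j, (j < n)%N -> `|v j - w j| <= b) ->
     forall i, (i < n)%N -> `|F v i - F w i| <= L * b).

(** Freezing time outside [0, T] makes the iterates continuous on the whole line, so that continuity
    never has to be relativised. *)
Let clamp (t : R) := Num.max 0 (Num.min t T).

Let clamp_in t : 0 <= clamp t <= T.
Proof. by rewrite /clamp le_max lexx /= ge_max (ltW T0) /= ge_min lexx orbT. Qed.

Let clamp_id t : 0 <= t <= T -> clamp t = t.
Proof. by move=> /andP[t0 tT]; rewrite /clamp (min_idPl tT) (max_idPr t0). Qed.

Let clamp_lip x y : `|clamp x - clamp y| <= 1 * `|x - y|.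
Proof.
rewrite mul1r /clamp; apply: (le_trans (max0_dist _ _)); exact: min_dist.
Qed.

Let clamp_continuous : continuous clamp.
Proof. exact: lipschitz_continuous clamp_lip. Qed.

(** The base point -1 keeps 0 in the interior, so there is a two-sided derivative on all of [0, T];
    subtracting the value at 0 restores the initial condition. *)
Let flow (w : R -> nat -> R) (t : R) (i : nat) : R :=
  v0 i + (primitive (-1) (fun s => F (w s) i) t - primitive (-1) (fun s => F (w s) i) 0).

Let cont (w : R -> nat -> R) := forall i, (i < n)%N -> continuous (w ^~ i).

Lemma vector_field_continuous w : cont w -> forall i, (i < n)%N ->
  continuous (fun s => F (w s) i).
Proof.
move=> cw i hi t; apply/cvgrPdist_le => e e0.
have eL : 0 < e / L by rewrite divr_gt0.
have : \forall s \near t, forall j, (j < n)%N -> `|w t j - w s j| <= e / L.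
  by apply: near_forall_lt => j hj; have /cvgrPdist_le /(_ _ eL) := cw j hj t.
apply: filterS => s hs; have := FL hs hi.
by rewrite mulrC divfK ?gt_eqF.
Qed.

Let flow_derive w i x : cont w -> (i < n)%N -> -1 < x ->
  is_derive (x : R) (1 : R) (flow w ^~ i) (F (w x) i).
Proof.
move=> cw hi x1; have dp := is_derive_primitive (vector_field_continuous cw hi) x1.
rewrite /flow; move: dp; set p := primitive _ _ => dp.
have d1 := is_deriveB dp (is_derive_cst (p 0) x (1 : R)).
have d2 := is_deriveD (is_derive_cst (v0 i) x (1 : R)) d1.
by move: d2; rewrite add0r subr0.
Qed.

Let flow0 w i : flow w 0 i = v0 i.
Proof. by rewrite /flow subrr addr0. Qed.

Let flow_compare w w' i t (b b' : R -> R) : cont w -> cont w' -> (i < n)%N -> 0 <= t <= T ->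
  (forall x, is_derive (x : R) (1 : R) b (b' x)) ->
  (forall x, 0 <= x <= T -> `|F (w x) i - F (w' x) i| <= b' x) ->
  `|flow w t i - flow w' t i| <= b t - b 0.
Proof.
move=> cw cw' hi /andP[t0 tT] db H.
have := @derive_compare (fun t => flow w t i - flow w' t i) b
  (fun x => F (w x) i - F (w' x) i) b' t t0.
rewrite !flow0 subrr subr0; apply.
- by move=> x x1; apply: is_deriveB; exact: flow_derive.
- by move=> x /andP[x0 xt]; apply: H; rewrite x0 (le_trans xt).
Qed.

Let flow_clamp_cont w : cont w -> cont (fun t => flow w (clamp t)).
Proof.
move=> cw i hi t.
apply: (@continuous_comp _ _ _ clamp (flow w ^~ i)); first exact: clamp_continuous.
have c1 : -1 < clamp t by have /andP[c0 _] := clamp_in t; lra.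
apply/differentiable_continuous/derivable1_diffP.
by have [] := flow_derive cw hi c1.
Qed.

Let iterate k := iter k (fun w t => flow w (clamp t)) (fun _ => v0).

Let iterate_cont k : cont (iterate k).
Proof. by elim: k => [|k IH]; [move=> i _; exact: cst_continuous|exact: flow_clamp_cont]. Qed.

(** Chosen so that |F v0 i| <= 2 L D, the initial slope of [bump D]; this starts the induction on
    iterates. *)
Let D := (\sum_(i < n) `|F v0 i|) / (2 * L).

Let D_ge0 : 0 <= D.
Proof. by apply: divr_ge0; [exact: sumr_ge0|apply: mulr_ge0 => //; exact: ltW]. Qed.

Let F0_le i : (i < n)%N -> `|F v0 i| <= D * (2 * L).
Proof.
move=> hi; rewrite /D divfK; last by rewrite gt_eqF// mulr_gt0.
by rewrite (bigD1 (Ordinal hi)) //= lerDl sumr_ge0.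
Qed.

(** Bielecki's weight: measured against exp(2 L t), the Picard map halves distances on the whole of
    [0, T], so no continuation over short time steps is needed. *)
Let bump (c t : R) := c * expR (2 * L * t).

Let bump_derive c x : is_derive (x : R) (1 : R) (bump c) (c * (2 * L) * expR (2 * L * x)).
Proof. by rewrite /bump; apply: is_derive_eq; rewrite /GRing.scale /=; ring. Qed.

Let bump0 c : bump c 0 = c.
Proof. by rewrite /bump mulr0 expR0 mulr1. Qed.

Let iterate_step k t i : (i < n)%N -> 0 <= t <= T ->
  `|iterate k.+1 t i - iterate k t i| <= bump (D * 2 ^- k) t.
Proof.
elim: k t i => [|k IH] t i hi tT.
  rewrite /iterate /= clamp_id// -[X in _ - X](flow0 (fun _ => v0) i).
  pose f t := flow (fun _ => v0) t i.
  have c0 : cont (fun _ => v0) by move=> j _; exact: cst_continuous.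
  have [t0 _] := andP tT.
  have := @derive_compare f (bump D) (fun _ => F v0 i) _ t t0
    (fun x x1 => flow_derive c0 hi x1) (fun x _ => bump_derive D x).
  rewrite bump0 invr1 mulr1 => H.
  apply: (@le_trans _ _ (bump D t - D)); last by rewrite gerBl.
  apply: H => x /andP[x0 _]; apply: (le_trans (F0_le hi)).
  rewrite ler_peMr//; first by rewrite mulr_ge0// mulr_ge0// ltW.
  by rewrite -expR0 ler_expR mulr_ge0// mulr_ge0// ltW.
have ik : iterate k.+1 = fun t => flow (iterate k) (clamp t) by [].
have ik1 : iterate k.+2 = fun t => flow (iterate k.+1) (clamp t) by [].
rewrite ik1 {2}ik clamp_id//.
have H x : 0 <= x <= T -> `|F (iterate k.+1 x) i - F (iterate k x) i| <=
    D * 2 ^- k.+1 * (2 * L) * expR (2 * L * x).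
  move=> xT; have := FL (fun j hj => IH x j hj xT) hi.
  move=> /le_trans; apply; rewrite le_eqVlt; apply/orP; left; apply/eqP.
  by rewrite /bump exprS; field; rewrite expf_neq0.
have := flow_compare (@iterate_cont k.+1) (@iterate_cont k) hi tT (bump_derive _) H.
move=> /le_trans; apply; rewrite bump0 gerBl mulr_ge0 ?invr_ge0 ?exprn_ge0//.
Qed.

Let E0 := D * expR (2 * L * T).

Let E0_ge0 : 0 <= E0. Proof. by rewrite mulr_ge0 ?expR_ge0. Qed.

Let iterate_clamp k s : iterate k (clamp s) = iterate k s.
Proof. by case: k => [//|k]; rewrite /iterate /= (clamp_id (clamp_in s)). Qed.

Let iterate_step' k s i : (i < n)%N -> `|iterate k.+1 s i - iterate k s i| <= E0 * 2 ^- k.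
Proof.
move=> hi; rewrite -(iterate_clamp k.+1) -(iterate_clamp k).
apply: (le_trans (iterate_step k hi (clamp_in s))).
have /andP[_ cT] := clamp_in s.
have h : expR (2 * L * clamp s) <= expR (2 * L * T).
  by rewrite ler_expR ler_wpM2l// mulr_ge0// ltW.
have p : 0 <= 2 ^- k :> R by rewrite invr_ge0 exprn_ge0.
by rewrite /bump /E0 [leRHS]mulrAC; apply: ler_wpM2l => //; exact: mulr_ge0.
Qed.

Let iterate_dist k m s i : (i < n)%N ->
  `|iterate (k + m) s i - iterate k s i| <= 2 * E0 * 2 ^- k - 2 * E0 * 2 ^- (k + m).
Proof.
move=> hi; elim: m => [|m IH]; first by rewrite addn0 !subrr normr0.
rewrite addnS; have := iterate_step' (k + m) s hi.
have e2 : 2 * E0 * 2 ^- (k + m).+1 = E0 * 2 ^- (k + m).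
  by rewrite exprS; field; rewrite expf_neq0.
rewrite e2 => h; apply: (le_trans (ler_distD (iterate (k + m) s i) _ _)).
move: IH h; rewrite -[2 * E0 * 2 ^- (k + m)]mulrA; lra.
Qed.

Let iterate_near k m s i : (i < n)%N ->
  iterate m s i - 2 * E0 * 2 ^- m <= iterate k s i + 2 * E0 * 2 ^- k.
Proof.
move=> hi; have p0 j : 0 <= 2 * E0 * 2 ^- j.
  by apply: mulr_ge0; [apply: mulr_ge0|rewrite invr_ge0 exprn_ge0].
have [km|/ltnW mk] := leqP k m.
- have := iterate_dist k (m - k) s hi; rewrite subnKC// ler_norml => /andP[_].
  by have := p0 m; have := p0 k; lra.
- have := iterate_dist m (k - m) s hi; rewrite subnKC// ler_norml => /andP[].
  by have := p0 m; have := p0 k; lra.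
Qed.

(** The limit of the iterates, as a supremum of lower bounds: 2 E0 2^(-k) is the tail of the
    geometric series of the remaining steps. *)
Let sol (s : R) (i : nat) : R :=
  sup [set y : R | exists k, y = iterate k s i - 2 * E0 * 2 ^- k].

Let iterate_sol k s i : (i < n)%N -> `|iterate k s i - sol s i| <= 2 * E0 * 2 ^- k.
Proof.
move=> hi; pose S := [set y : R | exists k, y = iterate k s i - 2 * E0 * 2 ^- k].
have ub j : ubound S (iterate j s i + 2 * E0 * 2 ^- j) by move=> y [m ->]; exact: iterate_near.
have S0 : S !=set0 by exists (iterate 0 s i - 2 * E0 * 2 ^- 0), 0%N.
have h1 : sol s i <= iterate k s i + 2 * E0 * 2 ^- k by exact: ge_sup.
have h2 : iterate k s i - 2 * E0 * 2 ^- k <= sol s i.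
  by apply: ub_le_sup; [exists (iterate 0 s i + 2 * E0 * 2 ^- 0)|exists k].
by rewrite ler_norml; apply/andP; split; lra.
Qed.

Lemma geometric_small (x e : R) : 0 < e -> exists k, x * 2 ^- k <= e.
Proof.
move=> e0; pose k := (Num.truncn (x / e)).+1; exists k.
have h : x / e < k%:R by exact: truncnS_gt.
rewrite ler_pdivrMr ?exprn_gt0//; move: h; rewrite ltr_pdivrMr// => h.
have k2 : (k%:R : R) <= 2 ^+ k by rewrite -natrX ler_nat ltnW// ltn_expl.
rewrite (le_trans (ltW h))// mulrC ler_wpM2l// ltW//.
Qed.

Let sol_cont : cont sol.
Proof.
move=> i hi t; apply/cvgrPdist_le => e e0.
have e3 : 0 < e / 3 by lra.
have [k hk] := geometric_small (2 * E0) e3.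
have /cvgrPdist_le /(_ _ e3) := @iterate_cont k i hi t.
apply: filterS => s hs.
have := iterate_sol k t hi; have := iterate_sol k s hi; move: hs.
rewrite !ler_norml => /andP[? ?] /andP[? ?] /andP[? ?].
by apply/andP; split; lra.
Qed.

Let sol_fixed t i : (i < n)%N -> 0 <= t <= T -> flow sol t i = sol t i.
Proof.
move=> hi tT; apply/eqP; rewrite -subr_eq0 -normr_le0; apply/ler_addgt0Pl => e e0; rewrite addr0.
(* The two summands pay for [flow (iterate k)] against [flow sol], a rate 2 L E0 2^(-k) over a time
   at most T, and for the next iterate against [sol]. *)
have [k hk] := geometric_small (L * (2 * E0) * T + E0) e0.
pose c := L * (2 * E0 * 2 ^- k).
have dc x : is_derive (x : R) (1 : R) (fun x => c * x) c.
  by apply: is_derive_eq; rewrite /GRing.scale /= mulr1.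
have H x : 0 <= x <= T -> `|F (iterate k x) i - F (sol x) i| <= c.
  by move=> _; apply: FL => // j hj; exact: iterate_sol.
have := flow_compare (@iterate_cont k) sol_cont hi tT dc H.
have E : flow (iterate k) t = iterate k.+1 t by rewrite /iterate /= clamp_id.
rewrite E mulr0 subr0 => h1.
have := iterate_sol k.+1 t hi.
have e2 : 2 * E0 * 2 ^- k.+1 = E0 * 2 ^- k by rewrite exprS; field; rewrite expf_neq0.
rewrite e2 => h2.
have c0 : 0 <= c by rewrite mulr_ge0 ?(ltW L0)// mulr_ge0 ?invr_ge0 ?exprn_ge0// mulr_ge0.
have /andP[_ tT'] := tT.
have h3 : c * t <= L * (2 * E0) * T * 2 ^- k.
  apply: (@le_trans _ _ (c * T)); first by rewrite ler_wpM2l.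
  by rewrite le_eqVlt /c; apply/orP; left; apply/eqP; ring.
rewrite mulrDl in hk.
move: h1 h2; rewrite !ler_norml => /andP[? ?] /andP[? ?].
by apply/andP; split; lra.
Qed.

Lemma picard : exists v : R -> nat -> R,
  (forall i, (i < n)%N -> v 0 i = v0 i) /\
  forall i, (i < n)%N -> forall t, 0 <= t <= T -> deriv_on T (v ^~ i) t (F (v t) i).
Proof.
exists sol; split=> [i hi|i hi t tT].
  by rewrite -sol_fixed ?flow0// lexx ltW.
apply: (@deriv_on_is_derive _ _ _ (flow sol ^~ i)) => //.
- by move=> s sT; rewrite sol_fixed.
- by apply: (flow_derive sol_cont hi); have /andP[t0 _] := tT; lra.
Qed.

End Picard.

(** * Second differences and the regularity of functions in H^s *)

Section SecondDifferences.
Context {R : realType}.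
Variables (F F1 : R -> R) (r K : R).
Hypotheses (dF : forall x, is_derive (x : R) (1 : R) F (F1 x))
  (F1K : forall x y, `|x| <= r -> `|y| <= r -> `|F1 x - F1 y| <= K * `|x - y|).

(** Mean value theorem for x -> F(x + q) - F(x), whose derivative is at most K |q|. The four corners
    in the ball of radius [r] keep the intermediate points there by convexity. *)
Lemma parallelogram_le (a p q : R) : `|a| <= r -> `|a + p| <= r -> `|a + q| <= r ->
  `|a + p + q| <= r -> `|F a - F (a + p) - F (a + q) + F (a + p + q)| <= K * `|q| * `|p|.
Proof.
rewrite !ler_norml => /andP[? ?] /andP[? ?] /andP[? ?] /andP[? ?].
pose g x := F (1 * x + q) - F x.
have dg x : is_derive (x : R) (1 : R) g (1 * F1 (1 * x + q) - F1 x).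
  by apply: is_deriveB; exact: is_derive_affine.
have -> : F a - F (a + p) - F (a + q) + F (a + p + q) = g (a + p) - g a.
  by rewrite /g !mul1r; ring.
have H := @mean_value_le _ g _ a (a + p) (K * `|q|) dg.
rewrite (_ : a + p - a = p) in H; last by ring.
rewrite -ler_norml; apply: H => x; rewrite !mul1r => hx.
have [x1 x2] : `|x + q| <= r /\ `|x| <= r.
  move: hx; have [h|h] := lerP a (a + p); rewrite !ler_norml => /andP[? ?].
  - by split; apply/andP; split; lra.
  - by split; apply/andP; split; lra.
by rewrite (le_trans (F1K x1 x2))// (_ : x + q - x = q)//; ring.
Qed.

(** The defect, as a function of the step, vanishes at 0 and has derivative th (F1(a + x) - F1(a +
    th x)), at most K |b|. *)
Lemma interpolation_le (a b th : R) : 0 <= th <= 1 -> `|a| <= r -> `|a + b| <= r -> 0 <= K ->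
  `|(1 - th) * F a + th * F (a + b) - F (a + th * b)| <= K * b ^+ 2.
Proof.
move=> /andP[t0 t1]; rewrite !ler_norml => /andP[a1 a2] /andP[b1 b2] K0; rewrite -ler_norml.
pose g x := (1 - th) * F a + th * F (1 * x + a) - F (th * x + a).
have dg x : is_derive (x : R) (1 : R) g (th * (1 * F1 (1 * x + a)) - th * F1 (th * x + a)).
  have d1 := @is_derive_affine _ F F1 1 a x dF; have d2 := @is_derive_affine _ F F1 th a x dF.
  by apply: is_derive_eq; rewrite /GRing.scale /=; ring.
have -> : (1 - th) * F a + th * F (a + b) - F (a + th * b) = g b - g 0.
  by rewrite /g mulr0 add0r mulr0 add0r mul1r (addrC b) (addrC (th * b)); ring.
have H := @mean_value_le _ g _ 0 b (K * `|b|) dg.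
rewrite subr0 -mulrA -expr2 real_normK ?num_real// in H.
apply: H => x hx; rewrite -mulrBr !mul1r normrM (ger0_norm t0).
have xb : `|x| <= `|b|.
  move: hx; have [h|h] := lerP 0 b => /andP[? ?].
  - by rewrite (ger0_norm h) ler_norml; apply/andP; split; lra.
  - by rewrite (ltr0_norm h) ler_norml; apply/andP; split; lra.
have [x1 x2] : `|x + a| <= r /\ `|th * x + a| <= r.
  move: hx; have [h|h] := lerP 0 b; rewrite !ler_norml => /andP[? ?].
  - by split; apply/andP; split; nra.
  - by split; apply/andP; split; nra.
have := F1K x1 x2.
have -> : x + a - (th * x + a) = (1 - th) * x by ring.
have t1' : 0 <= 1 - th by lra.
rewrite normrM (ger0_norm t1') => H.
apply: (@le_trans _ _ (1 * (K * ((1 - th) * `|x|)))); first by rewrite ler_pM.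
rewrite mul1r ler_wpM2l// (le_trans _ xb)// ler_piMl//; lra.
Qed.

End SecondDifferences.

Section Regularity.
Context {R : realType}.
Local Notation mu := (@lebesgue_measure R).
Implicit Types (v : R -> R).

(** Size and increments, the mixed differences used by the trapezoidal rule, and the interpolation
    defect used by the measure term, under one constant so that uniformity in time is a single
    statement. *)
Definition regular (K : R) v := [/\ forall x, `|v x| <= K,
  forall x y, `|v x - v y| <= K * `|x - y|,
  forall x p q, 0 <= p -> 0 <= q ->
     `|v x - v (x + p) - v (x + q) + v (x + p + q)| <= K * (p * q) &
  forall h x th, 0 <= th <= 1 ->
     `|(1 - th) * v x + th * v (x + h) - v (x + th * h)| <= K * h ^+ 2].

Lemma regularD K K' v v' : regular K v -> regular K' v' ->
  regular (K + K') (fun x => v x + v' x).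
Proof.
move=> [a1 a2 a3 a4] [b1 b2 b3 b4]; split.
- by move=> x; rewrite (le_trans (ler_normD _ _))// lerD.
- move=> x y; rewrite mulrDl opprD addrACA (le_trans (ler_normD _ _))// lerD//.
- move=> x p q p0 q0.
  have -> : v x + v' x - (v (x + p) + v' (x + p)) - (v (x + q) + v' (x + q)) +
      (v (x + p + q) + v' (x + p + q)) = (v x - v (x + p) - v (x + q) + v (x + p + q)) +
      (v' x - v' (x + p) - v' (x + q) + v' (x + p + q)) by ring.
  by rewrite (le_trans (ler_normD _ _))// (mulrDl K) lerD ?a3 ?b3.
- move=> h x th t01.
  have -> : (1 - th) * (v x + v' x) + th * (v (x + h) + v' (x + h)) -
      (v (x + th * h) + v' (x + th * h)) = ((1 - th) * v x + th * v (x + h) - v (x + th * h)) +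
      ((1 - th) * v' x + th * v' (x + h) - v' (x + th * h)) by ring.
  by rewrite (le_trans (ler_normD _ _))// (mulrDl K) lerD ?a4 ?b4.
Qed.

Lemma regular_mono K K' v : K <= K' -> regular K v -> regular K' v.
Proof.
move=> KK [a1 a2 a3 a4]; split.
- by move=> x; exact: le_trans KK.
- by move=> x y; rewrite (le_trans (a2 x y))// ler_wpM2r.
- by move=> x p q p0 q0; rewrite (le_trans (a3 x p q p0 q0))// ler_wpM2r// mulr_ge0.
- by move=> h x th t01; rewrite (le_trans (a4 h x th t01))// ler_wpM2r// sqr_ge0.
Qed.

Lemma regular_continuous K v : regular K v -> continuous v.
Proof. by move=> [_ lip _ _]; exact: lipschitz_continuous lip. Qed.

(** Four functionals with one, two, four and three nodes. Their symbols are the same differences of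
    cos and sin, at most 1, |x - y| |xi|, p q xi^2 and h^2 xi^2, hence all within the weight 1 +
    xi^2. *)
Lemma Hs_regular (s M : R) v : 3 <= s -> 0 < M -> continuous v -> Hs_bound s v M ->
  regular (10 * Num.sqrt M) v.
Proof.
move=> s3 M0 cv HM.
have dcos (x : R) : is_derive x (1 : R) cos (- sin x) by exact: is_derive_cos.
have dsin (x : R) : is_derive x (1 : R) sin (cos x) by exact: is_derive_sin.
have sin_lip (x y : R) : `|sin x - sin y| <= 1 * `|x - y|.
  by apply: (@mean_value_le _ sin cos) => // z _; rewrite ler_norml cos_geN1 cos_le1.
have cos_lip (x y : R) : `|cos x - cos y| <= 1 * `|x - y|.
  apply: (@mean_value_le _ cos (fun x => - sin x)) => // z _.
  by rewrite normrN ler_norml sin_geN1 sin_le1.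
have nsin_lip (x y : R) : `|- sin x - - sin y| <= 1 * `|x - y|.
  by rewrite -opprD normrN.
have xi1 (xi : R) : `|xi| <= 1 + xi ^+ 2.
  rewrite -[xi ^+ 2]real_normK ?num_real//; have := sqr_ge0 (`|xi| - 1); nra.
have xi2 (xi : R) : 1 <= 1 + xi ^+ 2 by rewrite lerDl sqr_ge0.
have bound n (a X : seq R) (b : R) : 0 <= b ->
    (forall xi, `|\sum_(i < n) a`_i * cos (X`_i * xi)| <= b * (1 + xi ^+ 2)) ->
    (forall xi, `|\sum_(i < n) a`_i * sin (X`_i * xi)| <= b * (1 + xi ^+ 2)) ->
    `|\sum_(i < n) a`_i * v X`_i| <= 10 * Num.sqrt M * b.
  move=> b0; exact: (@Hs_functional_bound _ s M v n (nth 0 a) (nth 0 X) b s3 M0 cv HM b0).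
have big_r (a b c d : R) : exists r, [/\ `|a| <= r, `|b| <= r, `|c| <= r & `|d| <= r].
  exists (`|a| + `|b| + `|c| + `|d|); have := normr_ge0 a; have := normr_ge0 b.
  by have := normr_ge0 c; have := normr_ge0 d => ? ? ? ?; split; lra.
split.
- move=> x; have := @bound 1%N [:: 1] [:: x] 1 ler01.
  rewrite !big_ord_recl !big_ord0 /= mul1r addr0 mulr1; apply=> xi;
    rewrite !big_ord_recl !big_ord0 /= !mul1r addr0 (le_trans _ (xi2 xi))// ler_norml.
  + by rewrite cos_geN1 cos_le1.
  + by rewrite sin_geN1 sin_le1.
- move=> x y; have := @bound 2%N [:: 1; -1] [:: x; y] `|x - y| (normr_ge0 _).
  rewrite !big_ord_recl !big_ord0 /= mul1r addr0 mulN1r; apply=> xi;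
    rewrite !big_ord_recl !big_ord0 /= !mul1r addr0 mulN1r.
  + by rewrite (le_trans (cos_lip _ _))// mul1r -mulrBl normrM ler_wpM2l.
  + by rewrite (le_trans (sin_lip _ _))// mul1r -mulrBl normrM ler_wpM2l.
- move=> x p q p0 q0; have pq0 : 0 <= p * q by exact: mulr_ge0.
  have := @bound 4%N [:: 1; -1; -1; 1] [:: x; x + p; x + q; x + p + q] (p * q) pq0.
  have E (a b c d : R) : 1 * a + (-1 * b + (-1 * c + (1 * d + 0))) = a - b - c + d by ring.
  rewrite !big_ord_recl !big_ord0 /= E; apply=> xi;
    rewrite !big_ord_recl !big_ord0 /= E !mulrDl;
    have [r [r1 r2 r3 r4]] := big_r (x * xi) (x * xi + p * xi) (x * xi + q * xi)
      (x * xi + p * xi + q * xi).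
  + have := parallelogram_le dcos (fun x y _ _ => nsin_lip x y) r1 r2 r3 r4.
    move=> /le_trans; apply; rewrite mul1r !normrM (ger0_norm p0) (ger0_norm q0).
    rewrite -[xi ^+ 2]real_normK ?num_real//; have := sqr_ge0 `|xi|; nra.
  + have := parallelogram_le dsin (fun x y _ _ => cos_lip x y) r1 r2 r3 r4.
    move=> /le_trans; apply; rewrite mul1r !normrM (ger0_norm p0) (ger0_norm q0).
    rewrite -[xi ^+ 2]real_normK ?num_real//; have := sqr_ge0 `|xi|; nra.
- move=> h x th t01; have h20 : 0 <= h ^+ 2 by exact: sqr_ge0.
  have := @bound 3%N [:: 1 - th; th; -1] [:: x; x + h; x + th * h] (h ^+ 2) h20.
  have E (a b c : R) : (1 - th) * a + (th * b + (-1 * c + 0)) = (1 - th) * a + th * b - c.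
    by ring.
  rewrite !big_ord_recl !big_ord0 /= E => H; refine (H _ _) => xi;
    rewrite !big_ord_recl !big_ord0 /= E (mulrDl x h xi) (mulrDl x (th * h) xi) -(mulrA th h xi);
    have [r [r1 r2 _ _]] := big_r (x * xi) (x * xi + h * xi) 0 0.
  + have := interpolation_le dcos (fun x y _ _ => nsin_lip x y) t01 r1 r2 ler01.
    by move=> /le_trans; apply; rewrite mul1r exprMn ler_wpM2l// lerDr.
  + have := interpolation_le dsin (fun x y _ _ => cos_lip x y) t01 r1 r2 ler01.
    by move=> /le_trans; apply; rewrite mul1r exprMn ler_wpM2l// lerDr.
Qed.

(** If |v(x)| > eta, the Lipschitz bound keeps |v| above eta/2 on ]x, x + d], and the integral of
    v^2 there is at least [c]. This cannot happen far out, where the bounded monotone [W] is within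
    [c] of its supremum or of its infimum. *)
Lemma regular_L2_decay (K eta : R) v : regular K v -> integ (fun x => v x ^+ 2) -> 0 < eta ->
  exists B, forall x, B <= `|x| -> `|v x| <= eta.
Proof.
move=> [vK lip _ _] iv eta0.
have K0 : 0 <= K by exact: le_trans (vK 0).
pose W := cumul (fun x => v x ^+ 2).
pose d := eta / (2 * (K + 1)).
have d0 : 0 < d by rewrite divr_gt0//; lra.
have dK : K * d <= eta / 2.
  have e : d * (K + 1) = eta / 2 by rewrite /d; field; rewrite gt_eqF//; lra.
  lra.
pose c := (eta / 2) ^+ 2 * d.
have c0 : 0 < c by rewrite mulr_gt0// exprn_gt0//; lra.
have key x : eta < `|v x| -> c <= W (x + d) - W x.
  move=> vx; have xd : x <= x + d by lra.
  rewrite /W cumulB//.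
  have mI : measurable (`]x, x + d]%classic : set (measurableTypeR R)) by [].
  have iN : mu.-integrable `]x, x + d] (EFin \o (fun y => `|v y ^+ 2|)).
    by apply: integ_on => //; exact: integ_norm.
  have ic : mu.-integrable `]x, x + d] (EFin \o cst ((eta / 2) ^+ 2)).
    apply: (@integrableS _ _ _ mu `[x, x + d]) => //.
      by apply: subset_itvr; rewrite bnd_simp.
    exact: (continuous_integrable_itv _ _ (@cst_continuous _ _ _)).
  have <- : \int[mu]_(y in `]x, x + d]) (cst ((eta / 2) ^+ 2) y) = c.
    rewrite Rintegral_cst//= lebesgue_measure_itv /= lte_fin ltrDl d0 /=.
    by rewrite addrAC subrr add0r.
  apply: le_Rintegral => // y /=; rewrite in_itv /= => /andP[y1 y2].
  rewrite normrX lerXn2r ?nnegrE//; first by lra.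
  have : `|v x - v y| <= eta / 2.
    apply: (le_trans (lip x y)); apply: (le_trans _ dK); rewrite ler_wpM2l//.
    by rewrite distrC ger0_norm; lra.
  have := lerB_dist (v x) (v y); lra.
have Wb x : 0 <= W x <= Rint (fun y => `|v y ^+ 2|) by rewrite cumul_ge0 cumul_le.
have Wm x y : x <= y -> W x <= W y.
  by move=> xy; rewrite -subr_ge0 /W cumulB//; exact: Rintegral_ge0.
pose S := range W.
have hs : has_sup S.
  split; first by exists (W 0), 0.
  by exists (Rint (fun y => `|v y ^+ 2|)) => _ [x _ <-]; have /andP[] := Wb x.
have hi : has_inf S.
  split; first by exists (W 0), 0.
  by exists 0 => _ [x _ <-]; have /andP[] := Wb x.
have [_ [x0 _ <-] h0] := sup_adherent c0 hs.
have [_ [x1 _ <-] h1] := inf_adherent c0 hi.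
exists (`|x0| + `|x1| + d) => x hx; rewrite leNgt; apply/negP => /key.
have Wsup y : W y <= sup S by apply: ub_le_sup; [exact: hs.2|exists y].
have Winf y : inf S <= W y by apply: ge_inf; [exact: hi.2|exists y].
have n0 := ler_norm x0; have n1 := ler_norm (- x1); rewrite normrN in n1.
have p0 := normr_ge0 x0; have p1 := normr_ge0 x1.
have [xp|xn] := lerP 0 x.
  rewrite (ger0_norm xp) in hx.
  have : W x0 <= W x by apply: Wm; lra.
  have := Wsup (x + d); lra.
rewrite (ltr0_norm xn) in hx.
have : W (x + d) <= W x1 by apply: Wm; lra.
have := Winf x; lra.
Qed.

End Regularity.

(** * Uniformity on the time interval *)

Section CompactTime.
Context {R : realType}.

(** Compactness of [0, T] by real induction; monotonicity in [K] lets two local constants be merged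
    by their maximum. *)
Lemma uniform_on_segment (T : R) (Q : R -> R -> Prop) : 0 <= T ->
  (forall K K' t, K <= K' -> Q K t -> Q K' t) ->
  (forall t, 0 <= t <= T -> exists K d, 0 < d /\
     forall s, 0 <= s <= T -> `|s - t| < d -> Q K s) ->
  exists K, forall t, 0 <= t <= T -> Q K t.
Proof.
move=> T0 Qm Ql.
have join K K' (t : R) : Q K t \/ Q K' t -> Q (Num.max K K') t.
  by case; apply: Qm; rewrite le_max lexx ?orbT.
suff /(_ T) [] : forall t, 0 <= t <= T -> exists K, forall s, 0 <= s <= t -> Q K s.
- by rewrite T0 lexx.
- by move=> K HK; exists K.
apply: real_induction => // [|t t0 tT [K HK]|t t0 tT HK].
- have [|K [d [d0 H]]] := Ql 0; first by rewrite lexx.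
  exists K => s /andP[s0 s1]; have -> : s = 0 by apply: le_anti; rewrite s0 s1.
  by apply: H; rewrite ?lexx// subrr normr0.
- have [|K' [d [d0 H]]] := Ql t; first by rewrite t0 ltW.
  exists d => // s ts sd sT; exists (Num.max K K') => r /andP[r0 rs]; apply: join.
  have [rt|tr] := lerP r t; [left; apply: HK; rewrite r0 //|right; apply: H].
  + by rewrite r0 (le_trans rs).
  + by rewrite gtr0_norm; lra.
- have [|K' [d [d0 H]]] := Ql t; first by rewrite tT ltW.
  pose q := Num.max 0 (t - d / 2).
  have q0 : 0 <= q by rewrite le_max lexx.
  have qt : q < t by rewrite gt_max t0 /=; lra.
  have qd : t - d / 2 <= q by rewrite le_max lexx orbT.
  have [K HK'] := HK q q0 qt.
  exists (Num.max K K') => r /andP[r0 rt]; apply: join.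
  have [rq|qr] := lerP r q; [left; apply: HK'; rewrite r0 //|right; apply: H].
  + by rewrite r0 (le_trans rt).
  + by rewrite distrC ger0_norm; lra.
Qed.

Lemma deriv_onB (T t l l' : R) (x y : R -> R) : deriv_on T x t l -> deriv_on T y t l' ->
  deriv_on T (fun s => x s - y s) t (l - l').
Proof.
move=> dx dy e e0; have e2 : 0 < e / 2 by lra.
have [d [d0 hd]] := dx _ e2; have [d' [d'0 hd']] := dy _ e2.
exists (Num.min d d'); rewrite lt_min d0 d'0; split => // s sT /andP[s0].
rewrite lt_min => /andP[sd sd'].
have := hd s sT; have := hd' s sT; rewrite s0 sd sd' => /(_ isT) h1 /(_ isT) h2.
have -> : (x s - y s - (x t - y t)) / (s - t) - (l - l') =
    ((x s - x t) / (s - t) - l) - ((y s - y t) / (s - t) - l') by ring.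
rewrite (le_lt_trans (ler_normB _ _))//; lra.
Qed.

End CompactTime.

Section Evolution.
Context {R : realType}.
Local Notation mu := (@lebesgue_measure R).
Variables (s T : R) (u w : R -> R -> R).
Hypotheses (s3 : 3 <= s) (T0 : 0 < T) (cu : forall t, continuous (u t)) (hu : Hs_cont s T u).

Lemma Hs_cont_increment t e : 0 <= t <= T -> 0 < e -> exists d, 0 < d /\
  forall t', 0 <= t' <= T -> `|t' - t| < d -> regular e (fun x => u t' x - u t x).
Proof.
(* With this [M] the constant 10 sqrt M of [Hs_regular] is exactly e. *)
move=> tT e0; have M0 : 0 < (e / 10) ^+ 2 by rewrite exprn_gt0//; lra.
have [_ H] := hu; have [d [d0 hd]] := H t tT _ M0.
exists d; split => // t' t'T td.
have := @Hs_regular R s _ (fun x => u t' x - u t x) s3 M0 _ (hd t' t'T td).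
rewrite sqrtr_sqr ger0_norm; last by lra.
rewrite mulrC divfK//; apply.
by move=> x; apply: cvgB; exact: cu.
Qed.

Lemma in_Hs_regular v : continuous v -> in_Hs s v -> exists K, regular K v.
Proof.
move=> cv [M [g1 [g2 [FP HM]]]]; exists (10 * Num.sqrt (Num.max M 1)).
apply: (Hs_regular s3 _ cv); first by rewrite lt_max ltr01 orbT.
exists g1, g2; split => //; apply: (le_trans HM); rewrite lee_fin.
by rewrite le_max lexx.
Qed.

Lemma evolution_regular : exists K, forall t, 0 <= t <= T -> regular K (u t).
Proof.
apply: uniform_on_segment; [exact: ltW|by move=> K K' t; exact: regular_mono|].
move=> t tT; have [K hK] := in_Hs_regular (@cu t) (hu.1 t tT).
have [d [d0 hd]] := Hs_cont_increment tT ltr01.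
exists (K + 1), d; split => // t' t'T td; have := regularD hK (hd t' t'T td).
by congr regular; apply/funext => x; ring.
Qed.

(** A radius independent of [t] is what allows [N] to be fixed once for all times. Half of eta goes
    to the decay at a given time, half to the increment around it. *)
Lemma evolution_decay eta : 0 < eta ->
  exists B, forall t, 0 <= t <= T -> forall x, B <= `|x| -> `|u t x| <= eta.
Proof.
move=> eta0; apply: uniform_on_segment; first exact: ltW.
  by move=> K K' t KK H x Kx; apply: H; exact: le_trans Kx.
move=> t tT; have [K hK] := in_Hs_regular (@cu t) (hu.1 t tT).
have e2 : 0 < eta / 2 by lra.
have [M [g1 [g2 [[[_ iv] _] _]]]] := hu.1 t tT.
have [B hB] := regular_L2_decay hK iv e2.
have [d [d0 hd]] := Hs_cont_increment tT e2.
exists B, d; split => // t' t'T td x Bx.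
have [/(_ x) h _ _ _] := hd t' t'T td; have h' := hB x Bx.
have := lerB_dist (u t' x) (u t x); lra.
Qed.

(** The H^s smallness of the difference quotient minus [w t] gives pointwise smallness, provided
    that function is continuous; hence the condition on [w t]. *)
Lemma evolution_derivative t x : 0 <= t <= T -> Hs_deriv s T u w -> continuous (w t) ->
  deriv_on T (fun t => u t x) t (w t x).
Proof.
move=> tT dw cw e e0; have M0 : 0 < (e / 20) ^+ 2 by rewrite exprn_gt0//; lra.
have [d [d0 hd]] := dw t tT _ M0; exists d; split => // t' t'T td.
have := @Hs_regular R s _ (fun x => (u t' x - u t x) / (t' - t) - w t x) s3 M0 _ (hd t' t'T td).
rewrite sqrtr_sqr ger0_norm; last by lra.
case.
- move=> y; apply: cvgB; last exact: cw.
  by apply: cvgM; [apply: cvgB; exact: cu|exact: cvg_cst].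
- by move=> /(_ x) h _ _ _; apply: (le_lt_trans h); lra.
Qed.

End Evolution.

(** * The nonlinearity and the continuity of the velocity *)

Section Nonlinearity.
Context {R : realType}.
Variables (f : R -> R) (k : nat).
Hypotheses (k3 : (3 <= k)%N) (Cf : Ck k f).

Lemma Ck_lipschitz (r : R) : 0 <= r -> exists K, [/\ 0 <= K,
  forall x, is_derive (x : R) (1 : R) f (derive1 f x),
  forall x y, `|x| <= r -> `|y| <= r -> `|f x - f y| <= K * `|x - y| &
  forall x y, `|x| <= r -> `|y| <= r -> `|derive1 f x - derive1 f y| <= K * `|x - y|].
Proof.
move=> r0; have [Cd _] := Cf.
have df x : derivable f x 1 := Cd 0%N (ltn_trans (isT : (0 < 2)%N) k3) x.
have df1 x : derivable (derive1 f) x 1 := Cd 1%N (ltn_trans (isT : (1 < 2)%N) k3) x.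
have df2 x : derivable (derive1 (derive1 f)) x 1 := Cd 2%N k3 x.
have dfE x : is_derive (x : R) (1 : R) f (derive1 f x).
  by split; [exact: df|rewrite derive1E].
have df1E x : is_derive (x : R) (1 : R) (derive1 f) (derive1 (derive1 f) x).
  by split; [exact: df1|rewrite derive1E].
have c1 : continuous (derive1 f).
  by move=> x; apply/differentiable_continuous/derivable1_diffP; exact: df1.
have c2 : continuous (derive1 (derive1 f)).
  by move=> x; apply/differentiable_continuous/derivable1_diffP; exact: df2.
have [K1 [K10 H1]] := continuous_bounded_itv (- r) r c1.
have [K2 [K20 H2]] := continuous_bounded_itv (- r) r c2.
have between (x y z : R) : `|x| <= r -> `|y| <= r -> Num.min y x <= z <= Num.max y x ->
    - r <= z <= r.
  rewrite !ler_norml => /andP[? ?] /andP[? ?].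
  by have [h|h] := lerP y x => /andP[? ?]; apply/andP; split; lra.
exists (K1 + K2); split; [exact: addr_ge0|exact: dfE| |] => x y xr yr.
- apply: (mean_value_le dfE) => z hz.
  by have := H1 z (between x y z xr yr hz); lra.
- apply: (mean_value_le df1E) => z hz.
  by have := H2 z (between x y z xr yr hz); lra.
Qed.

(** With a, b, c, d the values of [v] at the corners, d differs from b + c - a by the mixed
    difference of [v]. The mixed difference of f(v) is therefore a parallelogram difference of [f],
    of size K^2 p q, plus an increment of [f] of size K p q. *)
Lemma Ck_comp_regular (K : R) : 0 <= K -> f 0 = 0 -> exists G, [/\ 0 <= G,
  forall x y, `|x| <= K + 1 -> `|y| <= K + 1 -> `|f x - f y| <= G * `|x - y| &
  forall v, regular K v -> [/\ forall x, `|f (v x)| <= G,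
    forall x y, `|f (v x) - f (v y)| <= G * `|x - y| &
    forall x p q, 0 <= p -> 0 <= q ->
     `|f (v x) - f (v (x + p)) - f (v (x + q)) + f (v (x + p + q))| <= G * (p * q)]].
Proof.
move=> K0 f0; have r0 : 0 <= 3 * K + 1 by lra.
(* The radius 3K + 1 contains the ball of radius K + 1, where numerical values will live, and the
   corner b + c - a, of modulus at most 3K. *)
have [Kf [Kf0 df H1 H2]] := Ck_lipschitz r0.
pose G := Kf * (K ^+ 2 + K + 1).
have K20 := sqr_ge0 K.
have G0 : 0 <= G by apply: mulr_ge0 => //; lra.
have KfG : Kf <= G by rewrite /G -[leLHS]mulr1 ler_wpM2l//; lra.
have KfKG : Kf * K <= G by rewrite /G ler_wpM2l//; lra.
exists G; split=> // [x y xK yK|v [vB vL vP _]].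
  by rewrite (le_trans (H1 x y _ _)) ?ler_wpM2r//; lra.
have vB' x : `|v x| <= 3 * K + 1 by have := vB x; lra.
have lip x y : `|f (v x) - f (v y)| <= G * `|x - y|.
  rewrite (le_trans (H1 _ _ (vB' x) (vB' y)))//.
  by rewrite (le_trans (ler_wpM2l Kf0 (vL x y)))// mulrA ler_wpM2r.
split=> // [x|x p q p0 q0].
  have n0 : `|0 : R| <= 3 * K + 1 by rewrite normr0.
  have := H1 _ _ (vB' x) n0; rewrite f0 !subr0 => /le_trans; apply.
  by rewrite (le_trans _ KfKG)// ler_wpM2l.
set a := v x; set b := v (x + p); set c := v (x + q); set d := v (x + p + q).
have e1 : `|b - a| <= K * p.
  by rewrite (le_trans (vL _ _))// (_ : x + p - x = p) ?ger0_norm//; ring.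
have e2 : `|c - a| <= K * q.
  by rewrite (le_trans (vL _ _))// (_ : x + q - x = q) ?ger0_norm//; ring.
have e3 := vP x p q p0 q0; rewrite -/a -/b -/c -/d in e3.
have z3 : `|a + (b - a) + (c - a)| <= 3 * K + 1.
  have := vB x; have := vB (x + p); have := vB (x + q); rewrite -/a -/b -/c !ler_norml.
  by move=> /andP[? ?] /andP[? ?] /andP[? ?]; apply/andP; split; lra.
have zb : a + (b - a) = b by ring.
have zc : a + (c - a) = c by ring.
have := parallelogram_le df H2 (vB' x) (_ : `|a + (b - a)| <= _) (_ : `|a + (c - a)| <= _) z3.
rewrite -/a zb zc => /(_ (vB' _) (vB' _)) P.
have zd : `|d - (b + (c - a))| <= K * (p * q).
  by rewrite (_ : d - (b + (c - a)) = a - b - c + d)//; ring.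
have z4 : `|b + (c - a)| <= 3 * K + 1 by rewrite -{1}zb.
have Q := H1 _ _ (vB' (x + p + q)) z4; rewrite -/d in Q.
have -> : f a - f b - f c + f d = (f a - f b - f c + f (b + (c - a))) + (f d - f (b + (c - a))).
  by ring.
rewrite (le_trans (ler_normD _ _))// (le_trans (lerD P Q))//.
have pq0 : 0 <= p * q by exact: mulr_ge0.
have h1 : Kf * `|c - a| * `|b - a| <= Kf * (K * q) * (K * p).
  by rewrite ler_pM// ?mulr_ge0// ler_wpM2l.
have h2 : Kf * `|d - (b + (c - a))| <= Kf * (K * (p * q)) by rewrite ler_wpM2l.
apply: (le_trans (lerD h1 h2)).
have -> : Kf * (K * q) * (K * p) + Kf * (K * (p * q)) = Kf * (K ^+ 2 + K) * (p * q) by ring.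
by rewrite ler_wpM2r// /G ler_wpM2l// lerDl.
Qed.

End Nonlinearity.

Section VelocityContinuity.
Context {R : realType}.
Local Notation mu := (@lebesgue_measure R).

(** Reflecting the integration variable puts the point into [g], whose Lipschitz bound then passes
    to the convolution. *)
Lemma kconv_lipschitz (da g : R -> R) (G x y : R) : integ da -> continuous g ->
  (forall x, `|g x| <= G) -> (forall x y, `|g x - g y| <= G * `|x - y|) ->
  `|kconv da g x - kconv da g y| <= Rint (fun z => `|da z|) * G * `|x - y|.
Proof.
move=> ida cg gB gL.
have cgx z : continuous (fun t => g (z - t)).
  move=> t; apply: (@continuous_comp _ _ _ (fun t => z - t) g); last exact: cg.
  by apply: cvgB; [exact: cvg_cst|exact: cvg_id].
have ii z : integ (fun t => da t * g (z - t)).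
  apply: (@integ_measurable_le _ _ (fun t => G * `|da t|)).
  - apply: measurable_funM; first exact: integ_measurable.
    by apply: continuous_measurable_fun; exact: cgx.
  - by apply: integZl; exact: integ_norm.
  - by move=> t; rewrite normrM mulrC ler_wpM2r.
have E z : kconv da g z = Rint (fun t => da t * g (z - t)).
  rewrite -[RHS](Rint_reflect z (ii z)); congr Rint; apply/funext => t.
  by congr (_ * g _); ring.
rewrite !E -RintB// -mulrA mulrC -RintZl; last exact: integ_norm.
apply: norm_Rint_le.
- by apply: integ_measurable; exact: integB.
- by apply: integZl; exact: integ_norm.
move=> t; rewrite -mulrBr normrM mulrC ler_wpM2r//.
by rewrite (le_trans (gL _ _))// (_ : x - t - (y - t) = x - y)//; ring.
Qed.

Lemma mconv_lipschitz (m1 m2 : {finite_measure set R -> \bar R}) (K x y : R) (v : R -> R) :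
  regular K v -> `|mconv m1 m2 v x - mconv m1 m2 v y| <= K * (mass m1 + mass m2) * `|x - y|.
Proof.
move=> rv; have [vB vL _ _] := rv; have cv := regular_continuous rv.
have mv (z : R) : measurable_fun setT (fun t : R => v (z - t)).
  apply: continuous_measurable_fun => t.
  apply: (@continuous_comp _ _ _ (fun t : R => z - t) v); last exact: cv.
  by apply: cvgB; [exact: cvg_cst|exact: cvg_id].
have H (m : {finite_measure set R -> \bar R}) : `|Rintegral m setT (fun t : R => v (x - t)) -
    Rintegral m setT (fun t : R => v (y - t))| <= K * `|x - y| * mass m.
  have iz (z : R) : m.-integrable setT (EFin \o (fun t : R => v (z - t))).
    by apply: (@integrable_bounded _ m _ K).
  rewrite -(RintegralB measurableT (iz x) (iz y)).
  apply: norm_Rintegral_bounded; first exact: measurable_funB.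
  by move=> t; rewrite (le_trans (vL _ _))// (_ : x - t - (y - t) = x - y)//; ring.
have := H m1; have := H m2; rewrite /mconv !ler_norml => /andP[? ?] /andP[? ?].
by apply/andP; split; lra.
Qed.

End VelocityContinuity.

(** * Stability and consistency of the scheme *)

Section GridSums.
Context {R : realType}.

Definition on_grid (N : nat) (j : int) : Prop := - (N%:Z) <= j <= N%:Z.

Lemma on_grid_shift N (k : nat) : (k < (2 * N).+1)%N -> on_grid N (k%:Z - N%:Z).
Proof. by rewrite /on_grid => h; apply/andP; split; lia. Qed.

Lemma grid_index N j : on_grid N j ->
  (`|(j + N%:Z)%R|%N < (2 * N).+1)%N /\ (`|(j + N%:Z)%R|%N)%:Z - N%:Z = j.
Proof. by rewrite /on_grid => /andP[h1 h2]; split; lia. Qed.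

Lemma isum_norm_le N (a x : int -> R) (S b : R) : isum N (fun j => `|a j|) <= S ->
  (forall j, on_grid N j -> `|x j| <= b) -> `|isum N (fun j => a j * x j)| <= S * b.
Proof.
move=> aS xb.
have b0 : 0 <= b.
  by apply: (le_trans (normr_ge0 (x (0%:Z - N%:Z)))); apply: xb; exact: on_grid_shift.
apply: le_trans (ler_wpM2r b0 aS); rewrite /isum big_distrl /=.
apply: (le_trans (ler_norm_sum _ _ _)); apply: ler_sum => k _.
by rewrite normrM ler_wpM2l// xb//; exact: on_grid_shift.
Qed.

Lemma isumB N (F G : int -> R) : isum N F - isum N G = isum N (fun j => F j - G j).
Proof. by rewrite /isum -sumrB. Qed.

End GridSums.

Section Scheme.
Context {R : realType}.
Variables (da d2a : R -> R) (mu1 mu2 : {finite_measure set R -> \bar R}) (kappa h : R) (N : nat).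
Hypotheses (cda : continuous da) (ida : integ da) (id2a : integ d2a)
  (wda : weak_deriv da d2a) (c2 : cond_C2 d2a mu1 mu2)
  (k0 : 0 < kappa) (h0 : 0 < h) (h1 : h <= 1).

Let mV := Rint (fun y => `|d2a y|).
Let mA := Rint (fun y => `|da y|).
Let mM := mass mu1 + mass mu2.
Let S1 := mA + 3 * mV.
Let S2 := 4 * mM.

Lemma isum_kernel_le (x : int -> R) (b : R) i : (forall j, on_grid N j -> `|x j| <= b) ->
  `|isum N (fun j => h * da ((i - j)%:~R * h) * x j)| <= S1 * b.
Proof.
apply: isum_norm_le.
apply: le_trans (kernel_sum_bound cda ida id2a wda (i%:~R * h + N%:R * h) (2 * N).+1 h0 h1).
rewrite /isum; apply: ler_sum => k _.
by rewrite normrM (gtr0_norm h0) grid_diff opprD opprK addrA.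
Qed.

Lemma isum_D2_le (x : int -> R) (b : R) i : (forall j, on_grid N j -> `|x j| <= b) ->
  `|isum N (fun j => h * D2h h da (i - j) * x j)| <= S2 * b.
Proof.
apply: isum_norm_le.
apply: le_trans (kernel_D2_sum_bound cda wda c2 (i%:~R * h + N%:R * h) (2 * N).+1 h0).
rewrite /isum; apply: ler_sum => k _.
rewrite normrM (gtr0_norm h0) /D2h; set m := i - _.
have -> : (m + 1)%:~R * h = m%:~R * h + h by rewrite intrD; ring.
have -> : (m - 1)%:~R * h = m%:~R * h - h by rewrite intrB; ring.
by rewrite grid_diff opprD opprK addrA.
Qed.

(** Two nonlinearities are allowed because the exact solution is inserted with [f] and the numerical
    one with its clamped replacement. *)
Lemma semi_rhs_diff (F F' : R -> R) (v v' : int -> R) (b b' : R) i :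
  (forall j, on_grid N j -> `|F (v j) - F' (v' j)| <= b') ->
  (forall j, on_grid N j -> `|v j - v' j| <= b) ->
  `|semi_rhs kappa h da F N v i - semi_rhs kappa h da F' N v' i| <= S1 * b' + kappa * S2 * b.
Proof.
move=> Fb vb; have p1 := isum_kernel_le i Fb; have p2 := isum_D2_le i vb.
have e1 : isum N (fun j => h * da ((i - j)%:~R * h) * F (v j)) -
    isum N (fun j => h * da ((i - j)%:~R * h) * F' (v' j)) =
    isum N (fun j => h * da ((i - j)%:~R * h) * (F (v j) - F' (v' j))).
  by rewrite isumB; congr isum; apply/funext => j; rewrite mulrBr.
have e2 : isum N (fun j => h * D2h h da (i - j) * v j) -
    isum N (fun j => h * D2h h da (i - j) * v' j) =
    isum N (fun j => h * D2h h da (i - j) * (v j - v' j)).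
  by rewrite isumB; congr isum; apply/funext => j; rewrite mulrBr.
rewrite -e1 in p1; rewrite -e2 in p2; rewrite /semi_rhs -mulrA.
have p3 := ler_wpM2l (ltW k0) p2.
rewrite -[X in X * `|_|](gtr0_norm k0) -normrM mulrBr in p3.
apply: le_trans (lerD p1 p3); apply: le_trans (ler_normD _ _); rewrite -normrN.
by rewrite le_eqVlt; apply/orP; left; apply/eqP; congr (`| _ |); ring.
Qed.

(** In the coefficient of eta, mA is the tail of the convolution, |da 0| + mV bounds the kernel at
    the end nodes, and 2 kappa mM comes from interpolation beyond the grid. *)
Lemma semi_truncation (f v : R -> R) (K G eta : R) i :
  0 <= G -> regular K v -> (forall x, `|f (v x)| <= G) ->
  (forall x y, `|f (v x) - f (v y)| <= G * `|x - y|) ->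
  (forall x p q : R, 0 <= p -> 0 <= q ->
     `|f (v x) - f (v (x + p)) - f (v (x + q)) + f (v (x + p + q))| <= G * (p * q)) ->
  (0 < N)%N -> 0 <= eta ->
  (forall y, N%:R * h <= `|y| -> `|v y| <= eta /\ `|f (v y)| <= eta) ->
  `|- kconv da (fun y => f (v y)) (i%:~R * h) - kappa * mconv mu1 mu2 v (i%:~R * h)
    - semi_rhs kappa h da f N (fun j => v (j%:~R * h)) i| <=
  (quadrature_const da d2a mu1 mu2 G G G + kappa * (mM * K)) * h ^+ 2 +
  (mA + (`|da 0| + mV) + 2 * kappa * mM) * eta.
Proof.
move=> G0 rv f0 f1 f2 N0 eta0 tail; have [v0 _ _ v3] := rv.
have K0 : 0 <= K by exact: le_trans (v0 0).
have cv := regular_continuous rv.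
have cf : continuous (fun y => f (v y)) by exact: lipschitz_continuous f1.
have p1 := conv_quadrature cda ida id2a wda c2 i cf f0 f1 f2 G0 G0 h0 h1 eta0
  (fun y hy => (tail y hy).2).
have p2 := mconv_interpolation cda wda c2 i cv v0 (v3 h) K0 h0 N0 eta0
  (fun y hy => (tail y hy).1).
have p3 := ler_wpM2l (ltW k0) p2.
rewrite -[X in X * `|_|](gtr0_norm k0) -normrM mulrBr in p3.
rewrite /semi_rhs -normrN.
set a := kconv _ _ _ in p1 *; set b := isum _ _ in p1 *.
set c := kappa * mconv _ _ _ _ in p3 *; set d := kappa * isum _ _ in p3 *.
have -> : - (- a - c - (- b - d)) = (a - b) + (c - d) by ring.
apply: (le_trans (ler_normD _ _)); apply: (le_trans (lerD p1 p3)).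
rewrite le_eqVlt; apply/orP; left; apply/eqP; rewrite /mA /mV /mM; ring.
Qed.

End Scheme.

(** * Existence and error of the semidiscrete solution *)

Section SchemeDynamics.
Context {R : realType}.
Variables (da d2a : R -> R) (mu1 mu2 : {finite_measure set R -> \bar R}) (kappa h T : R) (N : nat).
Hypotheses (cda : continuous da) (ida : integ da) (id2a : integ d2a)
  (wda : weak_deriv da d2a) (c2 : cond_C2 d2a mu1 mu2)
  (k0 : 0 < kappa) (h0 : 0 < h) (h1 : h <= 1) (T0 : 0 < T).

Let mV := Rint (fun y => `|d2a y|).
Let mA := Rint (fun y => `|da y|).
Let mM := mass mu1 + mass mu2.
Let S1 := mA + 3 * mV.
Let S2 := 4 * mM.

Lemma abs_Rint_ge0 (g : R -> R) : 0 <= Rint (fun y => `|g y|).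
Proof. by apply: Rint_ge0 => x; exact: normr_ge0. Qed.

Lemma rate_ge0 G : 0 <= G -> 0 <= S1 * G + kappa * S2.
Proof.
move=> G0; apply: addr_ge0; apply: mulr_ge0 => //; last 2 first.
- exact: ltW.
- by apply: mulr_ge0 => //; apply: addr_ge0; exact: mass_ge0.
by apply: addr_ge0; [|apply: mulr_ge0 => //]; exact: abs_Rint_ge0.
Qed.

Lemma semi_sol_exists (F phi : R -> R) (G : R) : 0 <= G ->
  (forall x y, `|F x - F y| <= G * `|x - y|) ->
  exists v, semi_sol kappa h T da F phi N v.
Proof.
(* The added 1 makes the Lipschitz constant strictly positive, as Picard iteration requires. *)
move=> G0 FG; pose L := S1 * G + kappa * S2 + 1.
have A0 := rate_ge0 G0; have L0 : 0 < L by rewrite /L; lra.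
pose ext (v : nat -> R) (j : int) := v `|(j + N%:Z)%R|%N.
pose V (v : nat -> R) (k : nat) := semi_rhs kappa h da F N (ext v) (k%:Z - N%:Z).
have VL (v w : nat -> R) (b : R) : (forall j, (j < (2 * N).+1)%N -> `|v j - w j| <= b) ->
    forall i, (i < (2 * N).+1)%N -> `|V v i - V w i| <= L * b.
  move=> vb i hi.
  have b0 : 0 <= b by exact: le_trans (vb 0%N isT).
  have eb j : on_grid N j -> `|ext v j - ext w j| <= b by move=> /grid_index[jn _]; exact: vb.
  have fb j : on_grid N j -> `|F (ext v j) - F (ext w j)| <= G * b.
    by move=> /eb e; rewrite (le_trans (FG _ _))// ler_wpM2l.
  have := semi_rhs_diff cda ida id2a wda c2 k0 h0 h1 (i%:Z - N%:Z) fb eb.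
  move=> /le_trans; apply.
  have -> : L * b = S1 * (G * b) + kappa * S2 * b + b by rewrite /L; ring.
  by rewrite lerDl.
have [v [v0 dv]] := picard (fun k => phi ((k%:Z - N%:Z)%:~R * h)) T0 L0 VL.
exists (fun t => ext (v t)); split => i /grid_index[iN iE].
- by rewrite /ext v0// iE.
- by move=> t tT; have := dv _ iN t tT; rewrite /V iE.
Qed.

(** While the error is at most 1, numerical values stay in the ball of radius K + 1, where [F] and
    [f] agree. The statement thus covers both the original system and the clamped one. *)
Lemma scheme_error (f F phi : R -> R) (u w : R -> R -> R) (v : R -> int -> R) (K G tau delta : R) :
  0 <= G -> 0 <= tau -> tau < delta ->
  delta * expR ((S1 * G + kappa * S2 + 1) * T) <= 1 ->
  (forall x y, `|x| <= K + 1 -> `|y| <= K + 1 -> `|f x - f y| <= G * `|x - y|) ->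
  (forall x, `|x| <= K + 1 -> F x = f x) ->
  (forall x, u 0 x = phi x) ->
  (forall t, 0 <= t <= T -> forall x, `|u t x| <= K) ->
  (forall t, 0 <= t <= T -> forall x, deriv_on T (fun t => u t x) t (w t x)) ->
  (forall t, 0 <= t <= T -> forall i,
     `|w t (i%:~R * h) - semi_rhs kappa h da f N (fun j => u t (j%:~R * h)) i| <= tau) ->
  semi_sol kappa h T da F phi N v ->
  forall t, 0 <= t <= T -> forall i, on_grid N i ->
    `|u t (i%:~R * h) - v t i| <= delta * expR ((S1 * G + kappa * S2 + 1) * t).
Proof.
move=> G0 tau0 taud dT fG Ff u0 uK du tr [v0 dv] t tT i iN.
pose e (t : R) (k : nat) := u t ((k%:Z - N%:Z)%:~R * h) - v t (k%:Z - N%:Z).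
have [kN <-] := grid_index iN.
apply: (@gronwall_barrier _ (2 * N).+1 T (S1 * G + kappa * S2) tau delta e (ltW T0)
  (rate_ge0 G0) tau0 taud dT) => //.
  by move=> k /on_grid_shift kk; rewrite /e u0 v0// subrr.
move=> k /on_grid_shift kk s sT.
exists (w s ((k%:Z - N%:Z)%:~R * h) - semi_rhs kappa h da F N (v s) (k%:Z - N%:Z)); split.
  by apply: deriv_onB; [exact: du|move=> ep ep0; exact: dv].
move=> b b1 eb.
have gb j : on_grid N j -> `|u s (j%:~R * h) - v s j| <= b.
  by move=> /grid_index[jN jE]; have := eb _ jN; rewrite /e jE.
have b0 : 0 <= b by exact: le_trans (gb _ kk).
have fb j : on_grid N j -> `|f (u s (j%:~R * h)) - F (v s j)| <= G * b.
  move=> jN; have g := gb j jN; have uj := uK s sT (j%:~R * h).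
  have vj : `|v s j| <= K + 1.
    have := ler_distD 0 (v s j) (u s (j%:~R * h)).
    by have := lerB_dist (v s j) (u s (j%:~R * h)); rewrite distrC; lra.
  rewrite Ff// (le_trans (fG _ _ _ vj))//; first by lra.
  by rewrite ler_wpM2l.
have p1 := semi_rhs_diff cda ida id2a wda c2 k0 h0 h1 (k%:Z - N%:Z) fb gb.
have p2 := tr s sT (k%:Z - N%:Z).
set a := semi_rhs _ _ _ f _ _ _ in p1 p2.
rewrite (_ : w s _ - _ = (w s ((k%:Z - N%:Z)%:~R * h) - a) + (a - semi_rhs kappa h da F N (v s) (k%:Z - N%:Z))); last by ring.
apply: (le_trans (ler_normD _ _)); apply: (le_trans (lerD p2 p1)).
rewrite le_eqVlt; apply/orP; left; apply/eqP; rewrite /S1 /S2 /mA /mV /mM; ring.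
Qed.

End SchemeDynamics.

(** * Clamping and the convergence theorem *)

Section Clamp.
Context {R : realType}.

Definition clamp (r x : R) : R := Num.max (- r) (Num.min x r).

Lemma clamp_norm (r x : R) : 0 <= r -> `|clamp r x| <= r.
Proof.
move=> r0; rewrite /clamp ler_norml le_max lexx /= ge_max ge_min lexx orbT andbT.
by rewrite ge0_cp.
Qed.

Lemma clamp_id (r x : R) : `|x| <= r -> clamp r x = x.
Proof. by rewrite ler_norml /clamp => /andP[a b]; rewrite (min_idPl b) (max_idPr a). Qed.

Lemma clamp_dist (r x y : R) : `|clamp r x - clamp r y| <= `|x - y|.
Proof.
apply: le_trans (min_dist x y r); rewrite /clamp; set a := Num.min x r; set b := Num.min y r.
have n1 := ler_norm (a - b); have n2 := ler_norm (b - a); rewrite distrC in n2.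
by case: (leP (- r) a) => h1; case: (leP (- r) b) => h2; rewrite ?subrr ?normr0//
  ler_norml; apply/andP; split; lra.
Qed.

End Clamp.

Theorem theorem4p2 (R : realType) (kappa s T : R)
  (alpha da d2a : R -> R) (mu1 mu2 : {finite_measure set R -> \bar R})
  (f phi : R -> R) (u : R -> R -> R) :
  0 < kappa ->
  cond_C1 alpha da d2a ->
  cond_C2 d2a mu1 mu2 ->
  9 / 2 < s ->
  Ck (Num.truncn s).+1 f ->
  f 0 = 0 ->
  0 < T ->
  in_Hs s phi ->
  (* u in C^1([0,T], H^s(R)) solves u_t + alpha' * f(u) + kappa alpha''' * u = 0,
     u(.,0) = phi; u(t,.) is the continuous representative *)
  (forall t, continuous (u t)) ->
  (forall x, u 0 x = phi x) ->
  Hs_cont s T u ->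
  (exists w : R -> R -> R,
     Hs_cont s T w /\ Hs_deriv s T u w /\
     forall t, 0 <= t <= T -> forall x,
       w t x + kconv da (fun y => f (u t y)) x + kappa * mconv mu1 mu2 (u t) x = 0) ->
  exists C : R, exists h0 : R, 0 < h0 /\
    forall h eps : R, 0 < h -> h < h0 -> 0 < eps ->
    exists N : nat, (0 < N)%N /\
      (exists v, semi_sol kappa h T da f phi N v) /\
      forall v, semi_sol kappa h T da f phi N v ->
        forall t, 0 <= t <= T -> forall i : int, - (N%:Z) <= i <= N%:Z ->
          `|u t (i%:~R * h) - v t i| <= C * (h ^+ 2 + eps).
Proof.
move=> k0 [_ [ida [id2a [_ [wda cda]]]]] c2 s92 Cf f0 T0 _ cu u0 hu [w [_ [dw eqw]]].
have s3 : 3 <= s by lra.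
have k3 : (3 <= (Num.truncn s).+1)%N by rewrite ltnS truncn_ge_nat; lra.
have [K hK] := evolution_regular s3 T0 cu hu.
have T00 : 0 <= (0 : R) <= T by rewrite lexx ltW.
have K0 : 0 <= K by have [H _ _ _] := hK 0 T00; exact: le_trans (H 0).
have [G [G0 fG fr]] := Ck_comp_regular k3 Cf K0 f0.
pose mA := Rint (fun y => `|da y|); pose mV := Rint (fun y => `|d2a y|).
pose mM := mass mu1 + mass mu2.
have mA0 : 0 <= mA by exact: abs_Rint_ge0.
have mV0 : 0 <= mV by exact: abs_Rint_ge0.
have mM0 : 0 <= mM by apply: addr_ge0; exact: mass_ge0.
have wE t : 0 <= t <= T -> w t = fun x =>
    - kconv da (fun y => f (u t y)) x - kappa * mconv mu1 mu2 (u t) x.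
  by move=> tT; apply/funext => x; have := eqw t tT x; lra.
(* H^s bounds see [w t] only up to null sets; the pointwise equation shows that it is the continuous
   representative, since both convolutions are Lipschitz. *)
have cw t : 0 <= t <= T -> continuous (w t).
  move=> tT; have [fb fl _] := fr _ (hK t tT).
  have cf : continuous (fun y => f (u t y)) by exact: lipschitz_continuous fl.
  apply: (@lipschitz_continuous _ _ (mA * G + kappa * (K * mM))) => x y.
  have p1 := kconv_lipschitz x y ida cf fb fl.
  have p2 := ler_wpM2l (ltW k0) (mconv_lipschitz mu1 mu2 x y (hK t tT)).
  rewrite -[X in X * `|_|](gtr0_norm k0) -normrM mulrBr in p2.
  rewrite wE// mulrDl -[kappa * _ * _]mulrA; apply: le_trans (lerD p1 p2).
  apply: le_trans (ler_normD _ _); rewrite -normrN.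
  by rewrite le_eqVlt; apply/orP; left; apply/eqP; congr (`| _ |); ring.
have du t : 0 <= t <= T -> forall x, deriv_on T (fun t => u t x) t (w t x).
  by move=> tT x; apply: (@evolution_derivative R s T u w s3 cu t x tT dw (cw t tT)).
pose A := (mA + 3 * mV) * G + kappa * (4 * mM); pose E := expR ((A + 1) * T).
have A0 : 0 <= A by exact: rate_ge0.
have E1 : 1 <= E by rewrite -expR0 ler_expR mulr_ge0// ?ltW//; lra.
pose C1 := quadrature_const da d2a mu1 mu2 G G G + kappa * (mM * K).
pose C2 := mA + (`|da 0| + mV) + 2 * kappa * mM.
have C10 : 0 <= C1.
  apply: addr_ge0; last by do !apply: mulr_ge0 => //; exact: ltW.
  by rewrite /quadrature_const; apply: mulr_ge0 => //; do !apply: addr_ge0;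
    do !apply: mulr_ge0.
have C20 : 0 <= C2 by do !apply: addr_ge0 => //; do !apply: mulr_ge0 => //; exact: ltW.
(* Below these thresholds (C1 + 1) h^2 E and (C2 + 1) eta E are at most 1/2 each, the former because
   h^2 <= h. Their sum is [delta * E]. *)
pose r1 := 1 / (2 * (C1 + 1) * E); pose r2 := 1 / (2 * (C2 + 1) * E).
have d1 : 0 < 2 * (C1 + 1) * E by apply: mulr_gt0; lra.
have d2 : 0 < 2 * (C2 + 1) * E by apply: mulr_gt0; lra.
have r10 : 0 < r1 by rewrite divr_gt0.
have r20 : 0 < r2 by rewrite divr_gt0.
exists ((C1 + C2 + 2) * E), (Num.min 1 r1); split; first by rewrite lt_min ltr01.
move=> h eps h0; rewrite lt_min => /andP[/ltW h1 hr] eps0.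
(* Here eps is arbitrary, while the barrier needs a small tail; the cap reconciles the two. *)
pose eta := Num.min eps r2.
have eta0 : 0 < eta by rewrite lt_min eps0.
have eta_eps : eta <= eps by rewrite ge_min lexx.
have eta_r : eta <= r2 by rewrite ge_min lexx orbT.
(* Makes both |u| and |f(u)| <= G |u| at most eta in the tail. *)
have eG : 0 < eta / (G + 1) by rewrite divr_gt0//; lra.
have [B hB] := evolution_decay s3 T0 cu hu eG.
pose N := (Num.truncn (B / h)).+1.
have NB : B <= N%:R * h by rewrite -ler_pdivrMr// ltW// truncnS_gt.
have tail t (y : R) : 0 <= t <= T -> N%:R * h <= `|y| -> `|u t y| <= eta /\ `|f (u t y)| <= eta.
  move=> tT yN; have uy := hB t tT y (le_trans NB yN).
  have [uK _ _ _] := hK t tT.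
  have := fG (u t y) 0 (le_trans (uK y) _) _; rewrite f0 !subr0 normr0 => fy.
  have {}fy : `|f (u t y)| <= G * `|u t y| by apply: fy; lra.
  move: uy; rewrite ler_pdivlMr; last by lra.
  have un := normr_ge0 (u t y); have := mulr_ge0 G0 un; rewrite mulrDr mulr1 (mulrC _ G) => gu uG.
  by split; [|apply: (le_trans fy)]; clear -uG gu un; lra.
have tr t : 0 <= t <= T -> forall i, `|w t (i%:~R * h) -
    semi_rhs kappa h da f N (fun j => u t (j%:~R * h)) i| <= C1 * h ^+ 2 + C2 * eta.
  move=> tT i; have [fb fl fp] := fr _ (hK t tT); rewrite wE//.
  apply: (semi_truncation cda ida id2a wda c2 k0 h0 h1 i G0 (hK t tT) fb fl fp) => //.
    exact: ltW.
  by move=> y; exact: tail.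
(* The unit added to each constant makes [delta] strictly larger than the truncation error, as the
   barrier requires. *)
pose delta := (C1 + 1) * h ^+ 2 + (C2 + 1) * eta.
have h20 : 0 < h ^+ 2 by rewrite exprn_gt0.
have tau0 : 0 <= C1 * h ^+ 2 + C2 * eta.
  by apply: addr_ge0; apply: mulr_ge0 => //; exact: ltW.
have taud : C1 * h ^+ 2 + C2 * eta < delta by rewrite /delta; lra.
have dE : delta * E <= 1.
  have h2h : h ^+ 2 <= h by rewrite expr2 ler_piMl// ltW.
  have q1 : h ^+ 2 * (2 * (C1 + 1) * E) <= 1.
    by rewrite -ler_pdivlMr// (le_trans h2h)// ltW.
  have q2 : eta * (2 * (C2 + 1) * E) <= 1 by rewrite -ler_pdivlMr.
  by rewrite /delta; lra.
have err F v : (forall x, `|x| <= K + 1 -> F x = f x) -> semi_sol kappa h T da F phi N v ->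
    forall t, 0 <= t <= T -> forall i, on_grid N i ->
    `|u t (i%:~R * h) - v t i| <= delta * expR ((A + 1) * t).
  move=> Ff sol; apply: (scheme_error cda ida id2a wda c2 k0 h0 h1 T0 G0 tau0 taud dE fG Ff u0 _ du tr sol).
  by move=> t tT x; have [] := hK t tT.
have errE F v t i : (forall x, `|x| <= K + 1 -> F x = f x) -> semi_sol kappa h T da F phi N v ->
    0 <= t <= T -> on_grid N i -> `|u t (i%:~R * h) - v t i| <= delta * E.
  move=> Ff sol tT iN; apply: (le_trans (err F v Ff sol t tT i iN)).
  have /andP[t0 t1] := tT.
  by apply: ler_wpM2l; [rewrite ltW// (le_lt_trans tau0)|rewrite ler_expR ler_wpM2l//; lra].
exists N; split => //; split; last first.
  move=> v sol t tT i iN; apply: (le_trans (errE f v t i _ sol tT iN)) => //.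
  rewrite mulrAC; apply: ler_wpM2r; first by lra.
  have := mulr_ge0 C10 (ltW eps0); have := mulr_ge0 C20 (ltW h20).
  have := ler_wpM2l C20 eta_eps; rewrite /delta; lra.
(* This [F] is globally Lipschitz, so its system is solvable on [0, T]; the error bound then keeps
   the solution in the ball where [F] is [f], and it solves the original system. *)
pose F x := f (clamp (K + 1) x).
have K1 : 0 <= K + 1 by lra.
have Ff x : `|x| <= K + 1 -> F x = f x by move=> xK; rewrite /F clamp_id.
have [|v sol] := @semi_sol_exists _ _ _ _ _ kappa h T N cda ida id2a wda c2 k0 h0 h1 T0 F phi G G0.
  move=> x y; apply: (le_trans (fG _ _ (clamp_norm _ K1) (clamp_norm _ K1))).
  by rewrite ler_wpM2l// clamp_dist.
have vK t i : 0 <= t <= T -> on_grid N i -> F (v t i) = f (v t i).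
  move=> tT iN; have vE := errE F v t i Ff sol tT iN; apply: Ff; move: vE.
  have [uK _ _ _] := hK t tT; have := uK (i%:~R * h).
  by have := lerB_dist (v t i) (u t (i%:~R * h)); rewrite distrC; lra.
exists v; split; first exact: sol.1.
move=> i iN t tT e e0; have [d [d0 hd]] := sol.2 i iN t tT e e0; exists d; split => //.
suff <- : semi_rhs kappa h da F N (v t) i = semi_rhs kappa h da f N (v t) i by [].
rewrite /semi_rhs; congr (- _ - _); rewrite /isum; apply: eq_bigr => k _.
by rewrite vK//; exact: on_grid_shift.
Qed.
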